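(* Let $\varphi\in L^2(\mathbb{R})$ and $a>0$. The sequence of translates $\mathcal{T}(\varphi,a)=\{\varphi_n\}_{n\in\mathbb{Z}}$, $\varphi_n(x)=\varphi(x-na)$, is a lower semi-frame of its closed span $\langle\varphi\rangle=\overline{\mathrm{span}}(\{\varphi_n\}_{n\in\mathbb{Z}})$ if and only if $p_\varphi$ is bounded away from zero a.e. in $Z_\varphi:=\{\gamma\in[0,1):p_\varphi(\gamma)>0\}$, i.e. there exists $A>0$ such that $p_\varphi(\gamma)\ge A$ for a.e. $\gamma\in Z_\varphi$. In this case, the canonical Bessel dual of $\mathcal{T}(\varphi,a)$ is $\mathcal{T}(\psi,a)=\{\psi(\cdot-na)\}_{n\in\mathbb{Z}}$, where $\psi$ is the inverse Fourier transform of the function $\widehat\varphi\,\chi_{Z_\varphi}/p_\varphi$, with the meaning $$(\widehat\varphi\,\chi_{Z_\varphi}/p_\varphi)(\gamma):=\frac{\widehat\varphi(\gamma)}{p_\varphi(\gamma)}\ \text{ if }\gamma\in Z_\varphi,\qquad (\widehat\varphi\,\chi_{Z_\varphi}/p_\varphi)(\gamma):=0\ \text{ if }\gamma\notin Z_\varphi.$$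
   Context: The Fourier transform is $\widehat f(\gamma)=\int_{\mathbb{R}}f(x)e^{-2\pi i x\gamma}\,dx$ for $f\in L^1(\mathbb R)$, extended to a unitary operator on $L^2(\mathbb{R})$. The function $p_\varphi$ is $p_\varphi(\gamma)=\frac1a\sum_{n\in\mathbb{Z}}\left|\widehat\varphi\left(\frac{\gamma+n}{a}\right)\right|^2$; it belongs to $L^1(0,1)$. $\chi_{Z_\varphi}$ is the characteristic function of $Z_\varphi$. Let $\mathcal{K}$ be a Hilbert space (inner product linear in the first variable) and $\xi=\{\xi_n\}_{n\in\mathbb{Z}}$ a sequence in $\mathcal{K}$. It is a lower semi-frame of $\mathcal{K}$ if there is $A>0$ with $A\|f\|^2\le\sum_n|\langle f,\xi_n\rangle|^2$ for all $f\in\mathcal{K}$ (the sum may be $+\infty$). Let $\mathcal{D}(C_\xi)=\{f\in\mathcal{K}:\sum_n|\langle f,\xi_n\rangle|^2<\infty\}$ and $\mathcal{K}_\xi=\overline{\mathcal{D}(C_\xi)}$. The generalized frame operator $T_\xi:\mathcal{D}(T_\xi)\subseteq\mathcal{K}_\xi\to\mathcal{K}_\xi$ has domain the set of $f\in\mathcal{D}(C_\xi)$ for which there is $h\in\mathcal{K}_\xi$ with $\sum_n\langle f,\xi_n\rangle\langle\xi_n,g\rangle=\langle h,g\rangle$ for all $g\in\mathcal{D}(C_\xi)$, and then $T_\xi f=h$. If $\xi$ is a lower semi-frame of $\mathcal{K}$, $T_\xi:\mathcal{D}(T_\xi)\to\mathcal{K}_\xi$ is bijective with bounded inverse, and the canonical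 (Bessel) dual of $\xi$ is the sequence $\{T_\xi^{-1}P\xi_n\}_{n\in\mathbb{Z}}$, where $P$ is the orthogonal projection of $\mathcal{K}$ onto $\mathcal{K}_\xi$. Here these notions are applied with $\mathcal{K}=\langle\varphi\rangle$.
   Formalization: In the formula for the transform of ψ, p_φ and χ_{Z_φ} are evaluated at aγ mod 1 instead of at γ (extended 1-periodically and rescaled by a); the displayed formula is false as written, e.g. for a=1 and φ̂=χ_[0,2). *)

(* Defs.v *)
From HB Require Import structures.
From mathcomp Require Import all_boot all_order all_algebra finmap.
From mathcomp Require Import complex.
From mathcomp Require Import all_classical all_reals all_analysis.
From mathcomp Require Import summability.

Set Implicit Arguments.
Unset Strict Implicit.
Unset Printing Implicit Defensive.
Import Order.TTheory GRing.Theory Num.Theory.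
Import numFieldNormedType.Exports.

Local Open Scope classical_set_scope.
Local Open Scope complex_scope.
Local Open Scope ring_scope.

Notation normc := ComplexField.Normc.normc.

(* The notions below are relative to a subset K of a Z-module V with an inner
   product ip, linear in its first variable. For K inside L^2(R), V is a space
   of functions rather than of a.e.-classes: ip is only semi-definite and
   vectors at distance 0 play the role of equal vectors, so an operator is
   given by its graph. *)

Definition hnorm (R : realType) (V : zmodType) (ip : V -> V -> R[i]) (f : V)
    : R :=
  Num.sqrt (complex.Re (ip f f)).

Definition hclosure (R : realType) (V : zmodType) (ip : V -> V -> R[i])
    (K S : set V) : set V :=
  [set f | K f /\
    forall e : R, 0 < e -> exists g, S g /\ hnorm ip (f - g) < e].

Definition analysis_sum (R : realType) (V : zmodType) (ip : V -> V -> R[i])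
    (xi : int -> V) (f : V) : \bar R :=
  (\esum_(n in [set: int]) ((normc (ip f (xi n))) ^+ 2)%:E)%E.

Definition lower_semi_frame (R : realType) (V : zmodType)
    (ip : V -> V -> R[i]) (K : set V) (xi : int -> V) : Prop :=
  (forall n, K (xi n)) /\
  exists A : R, 0 < A /\
    forall f, K f -> ((A * hnorm ip f ^+ 2)%:E <= analysis_sum ip xi f)%E.

Definition dom_C (R : realType) (V : zmodType) (ip : V -> V -> R[i])
    (K : set V) (xi : int -> V) : set V :=
  [set f | K f /\ (analysis_sum ip xi f < +oo)%E].

Definition K_xi (R : realType) (V : zmodType) (ip : V -> V -> R[i])
    (K : set V) (xi : int -> V) : set V :=
  hclosure ip K (dom_C ip K xi).

(* f \in D(T_xi) and T_xi f = h; the series over Z is summed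
   unconditionally. *)
Definition frame_op (R : realType) (V : zmodType) (ip : V -> V -> R[i])
    (K : set V) (xi : int -> V) (f h : V) : Prop :=
  [/\ dom_C ip K xi f, K_xi ip K xi h &
    forall g, dom_C ip K xi g ->
      partial_sum (fun n : int => (ip f (xi n) * ip (xi n) g : R[i]^o))
        @ totally --> (ip h g : R[i]^o)].

(* T_xi^-1 h = f *)
Definition frame_op_inv (R : realType) (V : zmodType) (ip : V -> V -> R[i])
    (K : set V) (xi : int -> V) (h f : V) : Prop :=
  frame_op ip K xi f h /\
  forall f', frame_op ip K xi f' h -> hnorm ip (f' - f) = 0.

Definition orth_proj (R : realType) (V : zmodType) (ip : V -> V -> R[i])
    (S : set V) (f p : V) : Prop :=
  S p /\ forall g, S g -> ip (f - p) g = 0.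

Definition canonical_dual (R : realType) (V : zmodType) (ip : V -> V -> R[i])
    (K : set V) (xi eta : int -> V) : Prop :=
  forall n, exists p,
    orth_proj ip (K_xi ip K xi) (xi n) p /\
    frame_op_inv ip K xi p (eta n).

Definition cmeasurable (R : realType) (f : R -> R[i]) : Prop :=
  measurable_fun [set: R] (fun x => complex.Re (f x)) /\
  measurable_fun [set: R] (fun x => complex.Im (f x)).

Definition cLnorm (R : realType) (p : \bar R) (f : R -> R[i]) : \bar R :=
  Lnorm (@lebesgue_measure R) p (fun x => (normc (f x))%:E).

Definition Lspc (R : realType) (p : \bar R) : set (R -> R[i]) :=
  [set f | cmeasurable f /\ (cLnorm p f < +oo)%E].

Definition cintegral (R : realType) (f : R -> R[i]) : R[i] :=
  Rintegral (@lebesgue_measure R) [set: R] (fun x => complex.Re (f x))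
  +i* Rintegral (@lebesgue_measure R) [set: R] (fun x => complex.Im (f x)).

Definition ip2 (R : realType) (f g : R -> R[i]) : R[i] :=
  cintegral (fun x => f x * conjc (g x)).

Definition expi (R : realType) (t : R) : R[i] := cos t +i* sin t.

Definition fourier1 (R : realType) (f : R -> R[i]) (gamma : R) : R[i] :=
  cintegral (fun x => f x * expi (- (2 * pi * x * gamma))).

(* Graph of the continuous extension to L^2 of the Fourier transform on the
   intersection of L^1 and L^2. *)
Definition is_fourier2 (R : realType) (f F : R -> R[i]) : Prop :=
  [/\ Lspc 2%:E f, Lspc 2%:E F &
    exists u : nat -> R -> R[i],
      [/\ forall k, Lspc 1%:E (u k) /\ Lspc 2%:E (u k),
          (fun k => cLnorm 2%:E (u k - f)) @ \oo --> 0%E &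
          (fun k => cLnorm 2%:E (fourier1 (u k) - F)) @ \oo --> 0%E]].

(* By Plancherel's theorem both are total on L^2; values are representatives
   of a.e.-classes. *)
Definition fourier (R : realType) (f : R -> R[i]) : R -> R[i] :=
  xget (fun=> 0) [set F | is_fourier2 f F].

Definition inv_fourier (R : realType) (F : R -> R[i]) : R -> R[i] :=
  xget (fun=> 0) [set f | is_fourier2 f F].

Definition translates (R : realType) (phi : R -> R[i]) (a : R) (n : int)
    : R -> R[i] :=
  fun x => phi (x - n%:~R * a).

Definition lin_span (R : realType) (xi : int -> R -> R[i])
    : set (R -> R[i]) :=
  [set f | exists (s : seq int) (c : int -> R[i]),
    f = fun x => \sum_(n <- s) c n * xi n x].

Definition closed_span (R : realType) (xi : int -> R -> R[i])
    : set (R -> R[i]) :=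
  hclosure (@ip2 R) (Lspc 2%:E) (lin_span xi).

Definition p_fun (R : realType) (phi : R -> R[i]) (a gamma : R) : \bar R :=
  (a^-1%:E * \esum_(n in [set: int])
     ((normc (fourier phi ((gamma + n%:~R) / a))) ^+ 2)%:E)%E.

Definition Z_set (R : realType) (phi : R -> R[i]) (a : R) : set R :=
  [set gamma | 0 <= gamma < 1 /\ (0 < p_fun phi a gamma)%E].

(* The Fourier transform of the n-th translate is exp(-2 pi i n a gamma) times
   that of phi, and p_phi collects the values of |fourier phi|^2 at the points
   (gamma + n) / a: the argument of p_phi and of the characteristic function of
   Z_phi, seen as 1-periodic functions, that corresponds to the frequency gamma
   is a * gamma modulo 1. *)
Definition dual_symbol (R : realType) (phi : R -> R[i]) (a gamma : R) : R[i] :=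
  let t := a * gamma - (Num.floor (a * gamma))%:~R in
  if `[< Z_set phi a t >] then fourier phi gamma / (fine (p_fun phi a t))%:C
  else 0.

(* Main.v *)
(* On the Fourier side an element of the closed span of the translates is
   [m(a y) Phi y], with [Phi = fourier phi] and [m] a 1-periodic symbol, and the
   frame coefficients of [f] are the Fourier coefficients of the bracket
   [B_f t = (1/a) sum_n (Phi conj(fourier f)) ((t + n) / a)]. By Parseval the
   analysis sum of [f] is the integral of [|B_f|^2] over [0, 1). For the symbol
   [m] the squared norm is the integral of [|m|^2 p] and [B_f = conj(m) p]; thus
   the lower bound [A] compares the integral of [|m|^2 p] with that of
   [|m|^2 p^2], which is possible for all [m] if and only if [p >= A] a.e. where
   [p > 0]. For a general [f] in the closed span, whose symbol may be unbounded,
   the bound comes from pairing [f] with trigonometric approximants and completing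
   the square. The dual generator has the symbol [1/p], so its translates have the
   bracket [exp(2 pi i n t)] on the set where [p > 0], which supports every
   bracket: the frame operator sends them to the translates of [phi]. Its
   injectivity is the lower bound applied to a difference. *)
Require Import Defs.
From HB Require Import structures.
From mathcomp Require Import all_boot all_order all_algebra finmap.
From mathcomp Require Import complex ring lra.
From mathcomp Require Import all_classical all_reals all_analysis.
From mathcomp Require Import measurable_realfun summability.

Set Implicit Arguments.
Unset Strict Implicit.
Unset Printing Implicit Defensive.
Import Order.TTheory GRing.Theory Num.Theory.
Import numFieldNormedType.Exports.

Local Open Scope classical_set_scope.
Local Open Scope complex_scope.
Local Open Scope ring_scope.

(** * Complex numbers and complex-valued measurable functions *)

(** The frame coefficients of an element of the closed span need not be square summable, so its
    bracket is in general only integrable. Parseval is therefore proved for integrable functions,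
    with both sides allowed to be [+oo]; the inequality opposite to Bessel's is the delicate half.
    It rests on the density result that also realises bounded symbols in the span: trigonometric
    polynomials approximate bounded measurable functions of [frac (q x)] for any integrable weight
    [w]. For Parseval of [G] the weight is [1 + |G|] on the unit interval; for the span it is
    [|Phi|^2], with [q y = a y]. Density comes from a monotone class argument. Symbols are kept
    bounded everywhere: [1/p] is replaced by its restriction to [p >= A], which agrees with it a.e.
    where [p > 0]. The translates of [phi] themselves may lie outside the domain of the analysis
    operator, but they are limits of elements of it; hence the projection onto [K_xi] fixes them,
    and the dual is obtained by inverting the frame operator at [xi n] itself. *)

Definition csq (R : rcfType) (z : R[i]) : R :=
  complex.Re z ^+ 2 + complex.Im z ^+ 2.

Section complex_numbers.
Context {R : rcfType}.
Implicit Types z w : R[i].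

Lemma ReD z w : complex.Re (z + w) = complex.Re z + complex.Re w.
Proof. by case: z w => [? ?] [? ?]. Qed.

Lemma ImD z w : complex.Im (z + w) = complex.Im z + complex.Im w.
Proof. by case: z w => [? ?] [? ?]. Qed.

Lemma ReN z : complex.Re (- z) = - complex.Re z.
Proof. by case: z. Qed.

Lemma ImN z : complex.Im (- z) = - complex.Im z.
Proof. by case: z. Qed.

Lemma ReB z w : complex.Re (z - w) = complex.Re z - complex.Re w.
Proof. by rewrite ReD ReN. Qed.

Lemma ImB z w : complex.Im (z - w) = complex.Im z - complex.Im w.
Proof. by rewrite ImD ImN. Qed.

Lemma ReM z w :
  complex.Re (z * w) = complex.Re z * complex.Re w - complex.Im z * complex.Im w.
Proof. by case: z w => [? ?] [? ?]. Qed.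

Lemma ImM z w :
  complex.Im (z * w) = complex.Re z * complex.Im w + complex.Im z * complex.Re w.
Proof. by case: z w => [? ?] [? ?]. Qed.

Lemma ReJ z : complex.Re (conjc z) = complex.Re z.
Proof. by case: z. Qed.

Lemma ImJ z : complex.Im (conjc z) = - complex.Im z.
Proof. by case: z. Qed.

Lemma complexP z w :
  complex.Re z = complex.Re w -> complex.Im z = complex.Im w -> z = w.
Proof. by case: z w => [? ?] [? ?] /= -> ->. Qed.

Lemma csq_ge0 z : 0 <= csq z.
Proof. by rewrite addr_ge0 // sqr_ge0. Qed.

Lemma csq_eq0 z : csq z = 0 -> z = 0.
Proof.
move/eqP; rewrite paddr_eq0 ?sqr_ge0// !sqrf_eq0 => /andP[/eqP ? /eqP ?].
exact: complexP.
Qed.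

Lemma csqM z w : csq (z * w) = csq z * csq w.
Proof. by rewrite /csq ReM ImM; ring. Qed.

Lemma conjM z w : conjc (z * w) = conjc z * conjc w.
Proof. exact: rmorphM. Qed.

Lemma conjB z w : conjc (z - w) = conjc z - conjc w.
Proof. exact: rmorphB. Qed.

Lemma conj_sum (I : Type) (s : seq I) (F : I -> R[i]) :
  conjc (\sum_(i <- s) F i) = \sum_(i <- s) conjc (F i).
Proof. exact: rmorph_sum. Qed.

Lemma csqN z : csq (- z) = csq z.
Proof. by rewrite /csq ReN ImN !sqrrN. Qed.

Lemma csqJ z : csq (conjc z) = csq z.
Proof. by rewrite /csq ReJ ImJ sqrrN. Qed.

Lemma csq_real (x : R) : csq x%:C = x ^+ 2.
Proof. by rewrite /csq/= expr0n/= addr0. Qed.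

Lemma csqD_le z w : csq (z + w) <= 2 * csq z + 2 * csq w.
Proof.
rewrite /csq ReD ImD.
have := sqr_ge0 (complex.Re z - complex.Re w).
have := sqr_ge0 (complex.Im z - complex.Im w).
by nra.
Qed.

Lemma csqB_le z w : csq (z - w) <= 2 * csq z + 2 * csq w.
Proof. by rewrite -(csqN w) csqD_le. Qed.

Lemma normc_csq z : normc z = Num.sqrt (csq z).
Proof. by case: z. Qed.

Lemma normc_sqr z : normc z ^+ 2 = csq z.
Proof. by rewrite normc_csq sqr_sqrtr// csq_ge0. Qed.

Lemma normc_ge0 z : 0 <= normc z.
Proof. by rewrite normc_csq sqrtr_ge0. Qed.

Lemma mulJ z : z * conjc z = (csq z)%:C.
Proof. by case: z => a b; apply: complexP; rewrite ?ReM ?ImM /csq/=; ring. Qed.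

Lemma Re_le_normc z : `|complex.Re z| <= normc z.
Proof. by rewrite normc_csq -sqrtr_sqr ler_sqrt ?csq_ge0// lerDl sqr_ge0. Qed.

Lemma Im_le_normc z : `|complex.Im z| <= normc z.
Proof. by rewrite normc_csq -sqrtr_sqr ler_sqrt ?csq_ge0// lerDr sqr_ge0. Qed.

(** Expansion of [c |z - w/c|^2 >= 0], coordinate by coordinate. The free weight [c] becomes the
    frame bound in the lower estimate and a small parameter in the reverse Bessel inequality. *)
Lemma Re_mulJ_le z w (c : R) : 0 < c ->
  2 * complex.Re (z * conjc w) <= c * csq z + c^-1 * csq w.
Proof.
move=> c0; rewrite ReM ReJ ImJ /csq.
have ci : c * c^-1 = 1 by rewrite divff// gt_eqF.
have ci0 : 0 < c^-1 by rewrite invr_gt0.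
have h (x y : R) : 2 * (x * y) <= c * x ^+ 2 + c^-1 * y ^+ 2.
  have : 0 <= c * (x - c^-1 * y) ^+ 2 by rewrite mulr_ge0 ?sqr_ge0// ltW.
  have -> : c * (x - c^-1 * y) ^+ 2 = c * x ^+ 2 - 2 * (c * c^-1) * (x * y) +
      (c * c^-1) * (c^-1 * y ^+ 2) by ring.
  by rewrite ci; lra.
have := h (complex.Re z) (complex.Re w); have := h (complex.Im z) (complex.Im w).
by lra.
Qed.

Lemma csq_expand z w :
  csq (z + w) = csq z + csq w + 2 * complex.Re (z * conjc w).
Proof. by rewrite /csq ReD ImD ReM ReJ ImJ; ring. Qed.

End complex_numbers.

Section expi.
Context {R : realType}.

Lemma expiD (s t : R) : expi (s + t) = expi s * expi t.
Proof.
by apply: complexP; rewrite ?ReM ?ImM /= ?cosD ?sinD; ring.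
Qed.

Lemma expiN (t : R) : expi (- t) = conjc (expi t).
Proof. by apply: complexP => /=; rewrite ?cosN ?sinN. Qed.

Lemma expi0 : expi (0 : R) = 1.
Proof. by apply: complexP => /=; rewrite ?cos0 ?sin0. Qed.

Lemma csq_expi (t : R) : csq (expi t) = 1.
Proof. by rewrite /csq/= cos2Dsin2. Qed.

Lemma expi_int (n : int) : expi (2 * pi * n%:~R) = 1 :> R[i].
Proof.
have hn (k : nat) : expi (2 * pi * k%:R) = 1 :> R[i].
  elim: k => [|k IH]; first by rewrite mulr0 expi0.
  rewrite -(natr1 k) mulrDr mulr1 expiD IH mul1r mulrC mulr_natr.
  by apply: complexP => /=; rewrite ?cos2pi ?sin2pi.
case: n => k; first exact: hn.
by rewrite NegzE mulrNz mulrN expiN hn; apply: complexP => /=; rewrite ?oppr0.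
Qed.

End expi.

Section cmeasurable.
Context {R : realType}.
Implicit Types f g : R -> R[i].

Lemma cmeasD f g : cmeasurable f -> cmeasurable g ->
  cmeasurable (fun x => f x + g x).
Proof.
move=> [f1 f2] [g1 g2]; split.
- by under eq_fun do rewrite ReD; exact: measurable_funD.
- by under eq_fun do rewrite ImD; exact: measurable_funD.
Qed.

Lemma cmeasN f : cmeasurable f -> cmeasurable (fun x => - f x).
Proof.
move=> [f1 f2]; split.
- by under eq_fun do rewrite ReN; exact: measurableT_comp.
- by under eq_fun do rewrite ImN; exact: measurableT_comp.
Qed.

Lemma cmeasB f g : cmeasurable f -> cmeasurable g ->
  cmeasurable (fun x => f x - g x).
Proof. by move=> mf mg; apply: cmeasD => //; exact: cmeasN. Qed.

Lemma cmeasM f g : cmeasurable f -> cmeasurable g ->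
  cmeasurable (fun x => f x * g x).
Proof.
move=> [f1 f2] [g1 g2]; split.
- under eq_fun do rewrite ReM.
  by apply: measurable_funB; exact: measurable_funM.
- under eq_fun do rewrite ImM.
  by apply: measurable_funD; exact: measurable_funM.
Qed.

Lemma cmeasJ f : cmeasurable f -> cmeasurable (fun x => conjc (f x)).
Proof.
move=> [f1 f2]; split.
- by under eq_fun do rewrite ReJ.
- by under eq_fun do rewrite ImJ; exact: measurableT_comp.
Qed.

Lemma cmeas_cst c : cmeasurable (fun=> c : R[i]).
Proof. by split; exact: measurable_cst. Qed.

Lemma cmeas_real (f : R -> R) : measurable_fun [set: R] f ->
  cmeasurable (fun x => (f x)%:C).
Proof. by move=> mf; split => //=; exact: measurable_cst. Qed.

Lemma cmeas_comp f (g : R -> R) : cmeasurable f -> measurable_fun [set: R] g ->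
  cmeasurable (fun x => f (g x)).
Proof.
move=> [f1 f2] mg; split.
- exact: (measurableT_comp f1).
- exact: (measurableT_comp f2).
Qed.

Lemma cmeas_sum (I : Type) (s : seq I) (F : I -> R -> R[i]) :
  (forall i, cmeasurable (F i)) -> cmeasurable (fun x => \sum_(i <- s) F i x).
Proof.
move=> mF; elim: s => [|i s IH].
  by under eq_fun do rewrite big_nil; exact: cmeas_cst.
by under eq_fun do rewrite big_cons; exact: cmeasD.
Qed.

Lemma cmeas_expi (g : R -> R) : measurable_fun [set: R] g ->
  cmeasurable (fun x => expi (g x)).
Proof.
move=> mg; split => /=.
- apply: measurableT_comp mg; apply: continuous_measurable_fun.
  exact: continuous_cos.
- apply: measurableT_comp mg; apply: continuous_measurable_fun.
  exact: continuous_sin.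
Qed.

Lemma meas_csq f : cmeasurable f -> measurable_fun [set: R] (fun x => csq (f x)).
Proof. by move=> [f1 f2]; apply: measurable_funD; exact: measurable_funX. Qed.

Lemma meas_normc f : cmeasurable f ->
  measurable_fun [set: R] (fun x => normc (f x)).
Proof.
move=> mf; under eq_fun do rewrite normc_csq.
apply: measurableT_comp (meas_csq mf).
by apply: continuous_measurable_fun; exact: sqrt_continuous.
Qed.

Lemma meas_ecsq f : cmeasurable f ->
  measurable_fun [set: R] (fun x => (csq (f x))%:E).
Proof. by move=> mf; apply/measurable_EFinP; exact: meas_csq. Qed.

End cmeasurable.

(** * Complex integrals and square-integrable functions *)

Definition cintegrable (R : realType) (f : R -> R[i]) : Prop :=
  (@lebesgue_measure R).-integrable setT (fun x => (complex.Re (f x))%:E) /\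
  (@lebesgue_measure R).-integrable setT (fun x => (complex.Im (f x))%:E).

Definition Sq (R : realType) (f : R -> R[i]) : \bar R :=
  (\int[@lebesgue_measure R]_x (csq (f x))%:E)%E.

Section cintegral.
Context {R : realType}.
Notation mu := (@lebesgue_measure R).
Implicit Types f g : R -> R[i].

Lemma aeS (P Q : R -> Prop) : (forall x, P x -> Q x) ->
  {ae mu, forall x, P x} -> {ae mu, forall x, Q x}.
Proof.
move=> PQ [N [mN N0 sN]]; exists N; split => // x nQ; apply: sN => Px.
exact/nQ/PQ.
Qed.

Lemma aeS2 (P Q S : R -> Prop) : (forall x, P x -> Q x -> S x) ->
  {ae mu, forall x, P x} -> {ae mu, forall x, Q x} -> {ae mu, forall x, S x}.
Proof.
move=> PQS aP aQ; have [N [mN N0 sN]] := negligibleU aP aQ.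
exists N; split => // x nS; apply: sN.
by have [Px|nP] := pselect (P x); [right => Qx; exact/nS/PQS|left].
Qed.

Lemma integrable_Zl (c : R) (h : R -> R) : mu.-integrable setT (EFin \o h) ->
  mu.-integrable setT (EFin \o (fun x => c * h x)).
Proof.
move=> hi; rewrite (_ : EFin \o _ = fun x => (c%:E * (EFin \o h) x)%E).
  exact: integrableZl.
by apply/funext => x /=; rewrite EFinM.
Qed.

Lemma cintegrable_meas f : cintegrable f -> cmeasurable f.
Proof.
by move=> [f1 f2]; split; apply/measurable_EFinP;
  [exact: measurable_int f1|exact: measurable_int f2].
Qed.

Lemma cintegrable_le f (g : R -> R) : cmeasurable f ->
  mu.-integrable setT (EFin \o g) ->
  (forall x, normc (f x) <= g x) -> cintegrable f.
Proof.
move=> [f1 f2] ig fg; split; apply: le_integrable ig => //.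
- exact/measurable_EFinP.
- move=> x _; rewrite lee_fin (le_trans (Re_le_normc _))//.
  by rewrite (le_trans (fg x)) ?ler_norm.
- exact/measurable_EFinP.
- move=> x _; rewrite lee_fin (le_trans (Im_le_normc _))//.
  by rewrite (le_trans (fg x)) ?ler_norm.
Qed.

Lemma normc_le_ReIm (z : R[i]) : normc z <= `|complex.Re z| + `|complex.Im z|.
Proof.
rewrite normc_csq -[leRHS]ger0_norm ?addr_ge0// -sqrtr_sqr ler_sqrt ?sqr_ge0//.
rewrite sqrrD !real_normK ?num_real// /csq.
by rewrite -addrA lerD2l lerDr mulrn_wge0// mulr_ge0.
Qed.

Lemma cintegrable_normc f : cintegrable f ->
  mu.-integrable setT (fun x => (normc (f x))%:E).
Proof.
move=> fi; have [f1 f2] := fi; have fm := cintegrable_meas fi.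
have := integrableD measurableT (integrable_abse f1) (integrable_abse f2).
apply: le_integrable => //.
  by apply/measurable_EFinP; exact: meas_normc.
move=> x _ /=; rewrite lee_fin (ger0_norm (normc_ge0 _)).
by rewrite (le_trans (normc_le_ReIm _))// ler_norm.
Qed.

Lemma cintegrableD f g : cintegrable f -> cintegrable g ->
  cintegrable (fun x => f x + g x).
Proof.
move=> [f1 f2] [g1 g2]; split.
- under eq_fun do rewrite ReD EFinD; exact: integrableD.
- under eq_fun do rewrite ImD EFinD; exact: integrableD.
Qed.

Lemma cintegrableN f : cintegrable f -> cintegrable (fun x => - f x).
Proof.
move=> [f1 f2]; split.
- under eq_fun do rewrite ReN EFinN; exact: integrableN.
- under eq_fun do rewrite ImN EFinN; exact: integrableN.
Qed.

Lemma cintegrableB f g : cintegrable f -> cintegrable g ->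
  cintegrable (fun x => f x - g x).
Proof. by move=> fi gi; apply: cintegrableD => //; exact: cintegrableN. Qed.

Lemma cintegrableMb f g (M : R) : cintegrable f -> cmeasurable g ->
  (forall x, normc (g x) <= M) -> cintegrable (fun x => g x * f x).
Proof.
move=> fi mg gM.
apply: (@cintegrable_le _ (fun x => M * normc (f x))).
- by apply: cmeasM => //; exact: cintegrable_meas.
- under [X in integrable _ _ X]eq_fun do rewrite /= EFinM.
  by apply: integrableZl => //; exact: cintegrable_normc.
- move=> x; rewrite ComplexField.Normc.normcM ler_wpM2r// normc_ge0//.
Qed.

Lemma cintegrableZ f (c : R[i]) : cintegrable f ->
  cintegrable (fun x => c * f x).
Proof.
by move=> fi; apply: (cintegrableMb fi (cmeas_cst c)) => x; exact: lexx.
Qed.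

Lemma cintegrable_sum (I : Type) (s : seq I) (F : I -> R -> R[i]) :
  (forall i, cintegrable (F i)) -> cintegrable (fun x => \sum_(i <- s) F i x).
Proof.
move=> mF; elim: s => [|i s IH].
  under eq_fun do rewrite big_nil.
  by split => /=; exact: integrable0.
by under eq_fun do rewrite big_cons; exact: cintegrableD.
Qed.

Lemma cintegralD f g : cintegrable f -> cintegrable g ->
  cintegral (fun x => f x + g x) = cintegral f + cintegral g.
Proof.
move=> [f1 f2] [g1 g2]; apply: complexP; rewrite ?ReD ?ImD /=.
- under eq_Rintegral do rewrite ReD; exact: RintegralD.
- under eq_Rintegral do rewrite ImD; exact: RintegralD.
Qed.

Lemma cintegralZ f (c : R[i]) : cintegrable f ->
  cintegral (fun x => c * f x) = c * cintegral f.
Proof.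
move=> [f1 f2]; apply: complexP; rewrite ?ReM ?ImM /=.
- under eq_Rintegral do rewrite ReM.
  rewrite RintegralB ?RintegralZl//; exact: integrable_Zl.
- under eq_Rintegral do rewrite ImM.
  rewrite RintegralD ?RintegralZl//; exact: integrable_Zl.
Qed.

Lemma cintegralN f : cintegrable f ->
  cintegral (fun x => - f x) = - cintegral f.
Proof.
by move=> fi; under eq_fun do rewrite -mulN1r; rewrite cintegralZ// mulN1r.
Qed.

Lemma cintegralB f g : cintegrable f -> cintegrable g ->
  cintegral (fun x => f x - g x) = cintegral f - cintegral g.
Proof.
by move=> fi gi; rewrite cintegralD ?cintegralN//; exact: cintegrableN.
Qed.

Lemma cintegralJ f : cintegrable f ->
  cintegral (fun x => conjc (f x)) = conjc (cintegral f).
Proof.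
move=> [f1 f2]; apply: complexP; rewrite ?ReJ ?ImJ /=.
- by under eq_Rintegral do rewrite ReJ.
- under eq_Rintegral do rewrite ImJ -mulN1r.
  by rewrite RintegralZl// mulN1r.
Qed.

Lemma cintegral_sum (I : Type) (s : seq I) (F : I -> R -> R[i]) :
  (forall i, cintegrable (F i)) ->
  cintegral (fun x => \sum_(i <- s) F i x) = \sum_(i <- s) cintegral (F i).
Proof.
move=> mF; elim: s => [|i s IH].
  under eq_fun do rewrite big_nil.
  rewrite big_nil; apply: complexP; rewrite /= /Rintegral;
  by rewrite integral0.
under eq_fun do rewrite big_cons.
by rewrite big_cons cintegralD ?IH//; exact: cintegrable_sum.
Qed.

Lemma ae_eq_cintegral f g : cmeasurable f -> cmeasurable g ->
  {ae mu, forall x, f x = g x} -> cintegral f = cintegral g.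
Proof.
move=> [f1 f2] [g1 g2] fg; apply: complexP; rewrite /= /Rintegral; congr fine;
apply: ae_eq_integral => //; try exact/measurable_EFinP.
- by apply: aeS fg => x /= ->.
- by apply: aeS fg => x /= ->.
Qed.

Lemma cintegral_real (h : R -> R) :
  cintegral (fun x => (h x)%:C) = (Rintegral mu setT h)%:C.
Proof. by apply: complexP => //=; rewrite /Rintegral integral0. Qed.

Lemma cintegrable_real (h : R -> R) :
  mu.-integrable setT (EFin \o h) -> cintegrable (fun x => (h x)%:C).
Proof. by move=> hi; split => //; exact: integrable0. Qed.

End cintegral.

(** * The inner product and seminorm of L^2, on functions *)

Section L2.
Context {R : realType}.
Notation mu := (@lebesgue_measure R).
Notation L2 := (@Lspc R 2%:E).
Notation hn := (hnorm (@ip2 R)).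
Implicit Types f g : R -> R[i].

Lemma Sq_ge0 f : (0 <= Sq f)%E.
Proof. by apply: integral_ge0 => x _; rewrite lee_fin csq_ge0. Qed.

Lemma integral_csqZ (c : R) f : 0 <= c -> cmeasurable f ->
  (\int[mu]_x (c * csq (f x))%:E = c%:E * Sq f)%E.
Proof.
move=> c0 mf; under eq_integral do rewrite EFinM.
by apply: ge0_integralZl => //; [exact: meas_ecsq|
  move=> x _; rewrite lee_fin csq_ge0].
Qed.

Lemma cLnorm2E f : cLnorm 2%:E f = (Sq f `^ 2^-1)%E.
Proof.
rewrite /cLnorm unlock; congr poweR; apply: eq_integral => x _ /=.
by rewrite ger0_norm ?normc_ge0// -normc_sqr powR_mulrn// normc_ge0.
Qed.

Lemma Lspc2P f : L2 f <-> cmeasurable f /\ (Sq f < +oo)%E.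
Proof.
rewrite /Lspc/= cLnorm2E; split => -[mf h]; split => //.
- by apply: lty_poweRy h; rewrite invr_eq0.
- by rewrite poweR_lty.
Qed.

Lemma L2_meas f : L2 f -> cmeasurable f.
Proof. by case. Qed.

Lemma L2_fin f : L2 f -> Sq f \is a fin_num.
Proof. by move=> /Lspc2P[_ h]; rewrite ge0_fin_numE// Sq_ge0. Qed.

Lemma L2_csq f : L2 f -> mu.-integrable setT (fun x => (csq (f x))%:E).
Proof.
move=> /Lspc2P[mf h]; apply/integrableP; split; first exact: meas_ecsq.
under eq_integral do rewrite gee0_abs ?lee_fin ?csq_ge0//.
exact: h.
Qed.

Lemma L2_mul_cintegrable f g : L2 f -> L2 g ->
  cintegrable (fun x => f x * conjc (g x)).
Proof.
move=> f2 g2; have mf := L2_meas f2; have mg := L2_meas g2.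
apply: (@cintegrable_le _ _ (fun x => csq (f x) + csq (g x))).
- by apply: cmeasM => //; exact: cmeasJ.
- under [X in integrable _ _ X]eq_fun do rewrite /= EFinD.
  by apply: integrableD => //; exact: L2_csq.
move=> x; rewrite ComplexField.Normc.normcM.
rewrite -!normc_sqr; have -> : normc (conjc (g x)) = normc (g x).
  by rewrite !normc_csq csqJ.
have := sqr_ge0 (normc (f x) - normc (g x)).
have := sqr_ge0 (normc (f x) + normc (g x)).
by nra.
Qed.

Lemma Sq_le_L2 f (g : R -> \bar R) : cmeasurable f ->
  (forall x, 0 <= g x)%E -> measurable_fun setT g ->
  (forall x, ((csq (f x))%:E <= g x)%E) ->
  (\int[mu]_x g x < +oo)%E -> L2 f.
Proof.
move=> mf g0 mg fg gy; apply/Lspc2P; split => //.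
apply: le_lt_trans gy; apply: ge0_le_integral => //.
- by move=> x _; rewrite lee_fin csq_ge0.
- exact: meas_ecsq.
Qed.

Lemma SqD_le f g : cmeasurable f -> cmeasurable g ->
  (Sq (fun x => (f x + g x)%R) <= 2%:E * Sq f + 2%:E * Sq g)%E.
Proof.
move=> mf mg; rewrite /Sq -!ge0_integralZl//; last 4 first.
- exact: meas_ecsq.
- by move=> x _; rewrite lee_fin csq_ge0.
- exact: meas_ecsq.
- by move=> x _; rewrite lee_fin csq_ge0.
rewrite -ge0_integralD//; last 4 first.
- by move=> x _; rewrite -EFinM lee_fin mulr_ge0// csq_ge0.
- by apply/measurable_EFinP; apply: measurable_funM => //; exact: meas_csq.
- by move=> x _; rewrite -EFinM lee_fin mulr_ge0// csq_ge0.
- by apply/measurable_EFinP; apply: measurable_funM => //; exact: meas_csq.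
apply: ge0_le_integral => //.
- by move=> x _; rewrite lee_fin csq_ge0.
- by apply: meas_ecsq; exact: cmeasD.
- by apply/measurable_EFinP; apply: measurable_funD;
    apply: measurable_funM => //; exact: meas_csq.
- by move=> x _; rewrite -!EFinM -EFinD lee_fin csqD_le.
Qed.

Lemma SqN f : Sq (fun x => - f x) = Sq f.
Proof. by apply: eq_integral => x _; rewrite csqN. Qed.

Lemma L2D f g : L2 f -> L2 g -> L2 (fun x => f x + g x).
Proof.
move=> /Lspc2P[mf hf] /Lspc2P[mg hg]; apply/Lspc2P; split; first exact: cmeasD.
by apply: le_lt_trans (SqD_le mf mg) _; rewrite lte_add_pinfty ?lte_mul_pinfty.
Qed.

Lemma L2N f : L2 f -> L2 (fun x => - f x).
Proof.
by move=> /Lspc2P[mf h]; apply/Lspc2P; rewrite SqN; split => //; exact: cmeasN.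
Qed.

Lemma L2B f g : L2 f -> L2 g -> L2 (fun x => f x - g x).
Proof. by move=> f2 g2; apply: L2D => //; exact: L2N. Qed.

Lemma L2Mb f g (M : R) : L2 f -> cmeasurable g ->
  (forall x, csq (g x) <= M) -> L2 (fun x => g x * f x).
Proof.
move=> /Lspc2P[mf hf] mg gM.
have M0 : 0 <= M by apply: le_trans (gM 0); exact: csq_ge0.
apply: (@Sq_le_L2 _ (fun x => (M * csq (f x))%:E)).
- exact: cmeasM.
- by move=> x; rewrite lee_fin mulr_ge0// csq_ge0.
- by apply/measurable_EFinP; apply: measurable_funM => //; exact: meas_csq.
- by move=> x; rewrite lee_fin csqM ler_wpM2r// csq_ge0.
- under eq_integral do rewrite EFinM.
  rewrite ge0_integralZl//; last 2 first.
    exact: meas_ecsq.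
    by move=> x _; rewrite lee_fin csq_ge0.
  by rewrite lte_mul_pinfty.
Qed.

Lemma L2Z f (c : R[i]) : L2 f -> L2 (fun x => c * f x).
Proof. by move=> f2; apply: (L2Mb f2 (cmeas_cst c)) => x; exact: lexx. Qed.

Lemma L2_0 : L2 (fun=> 0).
Proof.
apply/Lspc2P; split; first exact: cmeas_cst.
rewrite /Sq (eq_integral (fun=> 0%E)) ?integral0// => x _.
by rewrite /csq/= expr0n/= addr0.
Qed.

Lemma L2_sum (I : Type) (s : seq I) (F : I -> R -> R[i]) :
  (forall i, L2 (F i)) -> L2 (fun x => \sum_(i <- s) F i x).
Proof.
move=> mF; elim: s => [|i s IH].
  by under eq_fun do rewrite big_nil; exact: L2_0.
by under eq_fun do rewrite big_cons; exact: L2D.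
Qed.

Lemma ip2_self f : L2 f -> ip2 f f = (fine (Sq f))%:C.
Proof.
move=> f2; rewrite /ip2; under eq_fun do rewrite mulJ.
by rewrite cintegral_real.
Qed.

Lemma hn_sqr f : L2 f -> hn f ^+ 2 = fine (Sq f).
Proof.
by move=> f2; rewrite /hnorm ip2_self//= sqr_sqrtr// fine_ge0// Sq_ge0.
Qed.

Lemma hn_ge0 f : 0 <= hn f.
Proof. exact: sqrtr_ge0. Qed.

Lemma Sq_hn f : L2 f -> Sq f = (hn f ^+ 2)%:E.
Proof. by move=> f2; rewrite hn_sqr// fineK// L2_fin. Qed.

Lemma cLnorm2_hn f : L2 f -> cLnorm 2%:E f = (hn f)%:E.
Proof.
move=> f2; rewrite cLnorm2E Sq_hn// poweR_EFin -powR_mulrn ?hn_ge0//.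
by rewrite -powRrM mulfV// powRr1// hn_ge0.
Qed.

(** Minkowski's inequality for the real functions [normc f] and [normc g], after the pointwise
    triangle inequality. *)
Lemma hnD_le f g : L2 f -> L2 g -> hn (fun x => f x + g x) <= hn f + hn g.
Proof.
move=> f2 g2; rewrite -lee_fin EFinD -!cLnorm2_hn//; last exact: L2D.
have mf := L2_meas f2; have mg := L2_meas g2.
apply: le_trans (minkowski_EFin mu (meas_normc mf) (meas_normc mg) _).
  rewrite /cLnorm unlock; apply: gt0_ler_poweR; rewrite ?invr_ge0//.
  - by rewrite in_itv/= leey andbT; apply: integral_ge0 => x _; rewrite lee_fin powR_ge0.
  - by rewrite in_itv/= leey andbT; apply: integral_ge0 => x _; rewrite lee_fin powR_ge0.
  apply: ge0_le_integral => //=.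
  - apply/measurable_EFinP.
    under eq_fun do rewrite powR_mulrn//.
    apply: measurable_funX; apply: measurableT_comp => //.
    by apply: meas_normc; exact: cmeasD.
  - apply/measurable_EFinP.
    under eq_fun do rewrite powR_mulrn//.
    apply: measurable_funX; apply: measurableT_comp => //.
    by apply: measurable_funD; exact: meas_normc.
  move=> x _; rewrite lee_fin !powR_mulrn// lerXn2r ?nnegrE//.
  rewrite !ger0_norm ?addr_ge0 ?normc_ge0//.
  exact: le_normcD.
by rewrite ler1n.
Qed.

Lemma hnN f : hn (fun x => - f x) = hn f.
Proof.
by rewrite /hnorm /ip2; under eq_fun do rewrite mulJ csqN -mulJ.
Qed.

Lemma hnB_le f g : L2 f -> L2 g -> hn (fun x => f x - g x) <= hn f + hn g.
Proof. by move=> f2 g2; rewrite -(hnN g) hnD_le//; exact: L2N. Qed.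

Lemma hn_subC f g : hn (fun x => f x - g x) = hn (fun x => g x - f x).
Proof. by rewrite -hnN; under eq_fun do rewrite opprB. Qed.

Lemma hn_dist_le f g h : L2 f -> L2 g -> L2 h ->
  hn (fun x => f x - g x) <= hn (fun x => f x - h x) + hn (fun x => h x - g x).
Proof.
move=> f2 g2 h2; apply: le_trans (hnD_le (L2B f2 h2) (L2B h2 g2)).
by under [in leRHS]eq_fun do rewrite subrKA.
Qed.

Lemma hn_dist f g : L2 f -> L2 g -> `|hn f - hn g| <= hn (fun x => f x - g x).
Proof.
move=> f2 g2; rewrite ler_norml; apply/andP; split.
  rewrite lerNl opprB lerBlDr hn_subC.
  apply: le_trans (hnD_le (L2B g2 f2) f2).
  by under [in leRHS]eq_fun do rewrite subrK.
rewrite lerBlDr; apply: le_trans (hnD_le (L2B f2 g2) g2).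
by under [in leRHS]eq_fun do rewrite subrK.
Qed.

Lemma ae_eq_hn f g : cmeasurable f -> cmeasurable g ->
  {ae mu, forall x, f x = g x} -> hn f = hn g.
Proof.
move=> mf mg fg; rewrite /hnorm /ip2; congr (Num.sqrt (complex.Re _)).
apply: ae_eq_cintegral.
- by apply: cmeasM => //; exact: cmeasJ.
- by apply: cmeasM => //; exact: cmeasJ.
- by apply: aeS fg => x ->.
Qed.

Lemma ip2D f g h : L2 f -> L2 g -> L2 h ->
  ip2 (fun x => f x + g x) h = ip2 f h + ip2 g h.
Proof.
move=> f2 g2 h2; rewrite /ip2; under eq_fun do rewrite mulrDl.
by rewrite cintegralD//; exact: L2_mul_cintegrable.
Qed.

Lemma ip2Z (c : R[i]) f g : L2 f -> L2 g ->
  ip2 (fun x => c * f x) g = c * ip2 f g.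
Proof.
move=> f2 g2; rewrite /ip2; under eq_fun do rewrite -mulrA.
by rewrite cintegralZ//; exact: L2_mul_cintegrable.
Qed.

Lemma ip2J f g : L2 f -> L2 g -> ip2 g f = conjc (ip2 f g).
Proof.
move=> f2 g2; rewrite /ip2 -cintegralJ; last exact: L2_mul_cintegrable.
by congr cintegral; apply/funext => x; rewrite conjM conjcK mulrC.
Qed.

Lemma ip2B f g h : L2 f -> L2 g -> L2 h ->
  ip2 (fun x => f x - g x) h = ip2 f h - ip2 g h.
Proof.
move=> f2 g2 h2; rewrite /ip2; under eq_fun do rewrite mulrBl.
by rewrite cintegralB//; exact: L2_mul_cintegrable.
Qed.

Lemma hnD_sqr f g : L2 f -> L2 g ->
  hn (fun x => f x + g x) ^+ 2 =
  hn f ^+ 2 + hn g ^+ 2 + 2 * complex.Re (ip2 f g).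
Proof.
move=> f2 g2; rewrite !hn_sqr//; last exact: L2D.
have E h : L2 h -> fine (Sq h) = complex.Re (ip2 h h) by move=> h2; rewrite ip2_self.
rewrite !E//; last exact: L2D.
rewrite ip2D ?(ip2J f2 (L2D f2 g2)) ?(ip2J g2 (L2D f2 g2))//; last exact: L2D.
rewrite (ip2J (L2D f2 g2) f2) (ip2J (L2D f2 g2) g2) !ip2D//.
rewrite (ip2J f2 g2) !ReD !ReJ !ReD ReJ.
by ring.
Qed.

End L2.

(** * Completeness *)

Definition ccvg (R : realType) (z : nat -> R[i]) (l : R[i]) : Prop :=
  (fun n => complex.Re (z n)) @ \oo --> complex.Re l /\
  (fun n => complex.Im (z n)) @ \oo --> complex.Im l.

Section convergence.
Context {R : realType}.
Notation mu := (@lebesgue_measure R).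
Notation L2 := (@Lspc R 2%:E).
Notation hn := (hnorm (@ip2 R)).
Implicit Types (f g : R -> R[i]) (u : nat -> R -> R[i]).

Lemma ccvg_csq (z : nat -> R[i]) l : ccvg z l ->
  (fun n => csq (z n)) @ \oo --> csq l.
Proof. by move=> [z1 z2]; apply: cvgD; apply: cvgM. Qed.

Lemma ccvgM (z w : nat -> R[i]) k l : ccvg z k -> ccvg w l ->
  ccvg (fun n => z n * w n) (k * l).
Proof.
move=> [z1 z2] [w1 w2]; split; rewrite ?ReM ?ImM.
- by under eq_fun do rewrite ReM; apply: cvgB; exact: cvgM.
- by under eq_fun do rewrite ImM; apply: cvgD; exact: cvgM.
Qed.

Lemma ccvgB (z w : nat -> R[i]) k l : ccvg z k -> ccvg w l ->
  ccvg (fun n => z n - w n) (k - l).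
Proof.
move=> [z1 z2] [w1 w2]; split; rewrite ?ReB ?ImB.
- by under eq_fun do rewrite ReB; exact: cvgB.
- by under eq_fun do rewrite ImB; exact: cvgB.
Qed.

Lemma ccvg_cst (c : R[i]) : ccvg (fun=> c) c.
Proof. by split; exact: cvg_cst. Qed.

Lemma ccvg_real (x : nat -> R) (l : R) : x @ \oo --> l ->
  ccvg (fun n => (x n)%:C) l%:C.
Proof. by move=> h; split => //=; exact: cvg_cst. Qed.

Lemma cvge0_lt (x : nat -> \bar R) (e : R) : x @ \oo --> 0%E -> 0 < e ->
  \forall n \near \oo, (x n < e%:E)%E.
Proof.
move=> /fine_cvgP[xfin xcv] e0; near=> n.
rewrite -[x n]fineK ?lte_fin; last by near: n.
by near: n; apply: (cvgr_lt (0 : R)).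
Unshelve. all: by end_near. Qed.

(** Fatou's lemma, with [|f|^2] first replaced by a pointwise lower limit to which it is a.e. equal.
    The bound is known only eventually, hence the shift of the sequence by [N]. *)
Lemma Sq_fatou u f (C : \bar R) : (forall n, cmeasurable (u n)) ->
  cmeasurable f -> {ae mu, forall x, ccvg (u ^~ x) (f x)} ->
  (\forall n \near \oo, (Sq (u n) <= C)%E) -> (Sq f <= C)%E.
Proof.
move=> mu_ mf uf [N _ uC].
pose h n x := (csq (u (n + N)%N x))%:E.
have mh n : measurable_fun setT (h n) by exact: meas_ecsq.
have h0 n x : setT x -> (0 <= h n x)%E by rewrite lee_fin csq_ge0.
have -> : Sq f = (\int[mu]_x limn_einf (h ^~ x))%E.
  apply: ge0_ae_eq_integral => //.
  - exact: meas_ecsq.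
  - apply: (eq_measurable_fun (fun x => - limn_esup (\- (h ^~ x)))%E).
      by move=> x _; rewrite limn_esupN oppeK.
    apply: measurableT_comp => //; apply: measurable_fun_limn_esup => n.
    exact: measurableT_comp.
  - by move=> x _; rewrite lee_fin csq_ge0.
  - move=> x _; rewrite limn_einf_lim; apply: lime_ge.
      exact: is_cvg_einfs.
    near=> n; apply: le_ereal_inf_tmp => _ [m _ <-]; exact: h0.
  apply: aeS uf => x /ccvg_csq ux _.
  have : h ^~ x @ \oo --> (csq (f x))%:E.
    apply: cvg_EFin; first exact: nearW.
    by rewrite (cvg_shiftn N (fun n => csq (u n x))).
  by move=> /cvg_limn_einf_sup[->].
apply: le_trans (fatou mu measurableT mh h0) _.
rewrite limn_einf_lim; apply: lime_le; first exact: is_cvg_einfs.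
near=> n; apply: (@le_trans _ _ (Sq (u (n + N)%N))); last first.
  by apply: uC; rewrite /= leq_addl.
apply: ereal_inf_lbound; exists n => //=; exact: leqnn.
Unshelve. all: by end_near. Qed.

Lemma Sq_dominated u f (g : R -> R) : (forall n, cmeasurable (u n)) ->
  cmeasurable f -> {ae mu, forall x, ccvg (u ^~ x) (f x)} ->
  mu.-integrable setT (EFin \o g) ->
  (forall n x, csq (u n x - f x) <= g x) ->
  (fun n => Sq (fun x => u n x - f x)) @ \oo --> 0%E.
Proof.
move=> mu_ mf uf ig dom.
have [| | | | |_ _] := @dominated_convergence _ _ _ mu setT measurableT
  (fun n x => (csq (u n x - f x))%:E) (cst 0%E) (EFin \o g).
- by move=> n; apply: meas_ecsq; exact: cmeasB.
- exact: measurable_cst.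
- apply: aeS uf => x ux _.
  apply: cvg_EFin; first exact: nearW.
  have := ccvg_csq (ccvgB ux (ccvg_cst (f x))).
  by rewrite subrr /csq/= expr0n/= addr0.
- by [].
- apply: aeW => x n _; rewrite gee0_abs ?lee_fin ?csq_ge0//; exact: dom.
by rewrite integral0.
Qed.

Lemma hn_le f (C : R) : L2 f -> 0 <= C -> (Sq f <= (C ^+ 2)%:E)%E -> hn f <= C.
Proof.
move=> f2 C0; rewrite Sq_hn// lee_fin => h.
by rewrite -(ler_pXn2r (ltn0Sn 1)) ?nnegrE ?hn_ge0.
Qed.

Lemma geometric_increments (x : nat -> R) (C : R) :
  (forall k, `|x k.+1 - x k| <= C * (2^-1) ^+ k) -> cvgn x.
Proof.
move=> h.
have : cvgn (series (fun k => x k.+1 - x k)).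
  apply: normed_cvg; apply: (series_le_cvg _ _ h).
  - by move=> k /=; exact: normr_ge0.
  - by move=> k; apply: le_trans (h k).
  apply: is_cvg_geometric_series.
  by rewrite gtr0_norm ?invr_gt0// invf_lt1// ltr1n.
rewrite /series/=; under eq_fun do rewrite telescope_sumr//.
move=> hc; have -> : x = (fun n => (x n - x 0%N) + x 0%N).
  by apply/funext => n; rewrite subrK.
by apply: is_cvgD => //; exact: is_cvg_cst.
Qed.

(* A subsequence with increments of norm at most [4^-k] converges almost
   everywhere, because [sum_k 4^k |v_(k+1) - v_k|^2] is integrable. *)
Lemma rapid_subsequence_cvg (v : nat -> R -> R[i]) : (forall k, L2 (v k)) ->
  (forall k, hn (fun x => v k.+1 x - v k x) <= (4^-1) ^+ k) ->
  {ae mu, forall x, cvgn (fun k => complex.Re (v k x)) /\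
                    cvgn (fun k => complex.Im (v k x))}.
Proof.
move=> v2 hv.
pose d k x := v k.+1 x - v k x.
have d2 k : L2 (d k) by exact: L2B.
pose h k x := (4 ^+ k * csq (d k x))%:E.
have h0 k x : setT x -> (0 <= h k x)%E.
  by rewrite lee_fin mulr_ge0// ?csq_ge0// exprn_ge0.
have mh k : measurable_fun setT (h k).
  apply/measurable_EFinP; apply: measurable_funM => //.
  by apply: meas_csq; exact: L2_meas.
have hint : mu.-integrable setT (fun x => (\sum_(k <oo) h k x)%E).
  apply/integrableP; split.
    apply: (@ge0_emeasurable_sum _ _ _ setT h xpredT) => [k x _ _|k _].
      exact: h0.
    exact: mh.
  under eq_integral => x _.
    rewrite gee0_abs; last by apply: nneseries_ge0 => k _ _; exact: h0.
    over.
  rewrite integral_nneseries//.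
  apply: (@le_lt_trans _ _ (\sum_(k <oo) ((4^-1) ^+ k)%:E)%E).
    apply: lee_nneseries => [k _ _|k _]; first by apply: integral_ge0 => x _; exact: h0.
    rewrite /h integral_csqZ ?exprn_ge0//; last exact: L2_meas.
    rewrite Sq_hn// -EFinM lee_fin.
    have : hn (d k) ^+ 2 <= ((4^-1) ^+ k) ^+ 2.
      by rewrite lerXn2r ?nnegrE ?hn_ge0 ?exprn_ge0 ?invr_ge0//; exact: hv.
    move=> hd; apply: le_trans (ler_wpM2l _ hd) _; first by rewrite exprn_ge0.
    by rewrite expr2 exprVn mulrA divff ?mul1r// expf_neq0.
  rewrite (_ : limn _ = (limn (series (fun k => (4^-1 : R) ^+ k)))%:E) ?ltry//.
  rewrite -EFin_lim.
    by apply: congr_lim; apply/funext => n /=; rewrite /series/= sumEFin.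
  have := @is_cvg_geometric_series R 1 4^-1; rewrite /geometric/=.
  under eq_fun do rewrite mul1r.
  by apply; rewrite gtr0_norm ?invr_gt0// invf_lt1// ltr1n.
have := integrable_ae measurableT hint.
apply: aeS => x /(_ I) hx.
pose C := fine (\sum_(k <oo) h k x)%E.
have C0 : 0 <= C by apply: fine_ge0; apply: nneseries_ge0 => k _ _; exact: h0.
(* A term of the series is at most its sum [C], so [|d_k|] is at most [sqrt C] times [2^-k]: the
   increments are summable. *)
have hC k : csq (d k x) <= C * (2^-1) ^+ k ^+ 2.
  have : (h k x <= C%:E)%E.
    rewrite /C fineK//; apply: le_trans (nneseries_lim_ge k.+1 _).
      rewrite big_mkord big_ord_recr/= leeDr// sume_ge0// => i _; exact: h0.
    by move=> *; exact: h0.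
  rewrite /h lee_fin => hk.
  have -> : (2^-1 : R) ^+ k ^+ 2 = (4 ^+ k)^-1.
    by rewrite -exprM mulnC exprM exprVn -natrX exprVn.
  by rewrite ler_pdivlMr ?exprn_gt0// mulrC.
have sC k : Num.sqrt (C * (2^-1) ^+ k ^+ 2) = Num.sqrt C * 2^-1 ^+ k.
  by rewrite sqrtrM// sqrtr_sqr ger0_norm// exprn_ge0// invr_ge0.
split; apply: (@geometric_increments _ (Num.sqrt C)) => k.
- rewrite -ReB; apply: le_trans (Re_le_normc _) _.
  by rewrite normc_csq -sC; apply: ler_wsqrtr; exact: hC.
- rewrite -ImB; apply: le_trans (Im_le_normc _) _.
  by rewrite normc_csq -sC; apply: ler_wsqrtr; exact: hC.
Qed.

(** The upper limit is measurable without any convergence assumption and equals the limit wherever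
    that exists; [fine] gives it some real value elsewhere. *)
Lemma measurable_ae_lim (x : nat -> R -> R) :
  (forall k, measurable_fun setT (x k)) ->
  exists2 l : R -> R, measurable_fun setT l &
    forall t, cvgn (x ^~ t) -> x ^~ t @ \oo --> l t.
Proof.
move=> mx; exists (fun t => fine (limn_esup (fun k => (x k t)%:E))).
  apply: measurableT_comp; first exact: fine_measurable.
  by apply: measurable_fun_limn_esup => k; exact/measurable_EFinP.
move=> t xt.
have : (fun k => (x k t)%:E) @ \oo --> (limn (x ^~ t))%:E.
  by apply: cvg_EFin; first exact: nearW.
by move=> /cvg_limn_einf_sup[_ ->].
Qed.

Theorem L2_complete u : (forall n, L2 (u n)) ->
  (forall e, 0 < e -> exists N, forall j k, (N <= j)%N -> (N <= k)%N ->
    hn (fun x => u j x - u k x) <= e) ->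
  exists2 f, L2 f & (fun n => hn (fun x => u n x - f x)) @ \oo --> (0 : R).
Proof.
move=> u2 uC.
have /choice[N hN] : forall k : nat, exists N : nat, forall i j,
    (N <= i)%N -> (N <= j)%N -> hn (fun x => u i x - u j x) <= (4^-1) ^+ k.
  by move=> k; apply: uC; rewrite exprn_gt0// invr_gt0.
(* Summing the thresholds makes [s k] and [s k.+1] both at least [N k], so consecutive terms of the
   subsequence are within [4^-k]; the summand [k] makes [s] unbounded. *)
pose s k := (k + \sum_(i < k.+1) N i)%N.
have sk k : (k <= s k)%N by rewrite leq_addr.
have sN k : (N k <= s k)%N.
  by rewrite /s big_ord_recr/= addnA leq_addl.
have sN1 k : (N k <= s k.+1)%N.
  apply: leq_trans (sN k) _; rewrite /s [in leqRHS]big_ord_recr/= addnA.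
  by apply: leq_trans (leq_addr _ _); rewrite leq_add2r.
pose v k := u (s k).
have vae := @rapid_subsequence_cvg v (fun k => u2 _) (fun k => hN k _ _ (sN1 k) (sN k)).
have mv k : cmeasurable (v k) by exact: (L2_meas (u2 _)).
have [F1 mF1 hF1] := @measurable_ae_lim (fun k x => complex.Re (v k x)) (fun k => (mv k).1).
have [F2 mF2 hF2] := @measurable_ae_lim (fun k x => complex.Im (v k x)) (fun k => (mv k).2).
pose F x : R[i] := F1 x +i* F2 x.
have mF : cmeasurable F by [].
have vF : {ae mu, forall x, ccvg (v ^~ x) (F x)}.
  by apply: aeS vae => x [h1 h2]; split; [exact: hF1|exact: hF2].
(* Fatou along the subsequence: the distance from [u j] to the a.e. limit inherits the Cauchy
   bound. *)
have est e M : 0 < e -> (forall j k, (M <= j)%N -> (M <= k)%N ->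
    hn (fun x => u j x - u k x) <= e) -> forall j, (M <= j)%N ->
    (Sq (fun x => (u j x - F x)%R) <= (e ^+ 2)%:E)%E.
  move=> e0 hM j Mj.
  apply: (@Sq_fatou (fun k x => u j x - v k x)).
  - by move=> k; apply: cmeasB => //; exact: L2_meas.
  - by apply: cmeasB => //; exact: L2_meas.
  - by apply: aeS vF => x vx; apply: ccvgB => //; exact: ccvg_cst.
  exists M => // k /= Mk.
  have vL : L2 (fun x => u j x - v k x) by apply: L2B => //; exact: u2.
  rewrite Sq_hn// lee_fin lerXn2r ?nnegrE ?hn_ge0 ?(ltW e0)//.
  by apply: hM => //; exact: leq_trans (sk k).
have uF2 e M : 0 < e -> (forall j k, (M <= j)%N -> (M <= k)%N ->
    hn (fun x => u j x - u k x) <= e) -> forall j, (M <= j)%N ->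
    L2 (fun x => u j x - F x).
  move=> e0 hM j Mj; apply/Lspc2P; split.
    by apply: cmeasB => //; exact: L2_meas.
  by apply: le_lt_trans (est e M e0 hM j Mj) _; rewrite ltry.
have L2F : L2 F.
  have [M hM] := uC 1 ltr01.
  have := L2B (u2 M) (uF2 1 M ltr01 hM M (leqnn M)).
  by under eq_fun do rewrite subKr.
exists F => //; apply/cvgrPdist_le => e e0.
have [M hM] := uC e e0; exists M => // n /= Mn.
rewrite sub0r normrN ger0_norm ?hn_ge0//.
apply: hn_le; [exact: L2B|exact: ltW|exact: (est e M)].
Qed.

End convergence.

(** * Density of trigonometric polynomials *)

Definition en (R : realType) (n : int) (t : R) : R[i] :=
  expi (2 * pi * (n%:~R * t)).

(** A list of pairs with repeated frequencies allowed: sums are then concatenations and products are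
    all-pairs lists. Repetitions are merged by [trig_uniq] where orthogonality is used. *)
Definition trig (R : realType) (s : seq (int * R[i])) (t : R) : R[i] :=
  \sum_(p <- s) p.2 * en p.1 t.

Definition frac (R : realType) (t : R) : R := t - (Num.floor t)%:~R.

Section trigonometric_polynomials.
Context {R : realType}.
Implicit Types (s r : seq (int * R[i])) (t : R).

Lemma enD m n t : en (m + n) t = en m t * en n t.
Proof. by rewrite /en -expiD; congr expi; rewrite intrD; ring. Qed.

Lemma en0 t : en 0 t = 1.
Proof. by rewrite /en mul0r mulr0 expi0. Qed.

Lemma enN n t : en (- n) t = conjc (en n t).
Proof. by rewrite /en -expiN; congr expi; rewrite intrN; ring. Qed.

Lemma en_add n t u : en n (t + u) = en n t * en n u.
Proof. by rewrite /en -expiD; congr expi; ring. Qed.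

Lemma en_int n (k : int) : en n k%:~R = 1 :> R[i].
Proof. by rewrite /en -intrM expi_int. Qed.

Lemma csq_en n t : csq (en n t) = 1.
Proof. exact: csq_expi. Qed.

Lemma cmeas_en n (q : R -> R) : measurable_fun [set: R] q ->
  cmeasurable (fun x => en n (q x)).
Proof. by move=> mq; apply: cmeas_expi; do 2 apply: measurable_funM => //. Qed.

Lemma cmeas_trig s (q : R -> R) : measurable_fun [set: R] q ->
  cmeasurable (fun x => trig s (q x)).
Proof.
move=> mq; apply: (@cmeas_sum _ _ s (fun p x => p.2 * en p.1 (q x))) => p.
by apply: cmeasM; [exact: cmeas_cst|exact: cmeas_en].
Qed.

Lemma trig_cat s r t : trig (s ++ r) t = trig s t + trig r t.
Proof. exact: big_cat. Qed.

Lemma trig_mul s r t :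
  trig [seq (p.1 + q.1, p.2 * q.2) | p <- s, q <- r] t = trig s t * trig r t.
Proof.
rewrite /trig big_allpairs_dep/= big_distrl/=; apply: eq_bigr => p _.
by rewrite big_distrr/=; apply: eq_bigr => q _; rewrite enD; ring.
Qed.

Lemma trig_bounded s : exists M : R, forall t, csq (trig s t) <= M.
Proof.
elim: s => [|p s [M hM]].
  by exists 0 => t; rewrite /trig big_nil /csq/= expr0n/= addr0.
exists (2 * csq p.2 + 2 * M) => t; rewrite /trig big_cons.
apply: le_trans (csqD_le _ _) _.
by rewrite csqM csq_en mulr1 lerD2l ler_wpM2l// hM.
Qed.

Lemma frac_itv t : 0 <= frac t < 1.
Proof.
rewrite /frac subr_ge0 floor_le_tmp/= ltrBlDl.
by have := floorD1_gt t; rewrite intrD addrC.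
Qed.

Lemma fracE t (k : int) : 0 <= t < 1 -> frac (t + k%:~R) = t.
Proof.
move=> t01; rewrite /frac floorDrz ?intr_int//.
have -> : Num.floor t = 0 by apply: floor_def; rewrite add0r.
by rewrite add0r intrKfloor addrK.
Qed.

Lemma frac_id t : 0 <= t < 1 -> frac t = t.
Proof. by move=> t01; rewrite -[in LHS](addr0 t) (fracE 0). Qed.

Lemma frac_addz t (k : int) : frac (t + k%:~R) = frac t.
Proof.
have -> : t + k%:~R = frac t + (Num.floor t + k)%:~R.
  by rewrite /frac intrD; ring.
by rewrite fracE// frac_itv.
Qed.

Lemma en_frac n t : en n (frac t) = en n t.
Proof.
have -> : en n t = en n (frac t + (Num.floor t)%:~R) by rewrite /frac subrK.
by rewrite en_add en_int mulr1.
Qed.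

Lemma measurable_frac : measurable_fun [set: R] (@frac R).
Proof.
apply: measurable_funB => //; apply: nondecreasing_measurable => // x y xy.
by rewrite ler_int le_floor.
Qed.

End trigonometric_polynomials.

(** * Polynomials converging to a step function *)

Section threshold.
Context {R : realType}.

Lemma bernoulli_lower (y : R) n : 0 <= y <= 1 -> 1 - n%:R * y <= (1 - y) ^+ n.
Proof.
move=> /andP[y0 y1]; elim: n => [|n IH]; first by rewrite mul0r subr0.
rewrite exprS; have := ler_wpM2l (_ : 0 <= 1 - y) IH.
rewrite subr_ge0 => /(_ y1); apply: le_trans.
rewrite -natr1; have : 0 <= n%:R * y * y by rewrite !mulr_ge0.
by nra.
Qed.

Lemma bernoulli_upper (y : R) n : 0 <= y <= 1 ->
  (1 - y) ^+ n * (1 + n%:R * y) <= 1.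
Proof.
move=> /andP[y0 y1]; elim: n => [|n IH]; first by rewrite mul0r addr0 mulr1.
apply: le_trans IH; rewrite exprSr -mulrA ler_wpM2l//.
  by rewrite exprn_ge0// subr_ge0.
have -> : (1 - y) * (1 + n.+1%:R * y) = 1 + n%:R * y - (n%:R * y * y + y * y).
  by rewrite -natr1; ring.
by rewrite gerBl addr_ge0 ?mulr_ge0.
Qed.

(** With [s = sqrt r], a geometric sum of [n] terms, each at least [s^n], gives
    [n s^n (1 - s) <= 1 - s^n]; hence [n r^n <= s^n / (1 - s)]. *)
Lemma mul_geometric_cvg0 (r : R) : 0 <= r < 1 ->
  (fun n => n%:R * r ^+ n) @ \oo --> (0 : R).
Proof.
move=> /andP[r0 r1].
set s := Num.sqrt r.
have s0 : 0 <= s by exact: sqrtr_ge0.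
have s1 : s < 1 by rewrite -sqrtr1 ltr_sqrt.
have rE : r = s * s by rewrite -expr2 sqr_sqrtr.
have bound n : n%:R * s ^+ n * (1 - s) <= 1 - s ^+ n.
  elim: n => [|n IH]; first by rewrite mul0r mul0r expr0 subrr.
  have sn0 : 0 <= s ^+ n by rewrite exprn_ge0.
  have sn1 : s ^+ n <= 1 by rewrite exprn_ile1// ltW.
  have h1 := ler_wpM2l s0 IH.
  have h2 : 0 <= (1 - s) * (1 - s * s ^+ n).
    rewrite mulr_ge0 ?subr_ge0 ?(ltW s1)//.
    by rewrite (le_trans _ sn1)// ler_piMl// ltW.
  rewrite exprS -natr1; move: h1 h2; move: (s ^+ n) sn0 sn1 => z; nra.
have lim : (fun n => (1 - s)^-1 * s ^+ n) @ \oo --> (0 : R).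
  by apply: cvg_geometric; rewrite ger0_norm.
apply: (squeeze_cvgr _ (cvg_cst 0) lim); near=> n.
rewrite mulr_ge0 ?exprn_ge0//= rE exprMn mulrA ler_wpM2r// ?exprn_ge0//.
rewrite -[leRHS]mul1r ler_pdivlMr ?subr_gt0// (le_trans (bound n))//.
by rewrite gerBl exprn_ge0.
Unshelve. all: by end_near. Qed.

(* The exponent [n 2^n] places the threshold of [(1 - x^n)^(n 2^n)] at 1/2 and
   makes the limit at the threshold itself equal to 0. *)
Lemma threshold_cvg (x : R) : 0 <= x <= 1 ->
  (fun n => (1 - x ^+ n) ^+ (n * 2 ^ n)) @ \oo --> ((x < 2^-1)%R%:R : R).
Proof.
move=> /andP[x0 x1].
have xn n : 0 <= x ^+ n <= 1 by rewrite exprn_ge0//= exprn_ile1.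
(* For [y = x^n] and the exponent [n 2^n], both Bernoulli bounds involve [n (2x)^n], which tends to
   0 for [x < 1/2] and is at least [n] for [x >= 1/2]. *)
have E n : (n * 2 ^ n)%:R * x ^+ n = n%:R * (2 * x) ^+ n :> R.
  by rewrite natrM natrX exprMn mulrA.
have [x2|x2] := ltP x 2^-1.
  have h : (fun n => 1 - n%:R * (2 * x) ^+ n) @ \oo --> (1 - 0 : R).
    apply: cvgB; first exact: cvg_cst.
    apply: mul_geometric_cvg0; rewrite mulr_ge0//=.
    by rewrite mulrC -ltr_pdivlMr// mul1r.
  rewrite subr0 in h; rewrite [X in _ --> X](_ : _ = 1)//.
  apply: (squeeze_cvgr _ h); last exact: cvg_cst.
  near=> n.
  rewrite -E bernoulli_lower//= exprn_ile1//.
    by have /andP[_] := xn n; rewrite subr_ge0.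
  by have /andP[+ _] := xn n; rewrite gerBl.
have h : (fun n => (1 + n%:R)^-1) @ \oo --> (0 : R).
  by under eq_fun do rewrite addrC natr1; exact: cvg_harmonic.
apply: (squeeze_cvgr _ (cvg_cst 0) h); near=> n.
have /andP[xn0 xn1] := xn n.
rewrite exprn_ge0 ?subr_ge0//= -[leRHS]mul1r ler_pdivlMr; last first.
  by rewrite ltr_pwDl.
apply: le_trans (bernoulli_upper (n * 2 ^ n) (xn n)).
rewrite ler_wpM2l ?exprn_ge0 ?subr_ge0// lerD2l E ler_peMr// exprn_ege1//.
by rewrite mulrC -ler_pdivrMr// mul1r.
Unshelve. all: by end_near. Qed.

End threshold.

(** * Weighted density of trigonometric polynomials among bounded periodic functions *)

Section approximation.
Context {R : realType}.
Notation mu := (@lebesgue_measure R).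
Variables (w q : R -> R).
Hypothesis w0 : forall x, 0 <= w x.
Hypothesis iw : mu.-integrable setT (EFin \o w).
Hypothesis mq : measurable_fun [set: R] q.

Let mw : measurable_fun [set: R] w.
Proof. by apply/measurable_EFinP; exact: measurable_int iw. Qed.

(** Squared distance of the composites of [m] and [m'] with [q], in the weight [w]. The substitution
    [q] is the identity for Parseval and [y -> a y] on the Fourier side. *)
Definition wdist (m m' : R -> R[i]) : \bar R :=
  (\int[mu]_x (csq (m (q x) - m' (q x)) * w x)%:E)%E.

Let wmeas (m m' : R -> R[i]) : cmeasurable m -> cmeasurable m' ->
  measurable_fun setT (fun x => csq (m (q x) - m' (q x)) * w x).
Proof.
move=> mm mm'; apply: measurable_funM => //; apply: meas_csq.
by apply: cmeasB; exact: cmeas_comp.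
Qed.

Let wge0 (m m' : R -> R[i]) x : 0 <= csq (m (q x) - m' (q x)) * w x.
Proof. by rewrite mulr_ge0 ?csq_ge0. Qed.

Lemma wdist_le (m m' n n' p p' : R -> R[i]) (a b : R) :
  cmeasurable m -> cmeasurable m' -> cmeasurable n -> cmeasurable n' ->
  cmeasurable p -> cmeasurable p' -> 0 <= a -> 0 <= b ->
  (forall t, csq (m t - m' t) <= a * csq (n t - n' t) + b * csq (p t - p' t)) ->
  (wdist m m' <= a%:E * wdist n n' + b%:E * wdist p p')%E.
Proof.
move=> mm mm' mn mn' mp mp' a0 b0 h.
rewrite /wdist -!ge0_integralZl ?lee_fin//; last 4 first.
- by apply/measurable_EFinP; exact: wmeas.
- by move=> x _; rewrite lee_fin wge0.
- by apply/measurable_EFinP; exact: wmeas.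
- by move=> x _; rewrite lee_fin wge0.
rewrite -ge0_integralD//; last 4 first.
- by move=> x _; rewrite -EFinM lee_fin mulr_ge0.
- by apply/measurable_EFinP; apply: measurable_funM => //; exact: wmeas.
- by move=> x _; rewrite -EFinM lee_fin mulr_ge0.
- by apply/measurable_EFinP; apply: measurable_funM => //; exact: wmeas.
apply: ge0_le_integral => //.
- by move=> x _; rewrite lee_fin wge0.
- by apply/measurable_EFinP; exact: wmeas.
- apply/measurable_EFinP; apply: measurable_funD;
    by apply: measurable_funM => //; exact: wmeas.
- move=> x _; rewrite -!EFinM -EFinD lee_fin !mulrA -mulrDl ler_wpM2r//.
Qed.

(** The uniform bound belongs to the notion because it makes the class stable under products, hence
    an algebra. *)
Definition approximable (m : R -> R[i]) : Prop :=
  [/\ cmeasurable m, exists M : R, forall t, csq (m t) <= M &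
      forall e : R, 0 < e -> exists s, (wdist m (trig s) <= e%:E)%E].

Let mtrig s : cmeasurable (@trig R s).
Proof. by apply: (@cmeas_trig R s id); exact: measurable_id. Qed.

Lemma approximable_trig s : approximable (trig s).
Proof.
split; [exact: mtrig|exact: trig_bounded|].
move=> e e0; exists s; rewrite /wdist (eq_integral (fun=> 0%E)).
  by rewrite integral0 lee_fin ltW.
by move=> x _; rewrite subrr /csq/= expr0n/= addr0 mul0r.
Qed.

Lemma approximable_cst (c : R[i]) : approximable (fun=> c).
Proof.
rewrite (_ : (fun=> c) = trig [:: (0, c)]); first exact: approximable_trig.
by apply/funext => t; rewrite /trig big_seq1 en0 mulr1.
Qed.

Lemma approximableD m m' : approximable m -> approximable m' ->
  approximable (fun t => m t + m' t).
Proof.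
move=> [mm [M hM] am] [mm' [M' hM'] am']; split.
- exact: cmeasD.
- exists (2 * M + 2 * M') => t; apply: le_trans (csqD_le _ _) _.
  by rewrite lerD// ler_wpM2l.
move=> e e0; have e4 : 0 < e / 4 by rewrite divr_gt0.
have [s hs] := am _ e4; have [s' hs'] := am' _ e4; exists (s ++ s').
have : (wdist (fun t => (m t + m' t)%R) (trig (s ++ s')) <=
    2%:E * wdist m (trig s) + 2%:E * wdist m' (trig s'))%E.
  apply: wdist_le => //; try exact: mtrig.
    exact: cmeasD.
  by move=> t; rewrite trig_cat opprD addrACA csqD_le.
move=> /le_trans; apply.
rewrite [leRHS](_ : _ = 2%:E * (e / 4)%:E + 2%:E * (e / 4)%:E)%E; last first.
  by rewrite -!EFinM -EFinD; congr EFin; field.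
by apply: leeD; apply: lee_wpmul2l.
Qed.

Lemma approximableM m m' : approximable m -> approximable m' ->
  approximable (fun t => m t * m' t).
Proof.
move=> [mm [M hM] am] [mm' [M' hM'] am']; split.
- exact: cmeasM.
- exists (M * M') => t; rewrite csqM ler_pM ?csq_ge0//.
move=> e e0.
have M0 : 0 <= M by apply: le_trans (hM 0); exact: csq_ge0.
(* The order of the choices matters: [s'] is chosen against the bound [M] of [m], and only then [s]
   against the bound [K] of [trig s']. The [+ 1] avoids a division by zero. *)
have [s' hs'] := am' (e / (4 * (M + 1))) (ltac:(by rewrite divr_gt0// mulr_gt0// ltr_wpDl)).
have [K hK] := trig_bounded s'.
have K0 : 0 <= K by apply: le_trans (hK 0); exact: csq_ge0.
have [s hs] := am (e / (4 * (K + 1))) (ltac:(by rewrite divr_gt0// mulr_gt0// ltr_wpDl)).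
exists [seq (p.1 + r.1, p.2 * r.2) | p <- s, r <- s'].
have : (wdist (fun t => (m t * m' t)%R)
    (trig [seq (p.1 + r.1, p.2 * r.2)%R | p <- s, r <- s']) <=
    (2 * M)%:E * wdist m' (trig s') + (2 * K)%:E * wdist m (trig s))%E.
  apply: wdist_le; rewrite ?mulr_ge0//; try exact: mtrig.
    exact: cmeasM.
  move=> t; rewrite trig_mul.
  rewrite (_ : _ - _ = m t * (m' t - trig s' t) + trig s' t * (m t - trig s t));
    last by ring.
  apply: le_trans (csqD_le _ _) _; rewrite !csqM -!mulrA.
  by rewrite lerD// ler_wpM2l// ler_wpM2r ?csq_ge0.
move=> /le_trans; apply.
have hk (L : R) : 0 <= L -> L / (L + 1) <= 1.
  by move=> L0; rewrite ler_pdivrMr ?mul1r ?lerDl// ltr_wpDl.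
apply: (@le_trans _ _ ((2 * M)%:E * (e / (4 * (M + 1)))%:E +
    (2 * K)%:E * (e / (4 * (K + 1)))%:E)%E).
  by apply: leeD; apply: lee_wpmul2l; rewrite ?lee_fin ?mulr_ge0.
rewrite -!EFinM -EFinD lee_fin.
rewrite (_ : _ + _ = e / 2 * (M / (M + 1)) + e / 2 * (K / (K + 1))).
  have := hk _ M0; have := hk _ K0.
  have := divr_gt0 e0 (ltr0n R 2); nra.
by field; rewrite !gt_eqF// ltr_wpDl.
Qed.

Lemma approximable_exp m n : approximable m -> approximable (fun t => m t ^+ n).
Proof.
move=> am; elim: n => [|n IH]; first exact: approximable_cst.
by under eq_fun do rewrite exprS; exact: approximableM.
Qed.

(** Dominated convergence with dominating function [4 M w]. Closure of an algebra under uniformly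
    bounded pointwise limits is what leads from trigonometric polynomials to indicators, and from
    indicators to bounded measurable functions. *)
Lemma approximable_lim (u : nat -> R -> R[i]) m (M : R) :
  (forall n, approximable (u n)) -> (forall n t, csq (u n t) <= M) ->
  (forall t, ccvg (u ^~ t) (m t)) -> approximable m.
Proof.
move=> au uM um.
have mu_ n : cmeasurable (u n) by case: (au n).
have mm : cmeasurable m.
  split.
  - by apply: (measurable_fun_cvg (fun n => (mu_ n).1)) => x _; have [] := um x.
  - by apply: (measurable_fun_cvg (fun n => (mu_ n).2)) => x _; have [] := um x.
have mM t : csq (m t) <= M.
  have := ccvg_csq (um t) => /cvg_lim <-//; apply: limr_le.
    by apply/cvg_ex; exists (csq (m t)); exact: ccvg_csq.
  by near=> n; exact: uM.
split=> //; first by exists M.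
move=> e e0.
have cv : (fun n => wdist m (u n)) @ \oo --> 0%E.
  have [| | | | |_ _] := @dominated_convergence _ _ _ mu setT measurableT
    (fun n x => (csq (m (q x) - u n (q x)) * w x)%:E) (cst 0%E)
    (fun x => (4 * M * w x)%:E).
  - by move=> n; apply/measurable_EFinP; exact: wmeas.
  - exact: measurable_cst.
  - apply: aeW => x _; apply: cvg_EFin; first exact: nearW.
    rewrite -(mul0r (w x)).
    apply: cvgM; last exact: cvg_cst.
    have := ccvg_csq (ccvgB (ccvg_cst (m (q x))) (um (q x))).
    by rewrite subrr /csq/= expr0n/= addr0.
  - exact: integrable_Zl.
  - apply: aeW => x n _; rewrite gee0_abs ?lee_fin ?wge0// ler_wpM2r//.
    apply: le_trans (csqB_le _ _) _.
    by have := mM (q x); have := uM n (q x); lra.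
  by rewrite integral0.
have e4 : 0 < e / 4 by rewrite divr_gt0.
have [n hn] : exists n, (wdist m (u n) <= (e / 4)%:E)%E.
  have : \forall n \near \oo, (wdist m (u n) < (e / 4)%:E)%E.
    exact: cvge0_lt cv e4.
  by move=> [N _ hN]; exists N; apply: ltW; exact: hN (leqnn N).
have [_ _ /(_ _ e4)[s hs]] := au n; exists s.
have : (wdist m (trig s) <=
    2%:E * wdist m (u n) + 2%:E * wdist (u n) (trig s))%E.
  apply: wdist_le => //; try exact: mtrig.
  by move=> t; rewrite -(subrKA (u n t)) csqD_le.
move=> /le_trans; apply.
rewrite [leRHS](_ : _ = 2%:E * (e / 4)%:E + 2%:E * (e / 4)%:E)%E; last first.
  by rewrite -!EFinM -EFinD; congr EFin; field.
by apply: leeD; apply: lee_wpmul2l.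
Unshelve. all: by end_near. Qed.

(** These sets form a sigma-algebra, to be compared with the Borel sets through [frac]. *)
Definition approx_set (E : set R) : Prop :=
  approximable (fun t => (\1_E t)%:C).

Let csq_indic (E : set R) t : csq (\1_E t)%:C <= 1 :> R.
Proof. by rewrite csq_real indicE; case: (_ \in _); rewrite ?expr1n ?expr0n. Qed.

Lemma approx_set_ext (E F : set R) :
  (forall t, E t <-> F t) -> approx_set E -> approx_set F.
Proof. by move=> /predeqP ->. Qed.

Lemma approx_setC E : approx_set E -> approx_set (~` E).
Proof.
move=> aE; have := approximableD (approximable_cst 1)
  (approximableM (approximable_cst (-1)) aE).
congr approximable; apply/funext => t; rewrite !indicE in_setC.
by case: (_ \in _) => /=; rewrite ?mulr1 ?mulr0 ?subrr ?addr0.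
Qed.

Lemma approx_setI E F : approx_set E -> approx_set F -> approx_set (E `&` F).
Proof.
move=> aE aF; have := approximableM aE aF.
congr approximable; apply/funext => t; rewrite indicI -rmorphM//.
Qed.

Lemma approx_setU E F : approx_set E -> approx_set F -> approx_set (E `|` F).
Proof.
move=> aE aF; rewrite -(setCK (E `|` F)) setCU.
by apply: approx_setC; apply: approx_setI; exact: approx_setC.
Qed.

Lemma approx_set_bigcup (E : nat -> set R) : (forall n, approx_set (E n)) ->
  approx_set (\bigcup_n E n).
Proof.
move=> aE.
apply: (@approximable_lim (fun n t => (\1_(\big[setU/set0]_(i < n) E i) t)%:C)
  _ 1) => //.
  elim=> [|n IH]; last by rewrite big_ord_recr/=; exact: approx_setU.
  have := approximable_cst 0; congr approximable; apply/funext => t.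
  by rewrite big_ord0 indic0.
move=> t; apply: ccvg_real; apply: cvg_near_cst.
have [[n _ Et]|nEt] := pselect ((\bigcup_n E n) t).
  exists n.+1 => // k /= nk.
  rewrite !indicE !mem_set//; first by exists n.
  by rewrite -bigcup_mkord; exists n.
near=> k; rewrite !indicE !memNset// -bigcup_mkord => -[i _ Et].
by apply: nEt; exists i.
Unshelve. all: by end_near. Qed.

(** An affine map sends [f] into [[0, 1]] and the level [c] to [1/2]; the threshold polynomials in
    the rescaled function converge to the indicator of [f < c]. *)
Lemma approx_set_lt (f : R -> R) (M c : R) : (forall t, `|f t| <= M) ->
  approximable (fun t => (f t)%:C) -> approx_set [set t | f t < c].
Proof.
move=> fM af.
have M0 : 0 <= M by apply: le_trans (fM 0).
(* At least twice [|f - c|], and nonzero even when [M = c = 0]. *)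
pose K := 2 * (M + `|c| + 1).
have K0 : 0 < K by rewrite mulr_gt0// ltr_wpDl ?addr_ge0.
pose y t := 2^-1 + (f t - c) / K.
have y01 t : 0 <= y t <= 1.
  have h : `|f t - c| <= 2^-1 * K.
    rewrite /K mulKf// (le_trans (ler_normB _ _))//.
    by rewrite -addrA lerD ?fM// lerDl.
  have : `|(f t - c) / K| <= 2^-1 by rewrite normrM normfV (gtr0_norm K0) ler_pdivrMr.
  by rewrite ler_norml /y => /andP[]; lra.
have ay : approximable (fun t => (y t)%:C).
  have := approximableD (approximable_cst (2^-1 - c / K)%:C)
    (approximableM (approximable_cst (K^-1)%:C) af).
  congr approximable; apply/funext => t.
  by rewrite -rmorphM -rmorphD /y; congr (_%:C); ring.
apply: (@approximable_lim (fun n t => ((1 - y t ^+ n) ^+ (n * 2 ^ n))%:C) _ 1).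
- move=> n.
  have := approximable_exp (n * 2 ^ n) (approximableD (approximable_cst 1)
    (approximableM (approximable_cst (-1)) (approximable_exp n ay))).
  congr approximable; apply/funext => t.
  by rewrite !rmorphXn rmorphB rmorphXn mulN1r.
- move=> n t; rewrite csq_real; have /andP[y0 y1] := y01 t.
  have : 0 <= y t ^+ n <= 1 by rewrite exprn_ge0//= exprn_ile1.
  move=> /andP[z0 z1]; rewrite expr_le1// ?exprn_ge0 ?exprn_ile1 ?subr_ge0//.
  by rewrite gerBl.
- move=> t; apply: ccvg_real.
  have := threshold_cvg (y01 t).
  rewrite indicE; suff -> : (y t < 2^-1) = (t \in [set t | f t < c]) by [].
  have -> : (y t < 2^-1) = (f t < c).
    by rewrite /y gtrDl pmulr_llt0 ?invr_gt0// subr_lt0.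
  by apply/idP/idP => [ft|/set_mem]; [rewrite mem_set|].
Qed.

Lemma approximable_cos : approximable (fun t => (cos (2 * pi * t))%:C).
Proof.
have := approximable_trig [:: (1, (2^-1)%:C); (-1, (2^-1)%:C)].
congr approximable; apply/funext => t.
rewrite /trig big_cons big_seq1/= enN /en mul1r.
by apply: complexP; rewrite /= ?ReM ?ImM/=; field.
Qed.

Lemma approximable_sin : approximable (fun t => (sin (2 * pi * t))%:C).
Proof.
have := approximable_trig [:: (1, 0 -i* (2^-1)); (-1, 0 +i* (2^-1))].
congr approximable; apply/funext => t.
rewrite /trig big_cons big_seq1/= enN /en mul1r.
by apply: complexP; rewrite /= ?ReM ?ImM/=; field.
Qed.


Lemma sin_2pi_frac (t : R) : sin (2 * pi * t) = sin (2 * pi * frac t).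
Proof.
by have := en_frac 1 t; rewrite /en !mul1r => /(congr1 (@complex.Im R))/= ->.
Qed.

Lemma cos_2pi_frac (t : R) : cos (2 * pi * t) = cos (2 * pi * frac t).
Proof.
by have := en_frac 1 t; rewrite /en !mul1r => /(congr1 (@complex.Re R))/= ->.
Qed.

Lemma sin_2pi_lt0 (s : R) : 0 <= s < 1 -> (sin (2 * pi * s) < 0) = (2^-1 < s).
Proof.
move=> /andP[s0 s1]; have p0 := pi_gt0 R.
have [h|h] := ltP 2^-1 s; last first.
  apply/negbTE; rewrite -leNgt sin_ge0_pi//; apply/andP; split.
    by rewrite !mulr_ge0// ltW.
  by rewrite mulrAC ger_pMl//; lra.
have -> : 2 * pi * s = (2 * s - 1) * pi + pi by ring.
rewrite sinDpi oppr_lt0 sin_gt0_pi// mulr_gt0//=; last by lra.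
by rewrite gtr_pMl//; lra.
Qed.

Lemma cos_2pi_lt (s t : R) : 0 <= s <= 2^-1 -> 0 <= t <= 2^-1 ->
  (cos (2 * pi * s) < cos (2 * pi * t)) = (t < s).
Proof.
move=> hs ht; have p0 := pi_gt0 R.
have h (r : R) : 0 <= r <= 2^-1 -> 2 * pi * r \in `[0, pi].
  move=> /andP[r0 r1]; rewrite in_itv/= !mulr_ge0 ?(ltW p0)//=.
  by rewrite mulrAC ger_pMl//; lra.
by rewrite ltr_cos ?h// ltr_pM2l// mulr_gt0.
Qed.

Lemma cos_2pi_sub (s : R) : cos (2 * pi * s) = cos (2 * pi * (1 - s)).
Proof.
have -> : 2 * pi * (1 - s) = - (2 * pi * s) + pi *+ 2 by rewrite mulr2n; ring.
by rewrite cosD2pi cosN.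
Qed.

Lemma approx_setT : approx_set setT.
Proof.
have := approximable_cst 1; congr approximable; apply/funext => t.
by rewrite indicE in_setT.
Qed.

Lemma approx_set0 : approx_set set0.
Proof. by rewrite -setCT; exact: approx_setC approx_setT. Qed.

(** The sign of [sin (2 pi t)] tells which half of the period contains [t], and [cos (2 pi t)] is
    monotone on each half. So the ray is a union ([x <= 1/2]) or an intersection ([x > 1/2]) of
    level sets of sine and cosine. *)
Lemma approx_set_frac_gt (x : R) : approx_set [set t | x < frac t].
Proof.
have asin : approx_set [set t | sin (2 * pi * t) < 0].
  apply: (@approx_set_lt (fun t => sin (2 * pi * t)) 1); last exact: approximable_sin.
  by move=> t; exact: sin_max.
have acos c : approx_set [set t | cos (2 * pi * t) < c].
  apply: (@approx_set_lt (fun t => cos (2 * pi * t)) 1); last exact: approximable_cos.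
  by move=> t; exact: cos_max.
have aNcos c : approx_set [set t | - cos (2 * pi * t) < c].
  apply: (@approx_set_lt (fun t => - cos (2 * pi * t)) 1).
    by move=> t; rewrite normrN; exact: cos_max.
  have := approximableM (approximable_cst (-1)) approximable_cos.
  by congr approximable; apply/funext => t; rewrite mulN1r rmorphN.
have [x0|x0] := ltP x 0.
  apply: approx_set_ext approx_setT => t; split => // _ /=.
  by have /andP[+ _] := frac_itv t; exact: lt_le_trans.
have [x1|x1] := leP 1 x.
  apply: approx_set_ext approx_set0 => t; split => //= xt.
  by have /andP[_] := frac_itv t; rewrite ltNge (le_trans x1 (ltW xt)).
have [x2|x2] := leP x 2^-1.
  apply: approx_set_ext (approx_setU asin (acos (cos (2 * pi * x)))) => t.
  rewrite /setU/= sin_2pi_frac cos_2pi_frac sin_2pi_lt0 ?frac_itv//.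
  have /andP[t0 t1] := frac_itv t.
  have [h|h] := ltP 2^-1 (frac t).
    by split => // _; [exact: le_lt_trans h|left].
  by rewrite cos_2pi_lt ?t0 ?x0//; split => [[]|]; [| |right].
apply: approx_set_ext (approx_setI asin (aNcos (- cos (2 * pi * x)))) => t.
rewrite /setI/= sin_2pi_frac cos_2pi_frac sin_2pi_lt0 ?frac_itv// ltrN2.
have /andP[t0 t1] := frac_itv t.
have [h|h] := ltP 2^-1 (frac t).
  rewrite (cos_2pi_sub x) (cos_2pi_sub (frac t)) cos_2pi_lt; last 2 first.
  - by apply/andP; split; lra.
  - by apply/andP; split; lra.
  by rewrite ltrD2l ltrN2; split => [[]|].
by split => [[]//|xt]; have := lt_trans x2 xt; rewrite ltNge h.
Qed.

(** Open rays generate the Borel sets, and the sets whose preimage is approximable form a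
    sigma-algebra. *)
Lemma approx_set_frac (E : set R) : measurable E ->
  approx_set ((@frac R) @^-1` E).
Proof.
have : (@ocitv R).-sigma.-measurable `<=` [set E | approx_set ((@frac R) @^-1` E)].
  rewrite RGenOInfty.measurableE; apply: smallest_sub.
    split => /=.
    - by rewrite preimage_set0; exact: approx_set0.
    - by move=> A aA; rewrite setTD preimage_setC; exact: approx_setC.
    - by move=> A aA; rewrite preimage_bigcup; exact: approx_set_bigcup.
  move=> _ [x ->] /=; apply: approx_set_ext (approx_set_frac_gt x) => t.
  by rewrite /= in_itv/= andbT.
by move=> h /h.
Qed.

(** The carry is the next binary digit of [y]. Its support is measurable, so each digit contributes
    an approximable indicator. *)
Lemma floor_double (y : R) :
  (Num.floor (2 * y))%:~R = 2 * (Num.floor y)%:~R + (2^-1 <= frac y)%R%:R :> R.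
Proof.
have /andP[f0 f1] := frac_itv y.
have yE : y = frac y + (Num.floor y)%:~R by rewrite /frac subrK.
have E : Num.floor (2 * y) = 2 * Num.floor y + (2^-1 <= frac y)%R%:R.
  apply: floor_def; have [h|h] := leP 2^-1 (frac y);
  rewrite ?addr0 !intrD !intrM /= [in X in _ <= X]yE [in X in X < _]yE;
  by apply/andP; split; lra.
by rewrite E intrD intrM; case: leP.
Qed.

(* Partial sums of the binary expansion of [m]. *)
Lemma approximable_digits (m : R -> R) n : measurable_fun [set: R] m ->
  (forall t, 0 <= m t < 1) ->
  approximable (fun t => ((Num.floor (2 ^+ n * m (frac t)))%:~R / 2 ^+ n)%:C).
Proof.
move=> mm m01; elim: n => [|n IH].
  have := approximable_cst 0; congr approximable; apply/funext => t.
  by rewrite expr0 mul1r (floor_def (_ : 0 <= _ < (0 + 1)%:~R)) ?mul0r.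
pose E := [set t : R | 2^-1 <= frac (2 ^+ n * m t)].
have mE : measurable E.
  rewrite (_ : E = (fun t => frac (2 ^+ n * m t)) @^-1` `[2^-1, +oo[); last first.
    by apply/seteqP; split => t /=; rewrite in_itv/= andbT.
  rewrite -[X in measurable X]setTI.
  apply: (measurableT_comp measurable_frac) => //.
  exact: measurable_funM.
have := approximableD IH (approximableM (approximable_cst ((2 ^+ n.+1)^-1)%:C)
  (approx_set_frac mE)).
congr approximable; apply/funext => t.
rewrite -rmorphM -rmorphD/=; congr (_%:C).
rewrite [in RHS]exprS -mulrA floor_double indicE.
have -> : (t \in frac (R:=R) @^-1` E) = (2^-1 <= frac (2 ^+ n * m (frac t))).
  by apply/idP/idP => [/set_mem|h]; rewrite ?mem_set.
by rewrite exprS; field; rewrite ?expf_neq0.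
Qed.

Lemma approximable_frac01 (m : R -> R) : measurable_fun [set: R] m ->
  (forall t, 0 <= m t < 1) -> approximable (fun t => (m (frac t))%:C).
Proof.
move=> mm m01.
apply: (@approximable_lim
  (fun n t => ((Num.floor (2 ^+ n * m (frac t)))%:~R / 2 ^+ n)%:C) _ 1).
- by move=> n; exact: approximable_digits.
- move=> n t; rewrite csq_real; have /andP[h0 h1] := m01 (frac t).
  rewrite expr_le1// ?divr_ge0 ?exprn_ge0//; last first.
    by rewrite ler0z floor_ge0 mulr_ge0// exprn_ge0.
  rewrite ler_pdivrMr ?exprn_gt0// mul1r (le_trans (floor_le_tmp _))//.
  by rewrite ler_piMr ?(ltW h1)// exprn_ge0.
move=> t; apply: ccvg_real.
have h : (fun n => m (frac t) - (2^-1) ^+ n) @ \oo --> (m (frac t) - 0).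
  apply: cvgB; first exact: cvg_cst.
  by apply: cvg_expr; rewrite gtr0_norm ?invr_gt0// invf_lt1// ltr1n.
rewrite subr0 in h; apply: (squeeze_cvgr _ h); last exact: cvg_cst.
near=> n.
have n0 : (0 : R) < 2 ^+ n by rewrite exprn_gt0.
rewrite ler_pdivlMr// ler_pdivrMr// mulrBl exprVn mulVf ?gt_eqF//.
rewrite [m (frac t) * _]mulrC floor_le_tmp andbT lerBlDr.
by rewrite ltW// -[1]/(1%:~R) -intrD floorD1_gt.
Unshelve. all: by end_near. Qed.

Lemma approximable_frac_real (m : R -> R) (M : R) : measurable_fun [set: R] m ->
  (forall t, `|m t| <= M) -> approximable (fun t => (m (frac t))%:C).
Proof.
move=> mm mM.
have M0 : 0 <= M by apply: le_trans (mM 0).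
pose K := 2 * M + 1.
have K0 : 0 < K by rewrite ltr_wpDl// mulr_ge0.
have mn : measurable_fun [set: R] (fun t => (m t + M) / K).
  by apply: measurable_funM => //; exact: measurable_funD.
have := approximableD (approximable_cst (- M)%:C)
  (approximableM (approximable_cst K%:C) (approximable_frac01 mn _)).
have h t : 0 <= (m t + M) / K < 1.
  have := mM t; rewrite ler_norml => /andP[h1 h2].
  rewrite divr_ge0 ?(ltW K0)//=; last by lra.
  by rewrite ltr_pdivrMr// mul1r /K; lra.
move=> /(_ h); congr approximable; apply/funext => t.
by rewrite -rmorphM -rmorphD; congr (_%:C); field; rewrite gt_eqF.
Qed.

(** The real and imaginary parts are affine images of functions with values in [[0, 1)]; those are
    bounded limits of their binary truncations, which are finite combinations of approximable
    indicators. *)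
Theorem trig_dense (m : R -> R[i]) (M e : R) : cmeasurable m ->
  (forall t, csq (m t) <= M) -> 0 < e ->
  exists s, (\int[mu]_x (csq (m (frac (q x)) - trig s (q x)) * w x)%:E <= e%:E)%E.
Proof.
move=> [m1 m2] mM e0.
have M0 : 0 <= M by apply: le_trans (mM 0); exact: csq_ge0.
have bR t : `|complex.Re (m t)| <= Num.sqrt M.
  by rewrite (le_trans (Re_le_normc _))// normc_csq ler_wsqrtr.
have bI t : `|complex.Im (m t)| <= Num.sqrt M.
  by rewrite (le_trans (Im_le_normc _))// normc_csq ler_wsqrtr.
have : approximable (fun t => m (frac t)).
  have := approximableD (approximable_frac_real m1 bR)
    (approximableM (approximable_cst 'i) (approximable_frac_real m2 bI)).
  by congr approximable; apply/funext => t; rewrite [RHS]complexE.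
by move=> [_ _ /(_ e e0)].
Qed.

End approximation.

(** * Periodization *)

Section affine_change_of_variables.
Context {R : realType}.
Notation mu := (@lebesgue_measure R).
Variables (c d : R).
Hypothesis c0 : 0 < c.

Lemma measurable_affine : measurable_fun [set: R] (fun y : R => c * y + d).
Proof. by apply: measurable_funD => //; exact: measurable_funM. Qed.

Let aff (y : measurableTypeR R) : measurableTypeR R := c * y + d.

Let maff : measurable_fun [set: measurableTypeR R] aff.
Proof. exact: measurable_affine. Qed.

(** Both sides are measures in [A] that agree on half-open intervals, and these determine Lebesgue
    measure. *)
Lemma lebesgue_measure_affine (A : set R) : measurable A ->
  mu A = (c%:E * mu (aff @^-1` A))%E.
Proof.
move=> mA.
have cn : 0 <= c by exact: ltW.
pose m := mscale (NngNum cn)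
  (measure_function_pushforward__canonical__measure_function_Measure mu maff).
apply: (@lebesgue_measure_unique R m) => // _ [[u v]] _ <- /=.
rewrite /m /mscale/= /pushforward.
have -> : aff @^-1` [set` `]u, v]] = [set` `](u - d) / c, (v - d) / c]].
  apply/seteqP; split => y /=; rewrite /aff !in_itv/= ltr_pdivrMr// ler_pdivlMr//
    ltrBlDr lerBrDr mulrC//.
rewrite !lebesgue_measure_itv/= !lte_fin ltr_pM2r ?invr_gt0// ltrD2r.
case: ifPn => uv; last by rewrite mule0.
by rewrite -!EFinB -EFinM; congr EFin; field; rewrite gt_eqF.
Qed.

Lemma ge0_integral_affine (h : R -> \bar R) : measurable_fun setT h ->
  (forall x, 0 <= h x)%E ->
  (\int[mu]_x h x = c%:E * \int[mu]_y h (c * y + d)%R)%E.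
Proof.
move=> mh h0.
have cn : 0 <= c by exact: ltW.
pose m := mscale (NngNum cn)
  (measure_function_pushforward__canonical__measure_function_Measure mu maff).
rewrite (eq_measure_integral m) => [|A mA _]; last exact: lebesgue_measure_affine.
rewrite ge0_integral_mscale//=.
by rewrite (ge0_integral_pushforward maff).
Qed.

End affine_change_of_variables.

(** * Splitting an integral over the line into unit intervals *)

Section unfold.
Context {R : realType}.
Notation mu := (@lebesgue_measure R).
Notation U := (`[0%R, 1%R[%classic : set R).

(** An enumeration of the integers, even [k] going to [k/2] and odd [k] to [-(k+1)/2]. It turns sums
    over [int] into series, which can be measured and integrated term by term. *)
Definition int_of_nat (k : nat) : int :=
  if odd k then Negz k./2 else Posz k./2.

Lemma int_of_nat_bij : set_bij [set: nat] [set: int] int_of_nat.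
Proof.
split => //.
- move=> i j _ _; rewrite /int_of_nat => h.
  rewrite -(odd_double_half i) -(odd_double_half j).
  by move: h; case: (odd i); case: (odd j) => // -[->].
- move=> [n|n] _ /=; [exists n.*2|exists n.*2.+1] => //.
  + by rewrite /int_of_nat odd_double doubleK.
  + by rewrite /int_of_nat/= odd_double/= uphalf_double.
Qed.

Lemma esum_int_nneseries (x : int -> \bar R) : (forall n, 0 <= x n)%E ->
  (\esum_(n in [set: int]) x n = \sum_(k <oo) x (int_of_nat k))%E.
Proof.
by move=> x0; rewrite (reindex_esum _ _ _ x int_of_nat_bij) nneseries_esumT.
Qed.

Lemma measurable_esum_int (D : set R)
  (f : int -> R -> \bar R) : (forall n x, 0 <= f n x)%E ->
  (forall n, measurable_fun D (f n)) ->
  measurable_fun D (fun x => \esum_(n in [set: int]) f n x)%E.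
Proof.
move=> f0 mf; under eq_fun do rewrite esum_int_nneseries//.
by apply: (@ge0_emeasurable_sum _ _ _ D (fun k => f (int_of_nat k)) xpredT).
Qed.

Lemma integral_esum_int (D : set R) (f : int -> R -> \bar R) : measurable D ->
  (forall n x, 0 <= f n x)%E -> (forall n, measurable_fun D (f n)) ->
  (\int[mu]_(x in D) (\esum_(n in [set: int]) f n x) =
   \esum_(n in [set: int]) \int[mu]_(x in D) f n x)%E.
Proof.
move=> mD f0 mf; under eq_integral do rewrite esum_int_nneseries//.
transitivity (\sum_(k <oo) \int[mu]_(x in D) f (int_of_nat k) x)%E.
  by apply: integral_nneseries => // k; exact: mf.
apply/esym; apply: (@esum_int_nneseries (fun n => \int[mu]_(x in D) f n x)%E).
by move=> n; apply: integral_ge0 => x _; exact: f0.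
Qed.

Lemma ge0_integral_periodize (g : R -> \bar R) : measurable_fun setT g ->
  (forall x, 0 <= g x)%E ->
  (\int[mu]_x g x = \int[mu]_(t in U) \esum_(n in [set: int]) g (t + n%:~R)%R)%E.
Proof.
move=> mg g0.
have mgn (n : int) : measurable_fun [set: R] (fun t => g (t + n%:~R)).
  by apply: (measurableT_comp mg); exact: measurable_funD.
rewrite integral_esum_int//; last first.
  by move=> n; exact: measurable_funTS.
rewrite (@esum_int_nneseries (fun n => \int[mu]_(x in U) g (x + n%:~R)%R)%E); last first.
  by move=> n; exact: integral_ge0.
(* The set where the floor equals [int_of_nat k]; these intervals partition the line. *)
pose F k : set R := `[(int_of_nat k)%:~R, (int_of_nat k)%:~R + 1[%classic.
have FE k x : F k x <-> Num.floor x = int_of_nat k.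
  rewrite /F/= in_itv/=; split => [h|<-]; first by apply: floor_def; rewrite intrD.
  by rewrite floor_le_tmp/= -[1]/(1%:~R) -intrD floorD1_gt.
have FT : \bigcup_k F k = setT.
  apply/seteqP; split => // x _.
  have [_ _ /(_ (Num.floor x) I)[k _ hk]] := int_of_nat_bij.
  by exists k => //; apply/FE.
have tF : trivIset setT F.
  move=> i j _ _ [x [/FE xi /FE xj]].
  have [_ inj _] := int_of_nat_bij.
  by apply: inj; rewrite ?in_setT// -xi -xj.
rewrite -[in LHS]FT ge0_integral_bigcup//; last 2 first.
- by move=> k; exact: measurable_itv.
- by rewrite FT.
apply: eq_eseriesr => k _.
rewrite integral_mkcond [RHS]integral_mkcond.
rewrite (@ge0_integral_affine _ 1 (int_of_nat k)%:~R)//; last 2 first.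
- by apply/(measurable_restrictT _ _).1; [exact: measurable_itv|exact: measurable_funTS].
- by move=> x; rewrite /patch; case: ifP.
rewrite mul1e; apply: eq_integral => t _; rewrite /patch mul1r.
have -> : (t + (int_of_nat k)%:~R \in F k) = (t \in U).
  apply/idP/idP => /set_mem; rewrite /F/= !in_itv/= => /andP[h1 h2];
  rewrite mem_set//= in_itv/=; apply/andP; split; lra.
by [].
Qed.

Lemma ge0_integral_unfold (a : R) (h : R -> \bar R) : 0 < a ->
  measurable_fun setT h -> (forall x, 0 <= h x)%E ->
  (\int[mu]_x h x =
   \int[mu]_(t in U) (a^-1%:E * \esum_(n in [set: int]) h ((t + n%:~R) / a)%R))%E.
Proof.
move=> a0 mh h0.
have a0' : 0 < a^-1 by rewrite invr_gt0.
rewrite (@ge0_integral_affine _ a^-1 0)//.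
under eq_integral do rewrite addr0 mulrC.
have mha : measurable_fun [set: R] (fun y => h (y / a)).
  by apply: (measurableT_comp mh); exact: measurable_funM.
rewrite (ge0_integral_periodize mha) ?ge0_integralZl//.
- apply: measurable_esum_int => // n; apply: measurable_funTS.
  by apply: (measurableT_comp mha); exact: measurable_funD.
- by move=> x _; exact: esum_ge0.
- by rewrite lee_fin ltW.
Qed.

End unfold.

Definition unit_itv (R : realType) : set R := `[0%R, 1%R[%classic.

(* [p_fun phi a] is [pz a] of [|fourier phi|^2]. *)
Definition pz (R : realType) (a : R) (r : R -> R) (t : R) : \bar R :=
  (a^-1%:E * \esum_(n in [set: int]) (r ((t + n%:~R) / a))%:E)%E.

(** Extension by zero from the unit interval: integrals over a period become integrals over the
    line, so that the same [ip2] and [Sq] serve both. *)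
Definition cres (R : realType) (f : R -> R[i]) (t : R) : R[i] :=
  (\1_(@unit_itv R) t)%:C * f t.

(** * Periodization and periodic multipliers *)

Section periodization.
Context {R : realType}.
Notation mu := (@lebesgue_measure R).
Notation U := (@unit_itv R).
Variable a : R.
Hypothesis a0 : 0 < a.
Implicit Types r T : R -> R.

Lemma measurable_unit_itv : measurable U.
Proof. exact: measurable_itv. Qed.

Lemma measurable_indic_unit : measurable_fun [set: R] (\1_U : R -> R).
Proof. by apply: measurable_indic; exact: measurable_unit_itv. Qed.

Let ai0 : (0 <= a^-1%:E)%E.
Proof. by rewrite lee_fin invr_ge0 ltW. Qed.

Lemma pz_ge0 r t : (forall x, 0 <= r x) -> (0 <= pz a r t)%E.
Proof.
by move=> r0; rewrite /pz mule_ge0// esum_ge0// => n _; rewrite lee_fin.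
Qed.

Lemma measurable_pz r : measurable_fun [set: R] r -> (forall x, 0 <= r x) ->
  measurable_fun [set: R] (pz a r).
Proof.
move=> mr r0; apply: emeasurable_funM => //.
apply: measurable_esum_int => [n x|n]; first by rewrite lee_fin.
apply/measurable_EFinP; apply: (measurableT_comp mr).
by apply: measurable_funM => //; exact: measurable_funD.
Qed.

Lemma integral_pz r : measurable_fun [set: R] r -> (forall x, 0 <= r x) ->
  (\int[mu]_x (r x)%:E = \int[mu]_(t in U) pz a r t)%E.
Proof.
move=> mr r0; apply: (ge0_integral_unfold a0); first exact/measurable_EFinP.
by move=> x; rewrite lee_fin.
Qed.

Lemma pz_fin r : mu.-integrable setT (EFin \o r) -> (forall x, 0 <= r x) ->
  {ae mu, forall t, U t -> pz a r t \is a fin_num}.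
Proof.
move=> ir r0.
have mr : measurable_fun [set: R] r by apply/measurable_EFinP; exact: measurable_int ir.
suff : mu.-integrable U (pz a r).
  by move=> h; have := integrable_ae _ h; apply; exact: measurable_unit_itv.
apply/integrableP; split; first by apply: measurable_funTS; exact: measurable_pz.
under eq_integral do rewrite gee0_abs ?pz_ge0//.
rewrite -integral_pz//.
have /integrableP[_] := ir.
by under eq_integral do rewrite /= ger0_norm//.
Qed.

Lemma esum_intZ (c : R) (x : int -> R) : 0 <= c -> (forall n, 0 <= x n) ->
  (\esum_(n in [set: int]) (c * x n)%:E = c%:E * \esum_(n in [set: int]) (x n)%:E)%E.
Proof.
move=> c0 x0; rewrite !esum_int_nneseries; last 2 first.
- by move=> n; rewrite lee_fin.
- by move=> n; rewrite lee_fin mulr_ge0.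
by rewrite -nneseriesZl// => n _; rewrite lee_fin.
Qed.

(** At the sample points [x = (t + n)/a] the argument [a x] is [t + n], so a 1-periodic factor is
    the constant [T t] throughout the sum. *)
Lemma pzZ T r t : (forall s, 0 <= T s) -> (forall x, 0 <= r x) ->
  (forall s (n : int), T (s + n%:~R) = T s) ->
  pz a (fun x => T (a * x) * r x) t = ((T t)%:E * pz a r t)%E.
Proof.
move=> T0 r0 TP; rewrite /pz.
rewrite (_ : (fun n : int => _) = fun n : int => (T t * r ((t + n%:~R) / a))%:E).
  by rewrite esum_intZ// muleCA.
apply/funext => n.
have -> : a * ((t + n%:~R) / a) = t + n%:~R by field; rewrite gt_eqF.
by rewrite TP.
Qed.

Lemma integral_resU (g : R -> \bar R) :
  (\int[mu]_t ((\1_U t)%:E * g t) = \int[mu]_(t in U) g t)%E.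
Proof.
rewrite [RHS]integral_mkcond; apply: eq_integral => t _.
by rewrite /patch indicE; case: (_ \in _); rewrite ?mul1e ?mul0e.
Qed.

(** Passing to [fine] changes the periodization only on a null set of the unit interval, since
    integrability of [r] makes it finite a.e. there. *)
Lemma ge0_integral_pz_mul T r : measurable_fun [set: R] T ->
  (forall s, 0 <= T s) -> (forall s (n : int), T (s + n%:~R) = T s) ->
  mu.-integrable setT (EFin \o r) -> (forall x, 0 <= r x) ->
  (\int[mu]_x (T (a * x)%R * r x)%:E =
   \int[mu]_t (\1_U t * (T t * fine (pz a r t)))%:E)%E.
Proof.
move=> mT T0 TP ir r0.
have mr : measurable_fun [set: R] r by apply/measurable_EFinP; exact: measurable_int ir.
rewrite integral_pz; last 2 first.
- apply: measurable_funM => //; apply: (measurableT_comp mT).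
  exact: measurable_funM.
- by move=> x; rewrite mulr_ge0.
under [RHS]eq_integral do rewrite EFinM.
rewrite integral_resU; apply: ge0_ae_eq_integral.
- exact: measurable_unit_itv.
- apply: measurable_funTS; apply: measurable_pz => [|x]; last by rewrite mulr_ge0.
  apply: measurable_funM => //; apply: (measurableT_comp mT).
  exact: measurable_funM.
- apply: measurable_funTS; apply/measurable_EFinP; apply: measurable_funM => //.
  by apply: measurableT_comp; [exact: fine_measurable|exact: measurable_pz].
- by move=> x _; apply: pz_ge0 => y; rewrite mulr_ge0.
- by move=> x _; rewrite lee_fin mulr_ge0// fine_ge0// pz_ge0.
apply: aeS (pz_fin ir r0) => t h Ut.
by rewrite pzZ// EFinM fineK// h.
Qed.

Lemma measurable_fine_pz r : mu.-integrable setT (EFin \o r) -> (forall x, 0 <= r x) ->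
  measurable_fun [set: R] (fun t => fine (pz a r t)).
Proof.
move=> ir r0; apply: measurableT_comp; first exact: fine_measurable.
by apply: measurable_pz => //; apply/measurable_EFinP; exact: measurable_int ir.
Qed.

Lemma integrable_res_pz r : mu.-integrable setT (EFin \o r) -> (forall x, 0 <= r x) ->
  mu.-integrable setT (EFin \o (fun t => \1_U t * fine (pz a r t))).
Proof.
move=> ir r0; apply/integrableP; split.
  have m1 := measurable_funM measurable_indic_unit (measurable_fine_pz ir r0).
  by apply/measurable_EFinP; exact: m1.
have h := @ge0_integral_pz_mul (cst 1) r (measurable_cst _) (fun=> ler01)
  (fun _ _ => erefl) ir r0.
have -> : (\int[mu]_t `|(EFin \o (fun t => (\1_U t * fine (pz a r t))%R)) t| =
    \int[mu]_x `|(EFin \o r) x|)%E.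
  transitivity (\int[mu]_x (cst 1 (a * x) * r x)%:E)%E.
    rewrite h; apply: eq_integral => t _; rewrite gee0_abs/= ?mul1r//.
    by rewrite lee_fin mulr_ge0// fine_ge0// pz_ge0.
  by apply: eq_integral => x _; rewrite /= mul1r ger0_norm.
by have /integrableP[] := ir.
Qed.

Lemma integrableMb (T g : R -> R) (M : R) : measurable_fun [set: R] T ->
  (forall s, `|T s| <= M) -> mu.-integrable setT (EFin \o g) ->
  mu.-integrable setT (EFin \o (fun x => T x * g x)).
Proof.
move=> mT TM ig.
have M0 : 0 <= M by apply: le_trans (TM 0).
have mg : measurable_fun [set: R] g by apply/measurable_EFinP; exact: measurable_int ig.
have := integrable_Zl M ig; apply: le_integrable => //.
  by apply/measurable_EFinP; exact: measurable_funM.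
by move=> x _; rewrite lee_fin !normrM (ger0_norm M0) ler_wpM2r.
Qed.

(** A signed bounded multiplier is reduced to nonnegative ones by writing [T = (T + M) - M]. *)
Lemma Rintegral_pz_mul T r (M : R) : measurable_fun [set: R] T ->
  (forall s, `|T s| <= M) -> (forall s (n : int), T (s + n%:~R) = T s) ->
  mu.-integrable setT (EFin \o r) -> (forall x, 0 <= r x) ->
  Rintegral mu setT (fun t => \1_U t * (T t * fine (pz a r t))) =
  Rintegral mu setT (fun x => T (a * x) * r x).
Proof.
move=> mT TM TP ir r0.
have M0 : 0 <= M by apply: le_trans (TM 0).
have TM0 s : 0 <= T s + M by have := TM s; rewrite ler_norml => /andP[]; lra.
have mTa : measurable_fun [set: R] (fun x => T (a * x)).
  by apply: (measurableT_comp mT); exact: measurable_funM.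
have ip := integrable_res_pz ir r0.
have h1 := @ge0_integral_pz_mul (fun s => T s + M) r (measurable_funD mT (measurable_cst _))
  TM0 (fun s n => congr1 (fun z => z + M) (TP s n)) ir r0.
have h2 := @ge0_integral_pz_mul (cst M) r (measurable_cst _) (fun=> M0) (fun _ _ => erefl) ir r0.
have -> : Rintegral mu setT (fun t => \1_U t * (T t * fine (pz a r t))) =
  Rintegral mu setT (fun t => \1_U t * ((T t + M) * fine (pz a r t))) -
  Rintegral mu setT (fun t => \1_U t * (M * fine (pz a r t))).
  rewrite -RintegralB//.
  - by apply: eq_Rintegral => t _; ring.
  - under [X in integrable _ _ X]eq_fun do rewrite /= mulrCA.
    apply: (@integrableMb _ _ (M + M)) => //; first exact: measurable_funD.
    by move=> s; rewrite (le_trans (ler_normD _ _))// lerD// ger0_norm.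
  - under [X in integrable _ _ X]eq_fun do rewrite /= mulrCA.
    exact: integrable_Zl.
rewrite /Rintegral -h1 -h2 -/(Rintegral _ _ _) -/(Rintegral _ _ _) -/(Rintegral _ _ _).
rewrite -RintegralB//.
- by apply: eq_Rintegral => t _; rewrite /cst; ring.
- apply: (@integrableMb _ _ (M + M)) => //; first exact: measurable_funD.
  by move=> s; rewrite (le_trans (ler_normD _ _))// lerD// ger0_norm.
- exact: integrable_Zl.
Qed.

Lemma cintegral_pz_mul (T : R -> R[i]) r (M : R) : cmeasurable T ->
  (forall s, csq (T s) <= M) -> (forall s (n : int), T (s + n%:~R) = T s) ->
  mu.-integrable setT (EFin \o r) -> (forall x, 0 <= r x) ->
  cintegral (cres (fun t => T t * (fine (pz a r t))%:C)) =
  cintegral (fun x => T (a * x) * (r x)%:C).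
Proof.
move=> [mT1 mT2] TM TP ir r0.
have bR t : `|complex.Re (T t)| <= Num.sqrt M.
  by rewrite (le_trans (Re_le_normc _))// normc_csq ler_wsqrtr.
have bI t : `|complex.Im (T t)| <= Num.sqrt M.
  by rewrite (le_trans (Im_le_normc _))// normc_csq ler_wsqrtr.
apply: complexP => /=.
- transitivity (Rintegral mu setT
    (fun t => \1_U t * (complex.Re (T t) * fine (pz a r t)))).
    by apply: eq_Rintegral => t _; rewrite /cres !ReM/=; ring.
  rewrite (Rintegral_pz_mul mT1 bR)//; last by move=> s n; rewrite TP.
  by apply: eq_Rintegral => t _; rewrite !ReM/=; ring.
- transitivity (Rintegral mu setT
    (fun t => \1_U t * (complex.Im (T t) * fine (pz a r t)))).
    by apply: eq_Rintegral => t _; rewrite /cres !ImM/=; ring.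
  rewrite (Rintegral_pz_mul mT2 bI)//; last by move=> s n; rewrite TP.
  by apply: eq_Rintegral => t _; rewrite !ImM/=; ring.
Qed.

Lemma cintegrable_res_pz r : mu.-integrable setT (EFin \o r) -> (forall x, 0 <= r x) ->
  cintegrable (cres (fun t => (fine (pz a r t))%:C)).
Proof.
move=> ir r0; rewrite /cres.
under eq_fun do rewrite -rmorphM.
by apply: cintegrable_real; exact: integrable_res_pz.
Qed.

(* The periodization of a complex function, by its four nonnegative parts. *)
Definition periodize (h : R -> R[i]) (t : R) : R[i] :=
  (fine (pz a ((@complex.Re R \o h)^\+) t))%:C - (fine (pz a ((@complex.Re R \o h)^\-) t))%:C
  + 'i * ((fine (pz a ((@complex.Im R \o h)^\+) t))%:C
          - (fine (pz a ((@complex.Im R \o h)^\-) t))%:C).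

Let four_parts (h : R -> R[i]) (x : R) : h x =
  (((@complex.Re R \o h)^\+ x)%:C - ((@complex.Re R \o h)^\- x)%:C)
  + 'i * (((@complex.Im R \o h)^\+ x)%:C - ((@complex.Im R \o h)^\- x)%:C).
Proof.
rewrite -!rmorphB/=; have E (f : R -> R) : f^\+ x - f^\- x = f x.
  by rewrite /funrpos /funrneg; case: (leP 0 (f x)) => fx;
    [rewrite max_r ?oppr_le0// subr0|rewrite max_l ?oppr_ge0 ?(ltW fx)// sub0r opprK].
by rewrite !E [LHS]complexE.
Qed.

Lemma cres_periodize (h : R -> R[i]) : cres (periodize h) = fun t =>
  cres (fun t => (fine (pz a ((@complex.Re R \o h)^\+) t))%:C) t
  - cres (fun t => (fine (pz a ((@complex.Re R \o h)^\-) t))%:C) t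
  + 'i * (cres (fun t => (fine (pz a ((@complex.Im R \o h)^\+) t))%:C) t
  - cres (fun t => (fine (pz a ((@complex.Im R \o h)^\-) t))%:C) t).
Proof. by apply/funext => t; rewrite /cres /periodize; ring. Qed.

Lemma cintegrable_periodize (h : R -> R[i]) : cintegrable h ->
  cintegrable (cres (periodize h)).
Proof.
move=> [h1 h2]; rewrite cres_periodize.
by apply: cintegrableD; [|apply: cintegrableZ]; apply: cintegrableB;
  apply: cintegrable_res_pz => //; (exact: integrable_funrpos || exact: integrable_funrneg).
Qed.

Lemma cintegral_comb4 (f1 f2 f3 f4 : R -> R[i]) :
  cintegrable f1 -> cintegrable f2 -> cintegrable f3 -> cintegrable f4 ->
  cintegral (fun t => f1 t - f2 t + 'i * (f3 t - f4 t)) =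
  cintegral f1 - cintegral f2 + 'i * (cintegral f3 - cintegral f4).
Proof.
move=> i1 i2 i3 i4; have i12 := cintegrableB i1 i2; have i34 := cintegrableB i3 i4.
by rewrite (cintegralD i12 (cintegrableZ _ i34)) cintegralZ// !cintegralB.
Qed.

(** Linearity over the four nonnegative parts of [h]. With exponentials for [T], Fourier
    coefficients of a periodization become integrals over the line. *)
Theorem cintegral_periodize (T h : R -> R[i]) (M : R) : cmeasurable T ->
  (forall s, csq (T s) <= M) -> (forall s (n : int), T (s + n%:~R) = T s) ->
  cintegrable h ->
  cintegral (cres (fun t => T t * periodize h t)) =
  cintegral (fun x => T (a * x) * h x).
Proof.
move=> mT TM TP [h1 h2].
have TMn s : normc (T s) <= Num.sqrt M by rewrite normc_csq ler_wsqrtr.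
have mTa : cmeasurable (fun x => T (a * x)).
  by apply: (cmeas_comp mT); exact: measurable_funM.
have I r : mu.-integrable setT (EFin \o r) -> (forall x, 0 <= r x) ->
    cintegrable (cres (fun t => T t * (fine (pz a r t))%:C)).
  move=> ir r0; rewrite /cres; under eq_fun do rewrite mulrCA.
  exact: cintegrableMb (cintegrable_res_pz ir r0) mT TMn.
have J r : mu.-integrable setT (EFin \o r) -> (forall x, 0 <= r x) ->
    cintegrable (fun x => T (a * x) * (r x)%:C).
  move=> ir r0; apply: (cintegrableMb (cintegrable_real ir) mTa) => x; exact: TMn.
have p1 : mu.-integrable setT (EFin \o (@complex.Re R \o h)^\+) by exact: integrable_funrpos.
have p2 : mu.-integrable setT (EFin \o (@complex.Re R \o h)^\-) by exact: integrable_funrneg.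
have p3 : mu.-integrable setT (EFin \o (@complex.Im R \o h)^\+) by exact: integrable_funrpos.
have p4 : mu.-integrable setT (EFin \o (@complex.Im R \o h)^\-) by exact: integrable_funrneg.
transitivity (cintegral (fun t =>
  cres (fun t => T t * (fine (pz a ((@complex.Re R \o h)^\+) t))%:C) t
  - cres (fun t => T t * (fine (pz a ((@complex.Re R \o h)^\-) t))%:C) t
  + 'i * (cres (fun t => T t * (fine (pz a ((@complex.Im R \o h)^\+) t))%:C) t
  - cres (fun t => T t * (fine (pz a ((@complex.Im R \o h)^\-) t))%:C) t))).
  by congr cintegral; apply/funext => t; rewrite /cres /periodize; ring.
transitivity (cintegral (fun x =>
  T (a * x) * ((@complex.Re R \o h)^\+ x)%:C - T (a * x) * ((@complex.Re R \o h)^\- x)%:C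
  + 'i * (T (a * x) * ((@complex.Im R \o h)^\+ x)%:C
          - T (a * x) * ((@complex.Im R \o h)^\- x)%:C))); last first.
  by congr cintegral; apply/funext => x; rewrite [in RHS](four_parts h); ring.
have g1 x : 0 <= (@complex.Re R \o h)^\+ x by exact: funrpos_ge0.
have g2 x : 0 <= (@complex.Re R \o h)^\- x by exact: funrneg_ge0.
have g3 x : 0 <= (@complex.Im R \o h)^\+ x by exact: funrpos_ge0.
have g4 x : 0 <= (@complex.Im R \o h)^\- x by exact: funrneg_ge0.
have I1 := I _ p1 g1; have I2 := I _ p2 g2.
have I3 := I _ p3 g3; have I4 := I _ p4 g4.
have J1 := J _ p1 g1; have J2 := J _ p2 g2.
have J3 := J _ p3 g3; have J4 := J _ p4 g4.
have K r : mu.-integrable setT (EFin \o r) -> (forall x, 0 <= r x) ->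
    cintegral (fun t => cres (fun t => T t * (fine (pz a r t))%:C) t) =
    cintegral (fun x => T (a * x) * (r x)%:C).
  by move=> *; exact: cintegral_pz_mul.
by rewrite !cintegral_comb4// (K _ p1 g1) (K _ p2 g2) (K _ p3 g3) (K _ p4 g4).
Qed.

Lemma pz0 r t : (forall n : int, r ((t + n%:~R) / a) = 0) -> pz a r t = 0%E.
Proof.
by move=> h; rewrite /pz esum1 ?mule0// => n _; rewrite h.
Qed.

Lemma periodize0 h t : (forall n : int, h ((t + n%:~R) / a) = 0) ->
  periodize h t = 0.
Proof.
move=> h0; have E (f : R[i] -> R) : f 0 = 0 ->
    pz a ((f \o h)^\+) t = 0%E /\ pz a ((f \o h)^\-) t = 0%E.
  by move=> f0; split; apply: pz0 => n; rewrite /funrpos /funrneg/= h0 f0 ?oppr0 maxxx.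
have [e1 e2] := E (@complex.Re R) erefl; have [e3 e4] := E (@complex.Im R) erefl.
rewrite /periodize; rewrite e1 e2 e3 e4.
by rewrite /= subrr mulr0 addr0.
Qed.

(** This holds at every [t]: where the periodization of [r] is infinite both sides are 0, because
    [fine +oo = 0]. Brackets of symbols are thereby computed pointwise rather than a.e. *)
Lemma pzM T r t : (forall s, 0 <= T s) -> (forall x, 0 <= r x) ->
  (forall s (n : int), T (s + n%:~R) = T s) ->
  fine (pz a (fun x => T (a * x) * r x) t) = T t * fine (pz a r t).
Proof.
move=> T0 r0 TP; rewrite pzZ//.
have := pz_ge0 t r0; case: (pz a r t) => [s|_|//] //=.
rewrite mulr0; have := T0 t; rewrite le_eqVlt => /predU1P[<-|Tt].
  by rewrite mul0e.
by rewrite gt0_muley ?lte_fin.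
Qed.

Lemma pz_parts T r t : (forall s (n : int), T (s + n%:~R) = T s) ->
  (forall x, 0 <= r x) ->
  fine (pz a ((fun x => T (a * x) * r x)^\+) t) -
  fine (pz a ((fun x => T (a * x) * r x)^\-) t) = T t * fine (pz a r t).
Proof.
move=> TP r0.
pose Tp s := Num.max (T s) 0; pose Tn s := Num.max (- T s) 0.
have Tp0 s : 0 <= Tp s by rewrite le_max lexx orbT.
have Tn0 s : 0 <= Tn s by rewrite le_max lexx orbT.
have TpP s (n : int) : Tp (s + n%:~R) = Tp s by rewrite /Tp TP.
have TnP s (n : int) : Tn (s + n%:~R) = Tn s by rewrite /Tn TP.
have -> : (fun x => T (a * x) * r x)^\+ = (fun x => Tp (a * x) * r x).
  by apply/funext => x; rewrite /funrpos /Tp maxr_pMl// mul0r.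
have -> : (fun x => T (a * x) * r x)^\- = (fun x => Tn (a * x) * r x).
  by apply/funext => x; rewrite /funrneg /Tn maxr_pMl// mul0r mulNr.
rewrite (pzM t Tp0 r0 TpP) (pzM t Tn0 r0 TnP) -mulrBl; congr (_ * _).
rewrite /Tp /Tn; case: (leP 0 (T t)) => h.
  by rewrite max_r ?oppr_le0// subr0.
by rewrite max_l ?oppr_ge0 ?(ltW h)// sub0r opprK.
Qed.

Lemma periodize_mul (T : R -> R[i]) r t : (forall s (n : int), T (s + n%:~R) = T s) ->
  (forall x, 0 <= r x) ->
  periodize (fun x => T (a * x) * (r x)%:C) t = T t * (fine (pz a r t))%:C.
Proof.
move=> TP r0; rewrite /periodize.
have -> : @complex.Re R \o (fun x => T (a * x) * (r x)%:C) =
    (fun x => complex.Re (T (a * x)) * r x).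
  by apply/funext => x /=; rewrite ReM/= mulr0 subr0.
have -> : @complex.Im R \o (fun x => T (a * x) * (r x)%:C) =
    (fun x => complex.Im (T (a * x)) * r x).
  by apply/funext => x /=; rewrite ImM/= mulr0 add0r.
rewrite -!rmorphB/=.
rewrite (@pz_parts (fun s => complex.Re (T s)))//; last by move=> s n; rewrite TP.
rewrite (@pz_parts (fun s => complex.Im (T s)))//; last by move=> s n; rewrite TP.
by apply: complexP; rewrite ?ReD ?ImD ?ReM ?ImM/=; ring.
Qed.

End periodization.

(** * Parseval identity on the unit interval *)

Section affine_complex.
Context {R : realType}.
Notation mu := (@lebesgue_measure R).
Variables (c d : R).
Hypothesis c0 : 0 < c.
Implicit Types f : R -> R[i].

Lemma integrable_affine (r : R -> R) : mu.-integrable setT (EFin \o r) ->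
  mu.-integrable setT (EFin \o (fun y => r (c * y + d))).
Proof.
move=> ir; have mr : measurable_fun [set: R] r.
  by apply/measurable_EFinP; exact: measurable_int ir.
have mra := measurableT_comp mr (measurable_affine c d).
apply/integrableP; split; first by apply/measurable_EFinP; exact: mra.
have /integrableP[_] := ir.
rewrite (@ge0_integral_affine _ c d c0 (fun x => `|(r x)%:E|%E))//; last first.
  by apply: measurableT_comp => //; apply/measurable_EFinP.
have : (0 <= \int[mu]_y `|(r (c * y + d))%:E|)%E by exact: integral_ge0.
move: (integral _ _ _) => [s|//|//] _; rewrite ?ltry//.
by rewrite gt0_muley ?lte_fin.
Qed.

Lemma Rintegral_affine (r : R -> R) : mu.-integrable setT (EFin \o r) ->
  Rintegral mu setT (fun y => r (c * y + d)) = c^-1 * Rintegral mu setT r.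
Proof.
move=> ir.
have key (s : R -> R) : (forall x, 0 <= s x) -> mu.-integrable setT (EFin \o s) ->
    Rintegral mu setT (fun y => s (c * y + d)) = c^-1 * Rintegral mu setT s.
  move=> s0 is_; have ms : measurable_fun [set: R] s.
    by apply/measurable_EFinP; exact: measurable_int is_.
  rewrite [in RHS]/Rintegral (@ge0_integral_affine _ c d c0 (EFin \o s))//; last first.
    exact/measurable_EFinP.
  rewrite fineM//=; last first.
    exact: (integrable_fin_num measurableT (integrable_affine is_)).
  by rewrite mulKf ?gt_eqF.
have rE x : r x = r^\+ x - r^\- x.
  by rewrite -[in LHS](funrposBneg r).
have rp := integrable_funrpos measurableT ir.
have rn := integrable_funrneg measurableT ir.
transitivity (Rintegral mu setT (fun y => r^\+ (c * y + d) - r^\- (c * y + d))).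
  by apply: eq_Rintegral => y _; rewrite -rE.
rewrite RintegralB//; [|exact: integrable_affine rp|exact: integrable_affine rn].
rewrite !key//.
rewrite -mulrBr -RintegralB//; congr (_ * _).
by apply: eq_Rintegral => y _; rewrite -rE.
Qed.

Lemma cintegrable_affine f : cintegrable f ->
  cintegrable (fun y => f (c * y + d)).
Proof. by move=> [f1 f2]; split; [exact: (integrable_affine f1)|exact: (integrable_affine f2)]. Qed.

Lemma cintegral_affine f : cintegrable f ->
  cintegral (fun y => f (c * y + d)) = (c^-1)%:C * cintegral f.
Proof.
move=> [f1 f2]; apply: complexP; rewrite ?ReM ?ImM/= mul0r ?subr0 ?addr0.
- exact: (@Rintegral_affine (fun x => complex.Re (f x))).
- exact: (@Rintegral_affine (fun x => complex.Im (f x))).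
Qed.

Lemma Sq_affine f : cmeasurable f ->
  Sq f = (c%:E * Sq (fun y => f (c * y + d)%R))%E.
Proof.
move=> mf; rewrite /Sq (@ge0_integral_affine _ c d c0)//; first exact: meas_ecsq.
by move=> x; rewrite lee_fin csq_ge0.
Qed.

End affine_complex.

(** * Orthonormality of the exponentials on a period *)

Section trigonometric_system.
Context {R : realType}.
Notation mu := (@lebesgue_measure R).
Notation L2 := (@Lspc R 2%:E).
Notation U := (@unit_itv R).
Notation hn := (hnorm (@ip2 R)).

Lemma cintegrable_indic_itv (u v : R) :
  cintegrable (fun t => (\1_(`[u, v[%classic : set R) t)%:C).
Proof. by apply: cintegrable_real; exact: integrable_indic_itv. Qed.

Lemma indic_itvE (u v t : R) :
  \1_(`[u, v[%classic : set R) t = ((u <= t) && (t < v))%:R :> R.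
Proof.
rewrite indicE; congr (_%:R); have -> // : (t \in `[u, v[%classic) = (u <= t < v).
by apply/idP/idP => [/set_mem|h]; rewrite ?mem_set//= in_itv.
Qed.

Lemma cintegrable_itv_en (u v : R) n :
  cintegrable (fun t => (\1_(`[u, v[%classic : set R) t)%:C * en n t).
Proof.
under eq_fun do rewrite mulrC.
apply: (@cintegrableMb _ _ _ 1); first exact: cintegrable_indic_itv.
  exact: (@cmeas_en R n id (@measurable_id _ _ _)).
by move=> x; rewrite normc_csq csq_en sqrtr1.
Qed.

Lemma cintegral_shift (f : R -> R[i]) (d : R) : cintegrable f ->
  cintegral (fun t => f (t - d)) = cintegral f.
Proof.
move=> fi; have := @cintegral_affine R 1 (- d) ltr01 f fi.
by rewrite invr1 mul1r => <-; congr cintegral; apply/funext => t; rewrite mul1r.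
Qed.

(* Shifting by half a period changes the sign of [en n] but not its integral
   over a period. *)
Lemma cintegral_en n : n != 0 -> cintegral (cres (@en R n)) = 0.
Proof.
move=> n0.
(* Half a period of [en n], where the phase is [pi] or [- pi] and [en n s = -1]. *)
pose s : R := (2 * `|n%:~R|)^-1.
have absn : 1 <= `|n%:~R| :> R.
  by rewrite -intr_norm -[1]/(1%:~R) ler_int -gtz0_ge1 normr_gt0.
have s0 : 0 < s by rewrite invr_gt0 mulr_gt0// (lt_le_trans ltr01).
have s1 : s < 1.
  rewrite invf_lt1; last by rewrite mulr_gt0// (lt_le_trans ltr01).
  by rewrite (@lt_le_trans _ _ 2)// ?ltr1n// ler_peMr.
have es : en n s = -1 :> R[i].
  rewrite /en /s; have [h|h] := leP 0 (n%:~R : R).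
    rewrite ger0_norm//; have nn : (n%:~R : R) != 0 by rewrite intr_eq0.
    have -> : 2 * pi * (n%:~R * (2 * n%:~R)^-1) = pi :> R by field.
    by apply: complexP; rewrite /= ?cospi ?sinpi ?oppr0.
  rewrite ltr0_norm//; have nn : (n%:~R : R) != 0 by rewrite intr_eq0.
  have -> : 2 * pi * (n%:~R * (2 * - n%:~R)^-1) = - pi :> R by field.
  by apply: complexP; rewrite /= ?cosN ?sinN ?cospi ?sinpi ?oppr0.
pose I (u v : R) := cintegral (fun t => (\1_(`[u, v[%classic : set R) t)%:C * en n t).
have shift1 u v d : I (u + d) (v + d) = en n d * I u v.
  rewrite /I -(cintegral_shift d (cintegrable_itv_en u v n)) -cintegralZ; last first.
    have := @cintegrable_affine R 1 (- d) ltr01 _ (cintegrable_itv_en u v n).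
    by congr cintegrable; apply/funext => t; rewrite mul1r.
  congr cintegral; apply/funext => t; rewrite !indic_itvE lerBrDr ltrBlDr.
  rewrite [RHS]mulrCA; congr (_ * _).
  by rewrite -en_add addrC subrK.
have split u v w : u <= v -> v <= w -> I u w = I u v + I v w.
  move=> uv vw; rewrite /I -cintegralD; try exact: cintegrable_itv_en.
  congr cintegral; apply/funext => t; rewrite -mulrDl !indic_itvE; congr (_ * _).
  rewrite -rmorphD -natrD; congr (_%:R%:C).
  have [tv|vt] := ltP t v.
    by rewrite (lt_le_trans tv vw) !andbT addn0.
  by rewrite (le_trans uv vt).
(* By periodicity the integrals over [[0, s)] and [[1, 1 + s)] agree. *)
have h01 : I 0 1 = I s (1 + s).
  rewrite (split 0 s 1) ?(ltW s0) ?(ltW s1)// (split s 1 (1 + s)) ?(ltW s1)//; last first.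
    by rewrite lerDl ltW.
  rewrite addrC; congr (_ + _).
  have := shift1 0 s 1; rewrite add0r -[en n 1]/(en n (1%:~R)) en_int mul1r addrC => <-.
  by rewrite addrC.
have := shift1 0 1 s; rewrite add0r -h01 es mulN1r => /eqP.
by rewrite -addr_eq0 -mulr2n mulrn_eq0/= => /eqP.
Qed.

Lemma cintegral_en0 : cintegral (cres (@en R 0)) = 1.
Proof.
rewrite /cres; under eq_fun do rewrite en0 mulr1.
rewrite cintegral_real /Rintegral integral_indic//=; last exact: measurable_unit_itv.
rewrite setIT/= lebesgue_measure_itv/= lte_fin ltr01/= subr0//.
Qed.

Definition ren n : R -> R[i] := cres (en n).

Lemma cresM (f g : R -> R[i]) t : cres f t * cres g t = cres (fun t => f t * g t) t.
Proof.
rewrite /cres indicE; case: (_ \in _); rewrite ?mul1r// !mul0r//.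
Qed.

Lemma cresJ (f : R -> R[i]) t : conjc (cres f t) = cres (fun t => conjc (f t)) t.
Proof. by rewrite /cres conjM conjc_real. Qed.

Lemma csq_cres (f : R -> R[i]) t : csq (cres f t) = \1_U t * csq (f t).
Proof.
by rewrite /cres csqM csq_real indicE; case: (_ \in _); rewrite ?expr1n ?expr0n.
Qed.

Lemma cmeas_cres (f : R -> R[i]) : cmeasurable f -> cmeasurable (cres f).
Proof. by move=> mf; apply: cmeasM => //; apply: cmeas_real; exact: measurable_indic_unit. Qed.

Lemma L2_cresb (f : R -> R[i]) (M : R) : cmeasurable f -> (forall t, csq (f t) <= M) ->
  L2 (cres f).
Proof.
move=> mf fM.
have M0 : 0 <= M by apply: le_trans (fM 0); exact: csq_ge0.
have ii : mu.-integrable setT (EFin \o (fun t => M * (\1_U t : R))).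
  by apply: integrable_Zl; exact: integrable_indic_itv.
apply: (@Sq_le_L2 _ _ (fun t => (M * \1_U t)%:E)).
- exact: cmeas_cres.
- by move=> x; rewrite lee_fin mulr_ge0.
- exact: measurable_int ii.
- by move=> x; rewrite csq_cres lee_fin mulrC ler_wpM2r.
- have /integrableP[_] := ii.
  by under eq_integral do rewrite gee0_abs ?lee_fin ?mulr_ge0//.
Qed.

Lemma L2_ren n : L2 (ren n).
Proof.
apply: (@L2_cresb _ 1); last by move=> t; rewrite csq_en.
exact: (@cmeas_en R n id (@measurable_id _ _ _)).
Qed.

Lemma ip2_ren m n : ip2 (ren m) (ren n) = (m == n)%:R.
Proof.
rewrite /ip2; under eq_fun do rewrite cresJ cresM -/(cres _ _).
transitivity (cintegral (cres (@en R (m - n)))).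
  by congr cintegral; apply/funext => t; rewrite /cres enD enN.
have [->|mn] := eqVneq m n; first by rewrite subrr cintegral_en0.
by rewrite cintegral_en// subr_eq0.
Qed.

Lemma ip2_suml (I : Type) (s : seq I) (c : I -> R[i]) (F : I -> R -> R[i]) g :
  (forall i, L2 (F i)) -> L2 g ->
  ip2 (fun x => \sum_(i <- s) c i * F i x) g = \sum_(i <- s) c i * ip2 (F i) g.
Proof.
move=> F2 g2; elim: s => [|i s IH].
  rewrite big_nil; under eq_fun do rewrite big_nil.
  rewrite /ip2; under eq_fun do rewrite mul0r.
  have := @cintegral_real R (cst 0); rewrite /= => ->.
  by rewrite /Rintegral integral0.
rewrite big_cons; under eq_fun do rewrite big_cons.
rewrite ip2D// ?IH ?ip2Z//; first exact: L2Z.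
by apply: L2_sum => j; exact: L2Z.
Qed.

Definition lin (s : seq int) (c : int -> R[i]) : R -> R[i] :=
  fun x => \sum_(n <- s) c n * ren n x.

Lemma L2_lin s c : L2 (lin s c).
Proof. by apply: L2_sum => n; apply: L2Z; exact: L2_ren. Qed.

Lemma ip2_lin_ren s c n : uniq s -> n \in s -> ip2 (lin s c) (ren n) = c n.
Proof.
move=> us ns; rewrite ip2_suml; [|exact: L2_ren|exact: L2_ren].
rewrite (bigD1_seq n)//= big1 ?addr0; last first.
  by move=> m mn; rewrite ip2_ren (negbTE mn) mulr0.
by rewrite ip2_ren eqxx mulr1.
Qed.

Lemma hn_lin s c : uniq s -> hn (lin s c) ^+ 2 = \sum_(n <- s) csq (c n).
Proof.
move=> us.
have h2 := L2_lin s c.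
suff E : ip2 (lin s c) (lin s c) = (\sum_(n <- s) csq (c n))%:C.
  by have := ip2_self h2; rewrite E => /complexI; rewrite hn_sqr.
rewrite [LHS]ip2_suml//; last exact: L2_ren.
rewrite rmorph_sum; apply: eq_big_seq => n ns.
by rewrite (ip2J h2 (L2_ren n)) ip2_lin_ren// mulJ.
Qed.

End trigonometric_system.

(** * Parseval identity for integrable functions on a period *)

Section parseval.
Context {R : realType}.
Notation mu := (@lebesgue_measure R).
Notation L2 := (@Lspc R 2%:E).
Notation U := (@unit_itv R).
Notation hn := (hnorm (@ip2 R)).

(** The exponential is not cut off: the definition is meant for integrable [G] vanishing off the
    unit interval, where it equals [ip2 G (ren n)]. *)
Definition fcoef (G : R -> R[i]) (n : int) : R[i] :=
  cintegral (fun t => G t * conjc (en n t)).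

Lemma sum_pairs_uniq (s : seq (int * R[i])) : exists (r : seq int) (c : int -> R[i]),
  uniq r /\ forall F : int -> R[i],
    \sum_(p <- s) p.2 * F p.1 = \sum_(n <- r) c n * F n.
Proof.
exists (undup [seq p.1 | p <- s]), (fun n => \sum_(p <- s | p.1 == n) p.2).
split=> [|F]; first exact: undup_uniq.
under [RHS]eq_bigr do rewrite big_distrl/=.
rewrite (exchange_big_dep xpredT)//=; apply: eq_big_seq => p ps.
rewrite big_mkcond (bigD1_seq p.1) ?undup_uniq ?mem_undup ?map_f//= eqxx.
by rewrite big1 ?addr0// => n /negbTE; rewrite eq_sym => ->.
Qed.

Lemma trig_uniq (s : seq (int * R[i])) : exists (r : seq int) (c : int -> R[i]),
  uniq r /\ forall t, trig s t = \sum_(n <- r) c n * en n t.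
Proof.
have [r [c [ur h]]] := sum_pairs_uniq s.
by exists r, c; split => // t; exact: (h (fun n => en n t)).
Qed.

Lemma cres_id (G : R -> R[i]) : (forall t, ~ U t -> G t = 0) -> cres G = G.
Proof.
move=> G0; apply/funext => t; rewrite /cres indicE.
have [/set_mem Ut|/negP nUt] := boolP (t \in U); first by rewrite mul1r.
by rewrite mul0r G0// => Ut; apply: nUt; rewrite mem_set.
Qed.

Lemma fcoef_ip2 (G : R -> R[i]) n : (forall t, ~ U t -> G t = 0) ->
  fcoef G n = ip2 G (ren n).
Proof.
move=> G0; congr cintegral; apply/funext => t; rewrite -(cres_id G0) cresJ cresM.
by rewrite /cres mulrA.
Qed.

(** Nonnegativity of the squared norm of [G] minus its partial Fourier sum. *)
Lemma bessel (G : R -> R[i]) (s : seq int) : L2 G -> uniq s ->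
  \sum_(n <- s) csq (ip2 G (ren n)) <= hn G ^+ 2.
Proof.
move=> G2 us; pose c n := ip2 G (ren n).
have l2 := L2_lin s c.
have := hnD_sqr G2 (L2N l2); rewrite hnN hn_lin//.
have E : ip2 (lin s c) G = (\sum_(n <- s) csq (c n))%:C.
  rewrite ip2_suml//; last exact: L2_ren.
  rewrite rmorph_sum; apply: eq_bigr => n _.
  by rewrite (ip2J G2 (L2_ren n)) mulJ.
have -> : ip2 G (fun x => - lin s c x) = - (\sum_(n <- s) csq (c n))%:C.
  rewrite (ip2J (L2N l2) G2).
  have -> : ip2 (fun x => - lin s c x) G = - ip2 (lin s c) G.
    by rewrite -mulN1r -ip2Z//; congr ip2; apply/funext => x; rewrite mulN1r.
  by rewrite E; apply: complexP; rewrite ?ReJ ?ImJ ?ReN ?ImN/= ?oppr0.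
rewrite ReN /= => h.
have := sqr_ge0 (hn (fun x => G x + - lin s c x)); rewrite h.
by rewrite /c; lra.
Qed.

Lemma cintegral_trig (G : R -> R[i]) r (c : int -> R[i]) : cintegrable G ->
  cintegral (fun t => G t * conjc (\sum_(n <- r) c n * en n t)) =
  \sum_(n <- r) conjc (c n) * fcoef G n.
Proof.
move=> iG.
have ie n : cintegrable (fun t => G t * conjc (en n t)).
  under eq_fun do rewrite mulrC.
  apply: (cintegrableMb (M := 1) iG).
    by apply: cmeasJ; exact: (@cmeas_en R n id (@measurable_id _ _ _)).
  by move=> x; rewrite normc_csq csqJ csq_en sqrtr1.
transitivity (cintegral (fun t => \sum_(n <- r) conjc (c n) * (G t * conjc (en n t)))).
  congr cintegral; apply/funext => t; rewrite conj_sum big_distrr/=.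
  by apply: eq_bigr => n _; rewrite conjM mulrCA.
rewrite cintegral_sum; last by move=> n; exact: cintegrableZ.
by apply: eq_bigr => n _; rewrite cintegralZ.
Qed.

(** The weight [c / |z|] in [Re_mulJ_le]. Both error terms are then linear in [|z|], as required
    when [z] is the value of a function that is merely integrable. *)
Lemma normc_mulJ_le (z w : R[i]) (c : R) : 0 < c ->
  2 * complex.Re (z * conjc w) <= c * normc z + c^-1 * (normc z * csq w).
Proof.
move=> c0; have [z0|z0] := eqVneq (normc z) 0.
  have -> : z = 0 by apply: csq_eq0; rewrite -normc_sqr z0 expr0n.
  rewrite mul0r /= mulr0 -[leLHS](addr0 0) lerD ?mulr_ge0 ?normc_ge0 ?csq_ge0//.
    exact: ltW.
  by rewrite invr_ge0 ltW.
have zp : 0 < normc z by rewrite lt_def z0 normc_ge0.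
have := @Re_mulJ_le _ z w (c / normc z) (divr_gt0 c0 zp).
rewrite -normc_sqr invf_div.
have -> : c / normc z * normc z ^+ 2 = c * normc z by field.
by have -> : normc z / c * csq w = c^-1 * (normc z * csq w) by ring.
Qed.

Let truncation_arith (x y z X N S c : R) :
  2 * X + y <= 2 * x + c * N + (1 + c) * X + z -> 2 * x <= S + y -> z <= 2 * c ->
  X <= S + c * (N + X + 2).
Proof. by lra. Qed.

Section lower.
Variables (G : R -> R[i]) (S : R).
Hypothesis iG : cintegrable G.
Hypothesis G0 : forall t, ~ U t -> G t = 0.
Hypothesis GS : forall s, uniq s -> \sum_(n <- s) csq (fcoef G n) <= S.

Let mG : cmeasurable G. Proof. exact: cintegrable_meas. Qed.

(** The cut-off of [G] to [|G|^2 <= k] is bounded and supported on a period, hence in L^2 although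
    [G] is only integrable, and [Re (G conj(Gk)) = |Gk|^2]. *)
Let Gk (k : R) (t : R) : R[i] := (\1_[set t | csq (G t) <= k] t)%:C * G t.

Let GkE k t : Gk k t = if csq (G t) <= k then G t else 0.
Proof.
rewrite /Gk indicE; have -> : (t \in [set t | csq (G t) <= k]) = (csq (G t) <= k).
  by apply/idP/idP => [/set_mem|h]; rewrite ?mem_set.
by case: ifP; rewrite ?mul1r ?mul0r.
Qed.

Let Gk_meas k : cmeasurable (Gk k).
Proof.
apply: cmeasM => //; apply: cmeas_real; apply: measurable_indic.
rewrite -[X in measurable X]setTI.
have -> : [set t | csq (G t) <= k] = (fun t => csq (G t)) @^-1` `]-oo, k].
  by apply/seteqP; split => t; rewrite /= in_itv.
by apply: meas_csq.
Qed.

Let Gk_bound k t : 0 <= k -> csq (Gk k t) <= k.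
Proof.
by move=> k0; rewrite GkE; case: ifP => // _; rewrite /csq/= expr0n addr0.
Qed.

Let Gk0 k t : ~ U t -> Gk k t = 0.
Proof. by move=> nU; rewrite GkE G0// if_same. Qed.

Let Gk_L2 k : 0 <= k -> L2 (Gk k).
Proof.
move=> k0; rewrite -(cres_id (Gk0 k)); apply: (@L2_cresb _ _ k) => // t.
exact: Gk_bound.
Qed.

Let Gk_mul k t : csq (Gk k t) = complex.Re (G t * conjc (Gk k t)).
Proof.
by rewrite GkE; case: ifP => _; rewrite ?mulJ// conjc0 mulr0 /csq/= expr0n/= addr0.
Qed.

(** Duality: the bound on the coefficients gives [2 Re <G, T> <= S + ||T||^2] for a trigonometric
    polynomial [T]. When [T] is close to [Gk], the left side is close to [2 ||Gk||^2] and [||T||^2]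
    to [||Gk||^2], so [||Gk||^2 <= S] up to errors of order [c]. *)
Let truncation_le k c : 0 <= k -> 0 < c -> c <= 1 ->
  hn (Gk k) ^+ 2 <= S + c * (Rintegral mu setT (fun t => normc (G t)) + hn (Gk k) ^+ 2 + 2).
Proof.
move=> k0 c0 c1.
(* The summand 1 measures [Gk - T] in L^2; the summand [|G|] controls the pairing of [G] with
   [Gk - T]. *)
pose w t := \1_U t * (1 + normc (G t)).
have w0 t : 0 <= w t by rewrite mulr_ge0// addr_ge0// normc_ge0.
have wE t : w t = \1_U t + normc (G t).
  rewrite /w mulrDr mulr1; congr (_ + _); rewrite indicE.
  have [_|/negP nUt] := boolP (t \in U); first by rewrite mul1r.
  rewrite mul0r G0 ?ComplexField.Normc.normc0// => Ut; apply: nUt.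
  by rewrite mem_set.
have iw : mu.-integrable setT (EFin \o w).
  rewrite (_ : EFin \o w = ((EFin \o \1_U) \+ (fun t => (normc (G t))%:E))%E).
    apply: integrableD => //; first exact: integrable_indic_itv.
    exact: cintegrable_normc.
  by apply/funext => t; rewrite /= wE EFinD.
have mw : measurable_fun [set: R] w.
  by apply/measurable_EFinP; exact: measurable_int iw.
(* Precision [c^2], because the error is later multiplied by [1 + 1/c] and must stay of order
   [c]. *)
have [s hs] := @trig_dense R w id w0 iw (@measurable_id _ _ _) (Gk k) k (c ^+ 2)
  (Gk_meas k) (fun t => Gk_bound t k0) (exprn_gt0 2 c0).
have [r [cf [ur Ts]]] := trig_uniq s.
set T := trig s in Ts hs.
have mT : cmeasurable T by exact: (cmeas_trig s (@measurable_id _ _ _)).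
pose W t := csq (Gk k (frac t) - T t) * w t.
have W0 t : 0 <= W t by rewrite mulr_ge0// csq_ge0.
have mW : measurable_fun [set: R] W.
  apply: measurable_funM => //; apply: meas_csq; apply: cmeasB => //.
  by apply: (cmeas_comp (Gk_meas k)); exact: measurable_frac.
have iW : mu.-integrable setT (EFin \o W).
  apply/integrableP; split; first exact/measurable_EFinP.
  under eq_integral do rewrite gee0_abs ?lee_fin//.
  by apply: le_lt_trans hs _; rewrite ltry.
have intW : Rintegral mu setT W <= c ^+ 2.
  by rewrite -lee_fin /Rintegral fineK//; exact: integrable_fin_num iW.
have linT : lin r cf = cres T.
  apply/funext => t; rewrite /lin /cres Ts big_distrr/=; apply: eq_bigr => n _.
  by rewrite /ren /cres mulrCA.
have T2 : L2 (cres T) by rewrite -linT; exact: L2_lin.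
have iGT : cintegrable (fun t => G t * conjc (T t)).
  have [M hM] := trig_bounded s.
  under eq_fun do rewrite mulrC.
  apply: (cintegrableMb (M := Num.sqrt M) iG); first exact: cmeasJ.
  by move=> t; rewrite normc_csq csqJ ler_wsqrtr.
(* The weighted inequality is used twice: for the pairing of [G] with [Gk - T], and for the cross
   term in the expansion of [|T|^2] around [Gk]. *)
have pw t : 2 * csq (Gk k t) + csq (cres T t) <=
    2 * complex.Re (G t * conjc (T t)) + c * normc (G t) +
    (1 + c) * csq (Gk k t) + (1 + c^-1) * W t.
  have ci : 0 < c^-1 by rewrite invr_gt0.
  have [Ut|nUt] := pselect (U t); last first.
    have Re0 : complex.Re (0 : R[i]) = 0 by [].
    rewrite Gk0// G0// mul0r Re0 ComplexField.Normc.normc0 csq_cres indicE memNset//.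
    rewrite mul0r /csq/= expr0n/= !addr0 !mulr0 !add0r mulr_ge0//.
    by rewrite addr_ge0// ltW.
  have Wt : W t = csq (Gk k t - T t) * (1 + normc (G t)).
    rewrite /W frac_id; last by move: Ut; rewrite /unit_itv/= in_itv.
    by rewrite /w indicE mem_set// mul1r.
  rewrite csq_cres indicE mem_set// mul1r Wt.
  have h1 := @normc_mulJ_le (G t) (Gk k t - T t) c c0.
  have E : complex.Re (G t * conjc (Gk k t - T t)) =
      csq (Gk k t) - complex.Re (G t * conjc (T t)).
    by rewrite conjB mulrBr ReB -Gk_mul.
  have h2 : csq (T t) <= (1 + c) * csq (Gk k t) + (1 + c^-1) * csq (Gk k t - T t).
    have TE : T t = Gk k t + - (Gk k t - T t) by rewrite opprB addrC subrK.
    rewrite [X in csq X <= _]TE csq_expand csqN.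
    have := @Re_mulJ_le _ (Gk k t) (- (Gk k t - T t)) c c0.
    by rewrite csqN; lra.
  rewrite E in h1.
  have := mulr_ge0 (normc_ge0 (G t)) (csq_ge0 (Gk k t - T t)).
  by move: h1 h2; lra.
have ig := L2_csq (Gk_L2 k0); have iT := L2_csq T2.
have iN := cintegrable_normc iG; have [iRe _] := iGT.
have j1 := integrable_Zl 2 iRe; have j2 := integrable_Zl c iN.
have j3 := integrable_Zl (1 + c) ig; have j4 := integrable_Zl (1 + c^-1) iW.
have j12 := integrableD measurableT j1 j2.
have j123 := integrableD measurableT j12 j3.
have L : Rintegral mu setT (fun t => 2 * csq (Gk k t) + csq (cres T t)) =
    2 * hn (Gk k) ^+ 2 + hn (cres T) ^+ 2.
  rewrite RintegralD//; last exact: integrable_Zl.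
  by rewrite RintegralZl// !hn_sqr//; exact: Gk_L2.
have Rr : Rintegral mu setT (fun t => 2 * complex.Re (G t * conjc (T t)) +
    c * normc (G t) + (1 + c) * csq (Gk k t) + (1 + c^-1) * W t) =
    2 * complex.Re (cintegral (fun t => G t * conjc (T t))) +
    c * Rintegral mu setT (fun t => normc (G t)) + (1 + c) * hn (Gk k) ^+ 2 +
    (1 + c^-1) * Rintegral mu setT W.
  rewrite (RintegralD measurableT j123 j4) (RintegralD measurableT j12 j3).
  rewrite (RintegralD measurableT j1 j2) !RintegralZl//.
  by rewrite hn_sqr//; exact: Gk_L2.
have le : 2 * hn (Gk k) ^+ 2 + hn (cres T) ^+ 2 <=
    2 * complex.Re (cintegral (fun t => G t * conjc (T t))) +
    c * Rintegral mu setT (fun t => normc (G t)) + (1 + c) * hn (Gk k) ^+ 2 +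
    (1 + c^-1) * Rintegral mu setT W.
  rewrite -L -Rr; apply: le_Rintegral => //.
    exact: (integrableD measurableT (integrable_Zl 2 ig) iT).
  exact: (integrableD measurableT j123 j4).
(* Termwise [2 Re (conj(c_n) G_n) <= |G_n|^2 + |c_n|^2]; as the frequencies are distinct, the first
   sum is at most [S] and the second is [||T||^2]. *)
have coef : 2 * complex.Re (cintegral (fun t => G t * conjc (T t))) <=
    S + hn (cres T) ^+ 2.
  rewrite -linT hn_lin//.
  under [in leLHS]eq_fun do rewrite Ts.
  rewrite cintegral_trig//.
  apply: (@le_trans _ _ (\sum_(n <- r) (csq (fcoef G n) + csq (cf n)))); last first.
    by rewrite big_split/= lerD2r; exact: GS.
  have -> : complex.Re (\sum_(n <- r) conjc (cf n) * fcoef G n) =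
      \sum_(n <- r) complex.Re (conjc (cf n) * fcoef G n).
    by elim: (r) => [|n l IH]; rewrite ?big_nil// !big_cons ReD IH.
  rewrite big_distrr/=; apply: ler_sum => n _.
  have := @Re_mulJ_le _ (fcoef G n) (cf n) 1 ltr01.
  by rewrite invr1 !mul1r [fcoef G n * _]mulrC.
have cW : (1 + c^-1) * Rintegral mu setT W <= 2 * c.
  apply: (@le_trans _ _ ((1 + c^-1) * c ^+ 2)).
    by rewrite ler_wpM2l// addr_ge0// invr_ge0 ltW.
  have -> : (1 + c^-1) * c ^+ 2 = c * c + c by field; rewrite gt_eqF.
  by rewrite (_ : 2 * c = c + c) ?lerD2r ?ger_pMl//; ring.
exact: truncation_arith le coef cW.
Qed.

Let truncation_bound k : 0 <= k -> hn (Gk k) ^+ 2 <= S.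
Proof.
move=> k0; apply/ler_addgt0Pr => e e0.
pose B := Rintegral mu setT (fun t => normc (G t)) + hn (Gk k) ^+ 2 + 2.
have B0 : 0 < B.
  rewrite ltr_wpDl// addr_ge0 ?sqr_ge0//.
  by apply: Rintegral_ge0 => t _; exact: normc_ge0.
pose c := Num.min 1 (e / B).
have c0 : 0 < c by rewrite lt_min ltr01 divr_gt0.
have c1 : c <= 1 by rewrite ge_min lexx.
apply: le_trans (truncation_le k0 c0 c1) _; rewrite lerD2l -ler_pdivlMr//.
by rewrite ge_min lexx orbT.
Qed.

(** Fatou as the cut-off level grows: at each point the cut-offs are eventually equal to [G]. In
    particular square-summable coefficients force an integrable [G] into L^2. *)
Lemma parseval_lower : (Sq G <= S%:E)%E.
Proof.
apply: (@Sq_fatou _ (fun n => Gk n%:R)) => //.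
- apply: aeW => t.
  have : \forall n \near \oo, Gk n%:R t = G t.
    near=> n; rewrite GkE ifT//.
    by near: n; exact: nbhs_infty_ger.
  by move=> h; split; apply: cvg_near_cst; apply: filterS h => n ->.
- by near=> n; rewrite Sq_hn ?lee_fin ?truncation_bound//; exact: Gk_L2.
Unshelve. all: by end_near. Qed.

End lower.

Theorem parseval (G : R -> R[i]) : cintegrable G ->
  (forall t, ~ U t -> G t = 0) ->
  (\esum_(n in [set: int]) (csq (fcoef G n))%:E = Sq G)%E.
Proof.
move=> iG G0; apply/eqP; rewrite eq_le; apply/andP; split.
  have [->|Gy] := eqVneq (Sq G) +oo%E; first by rewrite leey.
  have G2 : L2 G.
    by apply/Lspc2P; split; [exact: cintegrable_meas|rewrite ltey].
  apply: ub_ereal_sup => _ [A [finA _] <-].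
  rewrite fsbig_finite//= sumEFin Sq_hn// lee_fin.
  under eq_bigr do rewrite fcoef_ip2//.
  by apply: bessel => //; exact: fset_uniq.
set E := esum _ _.
have E0 : (0 <= E)%E by apply: esum_ge0 => n _; rewrite lee_fin csq_ge0.
have [->|Ey] := eqVneq E +oo%E; first by rewrite leey.
have Efin : E \is a fin_num by rewrite ge0_fin_numE// ltey.
rewrite -(fineK Efin); apply: parseval_lower => // s us.
rewrite -lee_fin fineK// -sumEFin fsbig_seq//.
by apply: esum_ge; exists [set` s] => //; split => //; exact: finite_seq.
Qed.

End parseval.

(** * Unconditional sums over the integers *)

Section unconditional_sums.
Context {R : realType}.

#[local] Existing Instance totally_filter.

Lemma csq_polar_Re (z w : R[i]) :
  csq (z + 1 * w) - csq (z + (-1) * w) = 4 * complex.Re (z * conjc w).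
Proof. by case: z w => [a b] [c d]; rewrite /csq/=; ring. Qed.

Lemma csq_polar_Im (z w : R[i]) :
  csq (z + 'i * w) - csq (z + (- 'i) * w) = 4 * complex.Im (z * conjc w).
Proof. by case: z w => [a b] [c d]; rewrite /csq/=; ring. Qed.

Lemma Re_sum (I : Type) (s : seq I) (F : I -> R[i]) :
  complex.Re (\sum_(i <- s) F i) = \sum_(i <- s) complex.Re (F i).
Proof. by elim: s => [|i s IH]; rewrite ?big_nil// !big_cons ReD IH. Qed.

Lemma Im_sum (I : Type) (s : seq I) (F : I -> R[i]) :
  complex.Im (\sum_(i <- s) F i) = \sum_(i <- s) complex.Im (F i).
Proof. by elim: s => [|i s IH]; rewrite ?big_nil// !big_cons ImD IH. Qed.

Lemma partial_sumE (V : zmodType) (x : int -> V) (A : {fset int}) :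
  partial_sum x A = \sum_(n <- A) x n.
Proof. by rewrite /partial_sum big_seq_fsetE. Qed.

Lemma partial_sum_esum_cvg (x : int -> R) (S : R) : (forall n, 0 <= x n) ->
  (\esum_(n in [set: int]) (x n)%:E = S%:E)%E -> partial_sum x @ totally --> S.
Proof.
move=> x0 xS; apply/cvgrPdist_le => e e0.
have [|_ [A [finA _] <-]] := @ub_ereal_sup_adherent R
  [set (\sum_(n \in A) (x n)%:E)%E | A in fsets [set: int]] e e0.
  by rewrite -/(esum _ _) xS.
rewrite -/(esum _ _) xS -EFinB fsbig_finite//= sumEFin lte_fin => hA.
exists (fset_set A) => // B /= AB; rewrite partial_sumE ler_distl.
have upper : \sum_(n <- B) x n <= S.
  rewrite -lee_fin -xS -sumEFin fsbig_seq ?fset_uniq//.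
  by apply: esum_ge; exists [set` B] => //; split => //; exact: finite_seq.
have lower : \sum_(n <- fset_set A) x n <= \sum_(n <- B) x n.
  rewrite (eq_big_seq (fun n => if n \in fset_set A then x n else 0)); last first.
    by move=> n ->.
  rewrite (big_fset_incl _ AB); last by move=> n _ /negbTE ->.
  by apply: ler_sum => n _; case: ifP.
by apply/andP; split; lra.
Qed.

Lemma complex_cvg (F : {fset int} -> R[i]) (l : R[i]) :
  (fun A => complex.Re (F A)) @ totally --> complex.Re l ->
  (fun A => complex.Im (F A)) @ totally --> complex.Im l ->
  (F : {fset int} -> R[i]^o) @ totally --> (l : R[i]^o).
Proof.
(* Radii range over positive elements of [R[i]]; such an element has zero imaginary part, so [e] is
   an ordinary real radius. *)
move=> h1 h2; apply/cvgrPdist_lt => -[e e']; rewrite ltcE/= => /andP[/eqP -> e0].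
have e2 : 0 < e / 2 by rewrite divr_gt0.
near=> A.
have /ltW a1 : `|complex.Re l - complex.Re (F A)| < e / 2.
  by near: A; move/cvgrPdist_lt : h1; apply.
have a2 : `|complex.Im l - complex.Im (F A)| < e / 2.
  by near: A; move/cvgrPdist_lt : h2; apply.
rewrite (_ : `|_| = (normc (l - F A))%:C); last by rewrite normc_def normc_csq.
rewrite ltcE/= eqxx/=.
apply: le_lt_trans (normc_le_ReIm (l - F A)) _; rewrite ReB ImB.
by rewrite [ltRHS](splitr e) ler_ltD.
Unshelve. all: by end_near. Qed.

(** Polarisation writes each term by means of four squared moduli, so that only convergence of
    nonnegative sums is needed. *)
Lemma partial_sum_polar (c d : int -> R[i]) (S : R[i] -> R) :
  (forall u, (\esum_(n in [set: int]) (csq (c n + u * d n))%:E = (S u)%:E)%E) ->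
  partial_sum (fun n => c n * conjc (d n) : R[i]^o) @ totally -->
  ((4^-1 * (S 1 - S (-1)) +i* (4^-1 * (S 'i - S (- 'i)))) : R[i]^o).
Proof.
move=> hS.
have cv u : partial_sum (fun n => csq (c n + u * d n)) @ totally --> S u.
  by apply: partial_sum_esum_cvg => // n; exact: csq_ge0.
apply: complex_cvg => /=.
- have h := cvgM (cvg_cst (4^-1 : R)) (cvgB (cv 1) (cv (-1))).
  rewrite (_ : (fun A => _) = (fun A => 4^-1 *
    (partial_sum (fun n => csq (c n + 1 * d n)) A
     - partial_sum (fun n => csq (c n + (-1) * d n)) A))); first exact: h.
  apply/funext => A; rewrite !partial_sumE -sumrB Re_sum big_distrr/=.
  by apply: eq_bigr => n _; rewrite csq_polar_Re mulKf.
- have h := cvgM (cvg_cst (4^-1 : R)) (cvgB (cv 'i) (cv (- 'i))).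
  rewrite (_ : (fun A => _) = (fun A => 4^-1 *
    (partial_sum (fun n => csq (c n + 'i * d n)) A
     - partial_sum (fun n => csq (c n + (- 'i) * d n)) A))); first exact: h.
  apply/funext => A; rewrite !partial_sumE -sumrB Im_sum big_distrr/=.
  by apply: eq_bigr => n _; rewrite csq_polar_Im mulKf.
Qed.

End unconditional_sums.

(** * Polarised Parseval identity *)

Section polarisation.
Context {R : realType}.
Notation mu := (@lebesgue_measure R).
Notation L2 := (@Lspc R 2%:E).
Notation U := (@unit_itv R).
Notation hn := (hnorm (@ip2 R)).
Implicit Types f g : R -> R[i].

(** Written with the same four combinations as [partial_sum_polar]. Any identity of norms for all
    combinations [f + u g] thus transfers to inner products, both for Parseval and for the Fourier
    transform. *)
Lemma ip2_polar f g : L2 f -> L2 g -> ip2 f g =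
  (4^-1 * (hn (fun x => f x + 1 * g x) ^+ 2 - hn (fun x => f x + (-1) * g x) ^+ 2))
  +i* (4^-1 * (hn (fun x => f x + 'i * g x) ^+ 2
               - hn (fun x => f x + (- 'i) * g x) ^+ 2)).
Proof.
move=> f2 g2.
have E u : hn (fun x => f x + u * g x) ^+ 2 =
    hn f ^+ 2 + hn (fun x => u * g x) ^+ 2 + 2 * complex.Re (conjc u * ip2 f g).
  rewrite hnD_sqr//; last exact: L2Z.
  by rewrite (ip2J (L2Z u g2) f2) ip2Z// (ip2J f2 g2) conjM conjcK.
have N u : hn (fun x => - u * g x) ^+ 2 = hn (fun x => u * g x) ^+ 2.
  by rewrite -hnN; under eq_fun do rewrite mulNr opprK.
have h1 z : complex.Re (conjc (1 : R[i]) * z) = complex.Re z by rewrite conjc1 mul1r.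
have h2 z : complex.Re (conjc (-1 : R[i]) * z) = - complex.Re z.
  by rewrite -mulN1r conjM conjc1 mulr1; case: z => a b /=; ring.
have h3 (z : R[i]) : complex.Re (conjc 'i * z) = complex.Im z.
  by case: z => a b /=; ring.
have h4 (z : R[i]) : complex.Re (conjc (- 'i) * z) = - complex.Im z.
  by case: z => a b /=; ring.
apply: complexP.
  rewrite [RHS]/= (E 1) (E (-1)) (N 1) h1 h2.
  by rewrite (_ : _ - _ = 4 * complex.Re (ip2 f g)) ?mulKf//; ring.
rewrite [RHS]/= (E 'i) (E (- 'i)) (N 'i) h3 h4.
by rewrite (_ : _ - _ = 4 * complex.Im (ip2 f g)) ?mulKf//; ring.
Qed.

Lemma fcoefD (G1 G2 : R -> R[i]) u n : (forall t, ~ U t -> G1 t = 0) ->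
  (forall t, ~ U t -> G2 t = 0) -> L2 G1 -> L2 G2 ->
  fcoef (fun t => G1 t + u * G2 t) n = fcoef G1 n + u * fcoef G2 n.
Proof.
move=> G10 G20 l1 l2; rewrite !fcoef_ip2//; last first.
  by move=> t nU; rewrite G10// G20// mulr0 addr0.
rewrite ip2D ?ip2Z//; first exact: L2_ren.
- exact: L2Z.
- exact: L2_ren.
Qed.

Lemma L2_unit_cintegrable (G : R -> R[i]) : (forall t, ~ U t -> G t = 0) ->
  L2 G -> cintegrable G.
Proof.
move=> G0 G2; have := L2_mul_cintegrable G2 (L2_ren 0).
congr cintegrable; apply/funext => t; rewrite cresJ -{1}(cres_id G0) cresM.
by rewrite /cres en0 conjc1 mulr1 -[RHS](congr1 (@^~ t) (cres_id G0)).
Qed.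

Theorem parseval_polar (G1 G2 : R -> R[i]) : (forall t, ~ U t -> G1 t = 0) ->
  (forall t, ~ U t -> G2 t = 0) -> L2 G1 -> L2 G2 ->
  partial_sum (fun n => fcoef G1 n * conjc (fcoef G2 n) : R[i]^o) @ totally -->
  (ip2 G1 G2 : R[i]^o).
Proof.
move=> G10 G20 l1 l2; rewrite ip2_polar//.
apply: (partial_sum_polar (S := fun u => hn (fun x => G1 x + u * G2 x) ^+ 2)) => u.
have l12 : L2 (fun x => G1 x + u * G2 x) by apply: L2D => //; exact: L2Z.
have s12 t : ~ U t -> G1 t + u * G2 t = 0.
  by move=> nU; rewrite G10// G20// mulr0 addr0.
rewrite -Sq_hn// -parseval//; last exact: L2_unit_cintegrable.
by apply: eq_esum => n _; rewrite fcoefD.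
Qed.

End polarisation.

(** * The Fourier transform on square-integrable functions *)

Section fourier_L1.
Context {R : realType}.
Notation mu := (@lebesgue_measure R).
Notation L2 := (@Lspc R 2%:E).
Notation U := (@unit_itv R).
Notation hn := (hnorm (@ip2 R)).
Implicit Types f g u v : R -> R[i].

Lemma Lspc1P f : Lspc 1%:E f <-> cintegrable f.
Proof.
rewrite /Lspc/= /cLnorm Lnorm1; split => [[mf h]|fi].
  apply: (@cintegrable_le _ f (fun x => normc (f x))) => //.
  apply/integrableP; split; last exact: h.
  by apply/measurable_EFinP; exact: meas_normc.
split; first exact: cintegrable_meas.
by have /integrableP[] := cintegrable_normc fi.
Qed.

Lemma cintegral_dominated (h : nat -> R -> R[i]) f (g : R -> R) :
  (forall n, cmeasurable (h n)) -> cmeasurable f ->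
  (forall x, ccvg (h ^~ x) (f x)) -> mu.-integrable setT (EFin \o g) ->
  (forall n x, normc (h n x) <= g x) ->
  ccvg (fun n => cintegral (h n)) (cintegral f).
Proof.
move=> mh mf hf ig dom.
have key (p : R[i] -> R) : (forall n, measurable_fun [set: R] (fun x => p (h n x))) ->
    measurable_fun [set: R] (fun x => p (f x)) ->
    (forall x, (fun n => p (h n x)) @ \oo --> p (f x)) ->
    (forall z, `|p z| <= normc z) ->
    (fun n => Rintegral mu setT (fun x => p (h n x))) @ \oo -->
    Rintegral mu setT (fun x => p (f x)).
  move=> mph mpf phf pn.
  have [| | | | |i1 _ c1] := @dominated_convergence _ _ _ mu setT measurableT
    (fun n x => (p (h n x))%:E) (fun x => (p (f x))%:E) (EFin \o g).
  - by move=> n; apply/measurable_EFinP; exact: mph.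
  - by apply/measurable_EFinP; exact: mpf.
  - by apply: aeW => x _; apply: cvg_EFin; [exact: nearW|exact: phf].
  - by [].
  - by apply: aeW => x n _; rewrite lee_fin (le_trans (pn _))//; exact: dom.
  apply: fine_cvg; rewrite fineK//; exact: integrable_fin_num i1.
split.
- apply: (key (@complex.Re R)) => [n||x|z]; [exact: (mh n).1|exact: mf.1|
    exact: (hf x).1|exact: Re_le_normc].
- apply: (key (@complex.Im R)) => [n||x|z]; [exact: (mh n).2|exact: mf.2|
    exact: (hf x).2|exact: Im_le_normc].
Qed.

Let kmeas (y : R) : measurable_fun [set: R] (fun x => - (2 * pi * x * y)).
Proof.
by apply: measurableT_comp => //; apply: measurable_funM => //.
Qed.

Lemma cintegrable_expi f (g : R -> R) : cintegrable f ->
  measurable_fun [set: R] g -> cintegrable (fun x => f x * expi (g x)).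
Proof.
move=> fi mg; under eq_fun do rewrite mulrC.
apply: (cintegrableMb (M := 1) fi); first exact: cmeas_expi.
by move=> x; rewrite normc_csq csq_expi sqrtr1.
Qed.

Lemma cintegrable_fourier u y : cintegrable u ->
  cintegrable (fun x => u x * expi (- (2 * pi * x * y))).
Proof. by move=> ui; exact: cintegrable_expi ui (kmeas y). Qed.

Lemma fourier1D u v y : cintegrable u -> cintegrable v ->
  fourier1 (fun x => u x + v x) y = fourier1 u y + fourier1 v y.
Proof.
move=> ui vi; rewrite /fourier1; under eq_fun do rewrite mulrDl.
by rewrite cintegralD//; exact: cintegrable_fourier.
Qed.

Lemma fourier1Z u c y : cintegrable u ->
  fourier1 (fun x => c * u x) y = c * fourier1 u y.
Proof.
move=> ui; rewrite /fourier1; under eq_fun do rewrite -mulrA.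
by rewrite cintegralZ//; exact: cintegrable_fourier.
Qed.

Lemma fourier1B u v y : cintegrable u -> cintegrable v ->
  fourier1 (fun x => u x - v x) y = fourier1 u y - fourier1 v y.
Proof.
move=> ui vi; rewrite /fourier1; under eq_fun do rewrite mulrBl.
by rewrite cintegralB//; exact: cintegrable_fourier.
Qed.

(** Serves the measurability of [fourier1 u]: its real and imaginary parts are sums and differences
    of such integrals with [K] the cosine or the sine, and continuity in the frequency follows by
    domination by [|r|]. *)
Let continuous_cos_type (r K : R -> R) : mu.-integrable setT (EFin \o r) ->
  continuous K -> (forall t, `|K t| <= 1) ->
  continuous (fun y => Rintegral mu setT (fun x => r x * K (2 * pi * x * y))).
Proof.
move=> ir cK K1 y.
have mr : measurable_fun [set: R] r by apply/measurable_EFinP; exact: measurable_int ir.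
have mK y' : measurable_fun [set: R] (fun x => K (2 * pi * x * y')).
  apply: measurableT_comp; first exact: continuous_measurable_fun.
  by apply: measurable_funM => //; exact: measurable_funM.
have B y' x : `|r x * K (2 * pi * x * y')| <= `|r x|.
  by rewrite normrM ler_piMr.
have := @continuity_under_integral R _ _ mu
  (fun y x => r x * K (2 * pi * x * y)) setT measurableT (y - 1) (y + 1) _ _
  (fun x => `|r x|) _ _.
apply.
- move=> y' _; apply: le_integrable ir => //.
    by apply/measurable_EFinP; exact: (measurable_funM mr (mK y')).
  by move=> x _; rewrite lee_fin.
- apply: aeW => x _ y' _; apply: cvgM; first exact: cvg_cst.
  apply: (@continuous_comp _ _ _ (fun y => 2 * pi * x * y) K); last exact: cK.
  exact: mulrl_continuous.
- have := integrable_abse ir; by [].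
- by move=> y' _; apply: aeW => x _; exact: B.
by rewrite inE/= in_itv/= ltrDl ltr01 andbT gtrBl.
Qed.

Lemma cmeas_fourier1 u : cintegrable u -> cmeasurable (fourier1 u).
Proof.
move=> [u1 u2].
have c1 := continuous_measurable_fun (continuous_cos_type u1 (@continuous_cos R) (@cos_max R)).
have c2 := continuous_measurable_fun (continuous_cos_type u2 (@continuous_cos R) (@cos_max R)).
have s1 := continuous_measurable_fun (continuous_cos_type u1 (@continuous_sin R) (@sin_max R)).
have s2 := continuous_measurable_fun (continuous_cos_type u2 (@continuous_sin R) (@sin_max R)).
have I r K y : mu.-integrable setT (EFin \o r) -> continuous K ->
    (forall t : R, `|K t| <= 1) ->
    mu.-integrable setT (EFin \o (fun x => r x * K (2 * pi * x * y))).
  move=> ir cK K1; have mr : measurable_fun [set: R] r.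
    by apply/measurable_EFinP; exact: measurable_int ir.
  apply: le_integrable ir => //.
    apply/measurable_EFinP; apply: measurable_funM => //.
    apply: measurableT_comp; first exact: continuous_measurable_fun.
    by apply: measurable_funM => //; exact: measurable_funM.
  by move=> x _; rewrite lee_fin normrM ler_piMr.
split => /=.
- rewrite (_ : (fun x => _) = (fun y =>
    Rintegral mu setT (fun x => complex.Re (u x) * cos (2 * pi * x * y)) +
    Rintegral mu setT (fun x => complex.Im (u x) * sin (2 * pi * x * y)))).
    exact: measurable_funD.
  apply/funext => y; rewrite -RintegralD//.
  + by apply: eq_Rintegral => x _; rewrite ReM/= cosN sinN mulrN opprK.
  + exact: (I _ _ y u1 (@continuous_cos R) (@cos_max R)).
  + exact: (I _ _ y u2 (@continuous_sin R) (@sin_max R)).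
- rewrite (_ : (fun x => _) = (fun y =>
    Rintegral mu setT (fun x => complex.Im (u x) * cos (2 * pi * x * y)) -
    Rintegral mu setT (fun x => complex.Re (u x) * sin (2 * pi * x * y)))).
    exact: measurable_funB.
  apply/funext => y; rewrite -RintegralB//.
  + by apply: eq_Rintegral => x _; rewrite ImM/= cosN sinN mulrN addrC.
  + exact: (I _ _ y u2 (@continuous_cos R) (@cos_max R)).
  + exact: (I _ _ y u1 (@continuous_sin R) (@sin_max R)).
Qed.

(* Parseval's identity on a period of length [2k] containing the support, at
   every frequency shift [s]; integrating over [s] gives Plancherel. *)
Lemma plancherel_compact u (k : R) : 0 < k -> cintegrable u ->
  (forall x, ~ (`[- k, k[%classic : set R) x -> u x = 0) ->
  Sq (fourier1 u) = Sq u.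
Proof.
move=> k0 ui u0.
pose L := 2 * k; have L0 : 0 < L by rewrite mulr_gt0.
have Ln : L != 0 by rewrite gt_eqF.
have mu_ := cintegrable_meas ui.
(* [u] rescaled to the unit interval and modulated by the shift [s]. Its [n]-th coefficient is the
   transform of [u] at [(s + n)/L], up to the factor [1/L] and the unimodular [expi (pi * (s + n))]
   due to the translation by [k = L/2]. *)
pose G s t : R[i] := u (L * t - k) * expi (- (2 * pi * (t * s))).
have iG s : cintegrable (G s).
  apply: cintegrable_expi; first exact: cintegrable_affine.
  apply: measurableT_comp => //; apply: measurable_funM => //.
  exact: measurable_funM.
have G0 s t : ~ U t -> G s t = 0.
  move=> nU; rewrite /G u0 ?mul0r// => /=; rewrite in_itv/= => /andP[h1 h2].
  apply: nU; rewrite /unit_itv/= in_itv/=; apply/andP; split.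
    by rewrite -(pmulr_rge0 _ L0); lra.
  by rewrite -(ltr_pM2l L0) mulr1; move: h2; rewrite /L; lra.
have coef s (n : int) : csq (fourier1 u ((s + n%:~R) / L)) = L ^+ 2 * csq (fcoef (G s) n).
  have := @cintegral_affine R L (- k) L0 _ (@cintegrable_expi u _ ui (kmeas ((s + n%:~R) / L))).
  move=> /(congr1 (@csq R)); rewrite csqM csq_real -/(fourier1 u _) exprVn.
  have -> : cintegral (fun y => u (L * y - k) *
      expi (- (2 * pi * (L * y - k) * ((s + n%:~R) / L)))) =
      expi (pi * (s + n%:~R)) * fcoef (G s) n.
    rewrite -cintegralZ; last first.
      under eq_fun do rewrite -expiN.
      by apply: cintegrable_expi => //; apply: measurableT_comp => //;
  do 2 apply: measurable_funM => //.
    congr cintegral; apply/funext => t.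
    rewrite /G /en -expiN [RHS]mulrC -!mulrA; congr (_ * _).
    rewrite -!expiD; congr expi; rewrite /L; field.
    by rewrite gt_eqF.
  by rewrite csqM csq_expi mul1r => ->; rewrite mulrA divff ?mul1r// expf_neq0.
have SqG s : Sq (G s) = (L^-1%:E * Sq u)%E.
  rewrite [in RHS](@Sq_affine R L (- k) L0)// muleA -EFinM mulVf// mul1e.
  by apply: eq_integral => t _; rewrite /G csqM csq_expi mulr1.
rewrite {1}/Sq (@ge0_integral_unfold R L (fun y => (csq (fourier1 u y))%:E) L0); last 2 first.
- by apply: meas_ecsq; exact: cmeas_fourier1.
- by move=> x; rewrite lee_fin csq_ge0.
(* Parseval makes the integrand in [s] constant: the factors [1/L] from unfolding, [L^2] from the
   coefficients and [1/L] from rescaling cancel. *)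
rewrite (eq_integral (fun=> Sq u)); last first.
  move=> s _.
  transitivity (L^-1%:E * \esum_(n in [set: int]) (L ^+ 2 * csq (fcoef (G s) n))%:E)%E.
    by congr (_ * _)%E; apply: eq_esum => n _; rewrite coef.
  rewrite esum_intZ ?exprn_ge0 ?(ltW L0)//; last by move=> n; exact: csq_ge0.
  rewrite parseval//; last exact: G0.
  by rewrite SqG !muleA -!EFinM (_ : _ * _ = 1) ?mul1e//; field.
rewrite integral_cst; last exact: measurable_itv.
by rewrite /= lebesgue_measure_itv/= lte_fin ltr01 -EFinB subr0 mule1.
Qed.

(** [k.+1] rather than [k] keeps the half-length positive, as [plancherel_compact] requires. *)
Definition trunc (k : nat) f (x : R) : R[i] :=
  (\1_(`[- k.+1%:R, k.+1%:R[%classic : set R) x)%:C * f x.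

Lemma truncE k f x : trunc k f x = if (- k.+1%:R <= x < k.+1%:R) then f x else 0.
Proof. by rewrite /trunc indic_itvE; case: ifP; rewrite ?mul1r ?mul0r. Qed.

Lemma cmeas_trunc k f : cmeasurable f -> cmeasurable (trunc k f).
Proof.
move=> mf; apply: cmeasM => //; apply: cmeas_real; apply: measurable_indic.
exact: measurable_itv.
Qed.

Lemma trunc_cvg f x : ccvg (fun k => trunc k f x) (f x).
Proof.
have h : \forall k \near \oo, trunc k f x = f x.
  near=> k; rewrite truncE ifT//.
  have : `|x| < k.+1%:R.
    apply: le_lt_trans (_ : k%:R < _); last by rewrite ltr_nat.
    by near: k; exact: nbhs_infty_ger.
  by rewrite ltr_norml => /andP[/ltW -> ->].
by split; apply: cvg_near_cst; apply: filterS h => n ->.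
Unshelve. all: by end_near. Qed.

Lemma csq_trunc_le k f x : csq (trunc k f x) <= csq (f x).
Proof. by rewrite truncE; case: ifP => // _; rewrite /csq/= expr0n/= addr0 csq_ge0. Qed.

Lemma normc_trunc_le k f x : normc (trunc k f x) <= normc (f x).
Proof. by rewrite !normc_csq ler_wsqrtr// csq_trunc_le. Qed.

Lemma csq_sub_trunc_le k f x : csq (trunc k f x - f x) <= csq (f x).
Proof.
rewrite truncE; case: ifP => _; last by rewrite sub0r csqN.
by rewrite subrr /csq/= expr0n/= addr0 csq_ge0.
Qed.

Lemma cintegrable_trunc k f : cintegrable f -> cintegrable (trunc k f).
Proof.
move=> fi; apply: (@cintegrable_le _ _ (fun x => normc (f x))).
- by apply: cmeas_trunc; exact: cintegrable_meas.
- exact: cintegrable_normc.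
- by move=> x; exact: normc_trunc_le.
Qed.

Lemma L2_trunc k f : L2 f -> L2 (trunc k f).
Proof.
move=> f2; apply: (L2Mb (M := 1) f2).
  apply: cmeas_real; apply: measurable_indic; exact: measurable_itv.
by move=> x; rewrite csq_real indicE; case: (_ \in _); rewrite ?expr1n ?expr0n.
Qed.

Lemma L2_trunc_cintegrable k f : L2 f -> cintegrable (trunc k f).
Proof.
move=> f2; pose I : R -> R := \1_(`[- k.+1%:R, k.+1%:R[%classic : set R).
have I0 x : 0 <= I x by rewrite /I indicE.
have I2 : L2 (fun x => (I x)%:C).
  have ii : mu.-integrable setT (EFin \o I) by exact: integrable_indic_itv.
  apply: (@Sq_le_L2 _ _ (EFin \o I)).
  - by apply: cmeas_real; apply/measurable_EFinP; exact: measurable_int ii.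
  - by move=> x; rewrite lee_fin.
  - exact: measurable_int ii.
  - by move=> x; rewrite csq_real lee_fin /I indicE; case: (_ \in _); rewrite ?expr1n ?expr0n.
  - have /integrableP[_] := ii.
    by under eq_integral do rewrite gee0_abs ?lee_fin ?I0//.
have := L2_mul_cintegrable f2 I2; congr cintegrable; apply/funext => x.
by rewrite conjc_real /trunc mulrC.
Qed.

Lemma hn_trunc_cvg f : L2 f ->
  (fun k => hn (fun x => trunc k f x - f x)) @ \oo --> (0 : R).
Proof.
move=> f2; have mf := L2_meas f2.
have tc : {ae mu, forall x, ccvg (fun k => trunc k f x) (f x)}.
  by apply: aeW => x; exact: trunc_cvg.
have := @Sq_dominated R (fun k => trunc k f) f (fun x => csq (f x))
  (fun k => cmeas_trunc k mf) mf tc (L2_csq f2)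
  (fun k x => csq_sub_trunc_le k f x).
move=> h; apply/cvgrPdist_le => e e0.
near=> k; rewrite sub0r normrN ger0_norm ?hn_ge0//.
apply: hn_le; [apply: L2B => //; exact: L2_trunc|exact: ltW|apply: ltW].
by near: k; apply: cvge0_lt h _; rewrite exprn_gt0.
Unshelve. all: by end_near. Qed.

Lemma hn_cvg (x : nat -> R -> R[i]) f : (forall k, L2 (x k)) -> L2 f ->
  (fun k => hn (fun t => x k t - f t)) @ \oo --> (0 : R) ->
  (fun k => hn (x k)) @ \oo --> hn f.
Proof.
move=> x2 f2 h; apply/cvgrPdist_le => e e0.
near=> k; rewrite distrC; apply: le_trans (hn_dist (x2 k) f2) _.
rewrite -[leLHS]ger0_norm ?hn_ge0// -[X in `|X|]opprK normrN -[X in `|X|]sub0r.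
by near: k; move/cvgrPdist_le : h; apply.
Unshelve. all: by end_near. Qed.

Lemma Sq_trunc_le k f : cmeasurable f -> (Sq (trunc k f) <= Sq f)%E.
Proof.
move=> mf; apply: ge0_le_integral => //.
- by move=> x _; rewrite lee_fin csq_ge0.
- by apply: meas_ecsq; exact: cmeas_trunc.
- exact: meas_ecsq.
- by move=> x _; rewrite lee_fin csq_trunc_le.
Qed.

Lemma plancherel_trunc k u : cintegrable u ->
  Sq (fourier1 (trunc k u)) = Sq (trunc k u).
Proof.
move=> ui; apply: (@plancherel_compact _ k.+1%:R) => //.
  exact: cintegrable_trunc.
move=> x nx; rewrite truncE ifF//; apply/negP => h; apply: nx.
by rewrite /= in_itv.
Qed.

Lemma fourier1_trunc_cvg u y : cintegrable u ->
  ccvg (fun k => fourier1 (trunc k u) y) (fourier1 u y).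
Proof.
move=> ui; apply: (@cintegral_dominated _ _ (fun x => normc (u x))).
- move=> k; apply: cintegrable_meas; apply: cintegrable_fourier.
  exact: cintegrable_trunc.
- by apply: cintegrable_meas; exact: cintegrable_fourier.
- by move=> x; apply: ccvgM; [exact: trunc_cvg|exact: ccvg_cst].
- exact: cintegrable_normc.
- move=> k x; rewrite ComplexField.Normc.normcM [normc (expi _)]normc_csq csq_expi sqrtr1 mulr1.
  exact: normc_trunc_le.
Qed.

Lemma plancherel_le u : cintegrable u -> L2 u -> (Sq (fourier1 u) <= Sq u)%E.
Proof.
move=> ui u2; apply: (@Sq_fatou _ (fun k => fourier1 (trunc k u))).
- by move=> k; apply: cmeas_fourier1; exact: cintegrable_trunc.
- exact: cmeas_fourier1.
- by apply: aeW => y; exact: fourier1_trunc_cvg.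
- near=> k; rewrite plancherel_trunc//; apply: Sq_trunc_le; exact: L2_meas.
Unshelve. all: by end_near. Qed.

Lemma L2_fourier1 u : cintegrable u -> L2 u -> L2 (fourier1 u).
Proof.
move=> ui u2; apply/Lspc2P; split; first exact: cmeas_fourier1.
by apply: le_lt_trans (plancherel_le ui u2) _; have /Lspc2P[] := u2.
Qed.

(** Fatou alone gives the inequality [plancherel_le]. Applied to [trunc k u - u], it shows that the
    transforms of the truncations converge in L^2, and the equality known for truncations passes to
    the limit. *)
Theorem plancherel_L1L2 u : cintegrable u -> L2 u -> hn (fourier1 u) = hn u.
Proof.
move=> ui u2.
have t2 k := L2_trunc k u2; have ti k := cintegrable_trunc k ui.
have f2 k := L2_fourier1 (ti k) (t2 k).
have h1 := hn_trunc_cvg u2.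
have h2 : (fun k => hn (fun y => fourier1 (trunc k u) y - fourier1 u y)) @ \oo --> (0 : R).
  apply: (squeeze_cvgr _ (cvg_cst 0) h1); near=> k; rewrite hn_ge0/=.
  have d2 : L2 (fun x => trunc k u x - u x) by exact: L2B.
  have di : cintegrable (fun x => trunc k u x - u x) by exact: cintegrableB.
  apply: hn_le; [apply: L2B => //; exact: L2_fourier1|exact: hn_ge0|].
  rewrite -Sq_hn//; apply: le_trans (plancherel_le di d2).
  rewrite le_eqVlt; apply/orP; left; apply/eqP; congr Sq.
  by apply/funext => y; rewrite fourier1B.
have c1 := hn_cvg t2 u2 h1.
have c2 := hn_cvg f2 (L2_fourier1 ui u2) h2.
have E : (fun k => hn (fourier1 (trunc k u))) = (fun k => hn (trunc k u)).
  apply/funext => k; apply/eqP; rewrite -(eqrXn2 (ltn0Sn 1)) ?hn_ge0//.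
  by rewrite !hn_sqr// plancherel_trunc.
by rewrite E in c2; exact: (cvg_unique _ c2 c1).
Unshelve. all: by end_near. Qed.

End fourier_L1.

(** * Extension of the transform to L^2 *)

Section fourier_L2.
Context {R : realType}.
Notation mu := (@lebesgue_measure R).
Notation L2 := (@Lspc R 2%:E).
Notation hn := (hnorm (@ip2 R)).
Implicit Types f g F G : R -> R[i].

Lemma cLnorm2_cvg0 (x : nat -> R -> R[i]) : (forall k, L2 (x k)) ->
  ((fun k => cLnorm 2%:E (x k)) @ \oo --> 0%E) <->
  ((fun k => hn (x k)) @ \oo --> (0 : R)).
Proof.
move=> x2; rewrite (_ : (fun k => cLnorm 2%:E (x k)) = (fun k => (hn (x k))%:E)).
  split; last by apply: cvg_EFin; exact: nearW.
  by move=> /fine_cvg.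
by apply/funext => k; rewrite cLnorm2_hn.
Qed.

Lemma is_fourier2P f F : is_fourier2 f F <->
  [/\ L2 f, L2 F & exists u : nat -> R -> R[i],
    [/\ forall k, cintegrable (u k) /\ L2 (u k),
        (fun k => hn (fun x => u k x - f x)) @ \oo --> (0 : R) &
        (fun k => hn (fun y => fourier1 (u k) y - F y)) @ \oo --> (0 : R)]].
Proof.
split=> [[f2 F2 [u [u12 uf uF]]]|[f2 F2 [u [u12 uf uF]]]]; split => //; exists u.
- have u12' k : cintegrable (u k) /\ L2 (u k).
    by have [/Lspc1P ? ?] := u12 k.
  split => //.
  + apply: (cLnorm2_cvg0 _).1 uf => k; apply: L2B => //; exact: (u12' k).2.
  + apply: (cLnorm2_cvg0 _).1 uF => k; apply: L2B => //.
    by have [? ?] := u12' k; exact: L2_fourier1.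
- split.
  + by move=> k; have [/Lspc1P ? ?] := u12 k.
  + apply: (cLnorm2_cvg0 _).2 uf => k; apply: L2B => //; exact: (u12 k).2.
  + apply: (cLnorm2_cvg0 _).2 uF => k; apply: L2B => //.
    by have [? ?] := u12 k; exact: L2_fourier1.
Qed.

Lemma is_fourier2_L1 u : cintegrable u -> L2 u -> is_fourier2 u (fourier1 u).
Proof.
move=> ui u2; apply/is_fourier2P; split => //; first exact: L2_fourier1.
have z g : hn (fun x => g x - g x) = 0.
  rewrite /hnorm /ip2; under eq_fun do rewrite subrr mul0r.
  by rewrite (@cintegral_real R (cst 0)) /Rintegral integral0 /= sqrtr0.
by exists (fun=> u); split => //; under eq_fun do rewrite z; exact: cvg_cst.
Qed.

Lemma fourier2_hn f F : is_fourier2 f F -> hn F = hn f.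
Proof.
move=> /is_fourier2P[f2 F2 [u [u12 uf uF]]].
have c1 := hn_cvg (fun k => (u12 k).2) f2 uf.
have c2 := hn_cvg (fun k => L2_fourier1 (u12 k).1 (u12 k).2) F2 uF.
rewrite (_ : (fun k => _) = (fun k => hn (u k))) in c2.
  exact: (cvg_unique _ c2 c1).
by apply/funext => k; rewrite plancherel_L1L2//; [exact: (u12 k).1|exact: (u12 k).2].
Qed.

Lemma hnZ (c : R[i]) f : L2 f -> hn (fun x => c * f x) = normc c * hn f.
Proof.
move=> f2; have cf2 := L2Z c f2.
have h : (normc c * hn f) ^+ 2 = hn (fun x => c * f x) ^+ 2.
  rewrite exprMn normc_sqr !hn_sqr// {2}/Sq.
  under eq_integral do rewrite csqM.
  rewrite integral_csqZ ?csq_ge0//; last exact: L2_meas.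
  by rewrite fineM//; exact: L2_fin.
apply/eqP; rewrite -(eqrXn2 (ltn0Sn 1)) ?h// ?hn_ge0//.
by rewrite mulr_ge0 ?normc_ge0 ?hn_ge0.
Qed.

Lemma fourier2_comb f F g G c : is_fourier2 f F -> is_fourier2 g G ->
  is_fourier2 (fun x => f x + c * g x) (fun y => F y + c * G y).
Proof.
move=> /is_fourier2P[f2 F2 [u [u12 uf uF]]] /is_fourier2P[g2 G2 [v [v12 vg vG]]].
apply/is_fourier2P; split; [by apply: L2D => //; exact: L2Z|by apply: L2D => //; exact: L2Z|].
have key (x y : nat -> R -> R[i]) (a b : R -> R[i]) :
    (forall k, L2 (x k)) -> (forall k, L2 (y k)) -> L2 a -> L2 b ->
    (fun k => hn (fun t => x k t - a t)) @ \oo --> (0 : R) ->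
    (fun k => hn (fun t => y k t - b t)) @ \oo --> (0 : R) ->
    (fun k => hn (fun t => (x k t + c * y k t) - (a t + c * b t))) @ \oo --> (0 : R).
  move=> x2 y2 a2 b2 xa yb.
  have lim : (fun k => hn (fun t => x k t - a t) + normc c * hn (fun t => y k t - b t))
      @ \oo --> (0 : R).
    rewrite -[X in _ --> X](addr0 0) -[in X in _ --> _ + X](mulr0 (normc c)).
    by apply: cvgD => //; apply: cvgM => //; exact: cvg_cst.
  apply: (squeeze_cvgr _ (cvg_cst 0) lim); near=> k; rewrite hn_ge0/=.
  have xa2 := L2B (x2 k) a2; have yb2 := L2B (y2 k) b2.
  rewrite -hnZ//; apply: le_trans (hnD_le xa2 (L2Z c yb2)).
  rewrite le_eqVlt; apply/orP; left; apply/eqP; congr hnorm.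
  by apply/funext => t; ring.
exists (fun k x => u k x + c * v k x); split.
- move=> k; have [u1 u2] := u12 k; have [v1 v2] := v12 k; split.
    by apply: cintegrableD => //; exact: cintegrableZ.
  by apply: L2D => //; exact: L2Z.
- by apply: key => // k; [exact: (u12 k).2|exact: (v12 k).2].
- rewrite (_ : (fun k => _) = (fun k => hn (fun t =>
    (fourier1 (u k) t + c * fourier1 (v k) t) - (F t + c * G t)))).
    by apply: key => // k; [exact: L2_fourier1 (u12 k).1 (u12 k).2
                          |exact: L2_fourier1 (v12 k).1 (v12 k).2].
  apply/funext => k; congr hnorm; apply/funext => y.
  have [u1 _] := u12 k; have [v1 _] := v12 k.
  by rewrite fourier1D ?fourier1Z//; exact: cintegrableZ.
Unshelve. all: by end_near. Qed.

Lemma fourier2_B f F g G : is_fourier2 f F -> is_fourier2 g G ->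
  is_fourier2 (fun x => f x - g x) (fun y => F y - G y).
Proof.
move=> fF gG; have := fourier2_comb (-1) fF gG.
by congr is_fourier2; apply/funext => x; rewrite mulN1r.
Qed.

Lemma fourier2_0 : is_fourier2 (fun=> 0 : R[i]) (fun=> 0 : R[i]).
Proof.
have i0 : cintegrable (fun=> 0 : R[i]) by split => /=; exact: integrable0.
have := is_fourier2_L1 i0 (@L2_0 R).
congr is_fourier2; apply/funext => y; rewrite /fourier1.
under eq_fun do rewrite mul0r.
by rewrite (@cintegral_real R (cst 0)) /Rintegral integral0.
Qed.

Lemma fourier2_sum (I : Type) (s : seq I) (c : I -> R[i]) (f F : I -> R -> R[i]) :
  (forall i, is_fourier2 (f i) (F i)) ->
  is_fourier2 (fun x => \sum_(i <- s) c i * f i x) (fun y => \sum_(i <- s) c i * F i y).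
Proof.
move=> fF; elim: s => [|i s IH].
  have := fourier2_0; congr is_fourier2; apply/funext => y; by rewrite big_nil.
have := fourier2_comb (c i) IH (fF i).
by congr is_fourier2; apply/funext => y; rewrite big_cons addrC.
Qed.

Lemma fourier2_ip2 f F g G : is_fourier2 f F -> is_fourier2 g G ->
  ip2 F G = ip2 f g.
Proof.
move=> fF gG; have [f2 F2 _] := fF; have [g2 G2 _] := gG.
have h c := fourier2_hn (fourier2_comb c fF gG).
by rewrite (ip2_polar F2 G2) (ip2_polar f2 g2) (h 1) (h (-1)) (h 'i) (h (- 'i)).
Qed.

(** Translation and modulation are isometries, exchanged by the integral transform; they carry an
    approximating sequence for [f] and [F] to one for the shifted pair. *)
Lemma fourier2_shift f F b : is_fourier2 f F ->
  is_fourier2 (fun x => f (x - b)) (fun y => expi (- (2 * pi * b * y)) * F y).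
Proof.
have sh2 g : L2 g -> L2 (fun x => g (x - b)) /\ hn (fun x => g (x - b)) = hn g.
  move=> g2; have mg := L2_meas g2.
  have ms : cmeasurable (fun x => g (x - b)).
    by apply: (cmeas_comp mg); exact: measurable_funB.
  have E : Sq (fun x => g (x - b)) = Sq g.
    rewrite (@Sq_affine R 1 (- b) ltr01 g mg) mul1e.
    by congr Sq; apply/funext => x; rewrite mul1r.
  have l2 : L2 (fun x => g (x - b)).
    by apply/Lspc2P; split => //; rewrite E; have /Lspc2P[] := g2.
  split => //; apply/eqP; rewrite -(eqrXn2 (ltn0Sn 1)) ?hn_ge0//.
  by rewrite !hn_sqr// E.
have me : cmeasurable (fun y => expi (- (2 * pi * b * y)) : R[i]).
  by apply: cmeas_expi; apply: measurableT_comp => //; exact: measurable_funM.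
have mo2 G : L2 G -> L2 (fun y => expi (- (2 * pi * b * y)) * G y) /\
    hn (fun y => expi (- (2 * pi * b * y)) * G y) = hn G.
  move=> G2; have l2 : L2 (fun y => expi (- (2 * pi * b * y)) * G y).
    by apply: (L2Mb (M := 1) G2) => // y; rewrite csq_expi.
  split => //; apply/eqP; rewrite -(eqrXn2 (ltn0Sn 1)) ?hn_ge0//.
  rewrite !hn_sqr//; apply/eqP; congr fine; apply: eq_integral => y _.
  by rewrite csqM csq_expi mul1r.
move=> /is_fourier2P[f2 F2 [u [u12 uf uF]]].
apply/is_fourier2P; split; [exact: (sh2 f f2).1|exact: (mo2 F F2).1|].
exists (fun k x => u k (x - b)); split.
- move=> k; have [u1 u2] := u12 k; split; last exact: (sh2 _ u2).1.
  have := @cintegrable_affine R 1 (- b) ltr01 _ u1.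
  by congr cintegrable; apply/funext => x; rewrite mul1r.
- rewrite (_ : (fun k => _) = (fun k => hn (fun x => u k x - f x)))//.
  apply/funext => k; have [_ u2] := u12 k.
  exact: (sh2 _ (L2B u2 f2)).2.
- rewrite (_ : (fun k => _) = (fun k => hn (fun y => fourier1 (u k) y - F y)))//.
  apply/funext => k; have [u1 u2] := u12 k.
  rewrite -(mo2 _ (L2B (L2_fourier1 u1 u2) F2)).2; congr hnorm.
  apply/funext => y; rewrite mulrBr; congr (_ - _).
  rewrite /fourier1 -cintegralZ; last exact: cintegrable_fourier.
  have := @cintegral_shift R (fun x => expi (- (2 * pi * b * y)) *
    (u k x * expi (- (2 * pi * x * y)))) b.
  move=> <-; last by apply: cintegrableZ; exact: cintegrable_fourier.
  congr cintegral; apply/funext => x; rewrite [RHS]mulrCA; congr (_ * _).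
  by rewrite -expiD; congr expi; ring.
Qed.

(** Diagonal choice: for each [j], one integrable [v j] within [1/(j+1)] of [f j] whose transform is
    equally close to [F j]. *)
Lemma fourier2_closed (f F : nat -> R -> R[i]) g G :
  (forall j, is_fourier2 (f j) (F j)) -> L2 g -> L2 G ->
  (fun j => hn (fun x => f j x - g x)) @ \oo --> (0 : R) ->
  (fun j => hn (fun y => F j y - G y)) @ \oo --> (0 : R) ->
  is_fourier2 g G.
Proof.
move=> fF g2 G2 fg FG; apply/is_fourier2P; split => //.
have f2 j : L2 (f j) by have [] := fF j.
have F2 j : L2 (F j) by have [] := fF j.
have /choice[v hv] : forall j : nat, exists v : R -> R[i],
    [/\ cintegrable v, L2 v, hn (fun x => v x - f j x) <= j.+1%:R^-1 &
        hn (fun y => fourier1 v y - F j y) <= j.+1%:R^-1].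
  move=> j; have /is_fourier2P[_ _ [u [u12 uf uF]]] := fF j.
  have j0 : (0 : R) < j.+1%:R^-1 by rewrite invr_gt0.
  have [k [h1 h2]] : exists k, hn (fun x => u k x - f j x) <= j.+1%:R^-1 /\
      hn (fun y => fourier1 (u k) y - F j y) <= j.+1%:R^-1.
    near \oo => k; exists k; split.
    + rewrite -[leLHS]ger0_norm ?hn_ge0// -normrN -[X in `|X|]sub0r.
      by near: k; move/cvgrPdist_le : uf; apply.
    + rewrite -[leLHS]ger0_norm ?hn_ge0// -normrN -[X in `|X|]sub0r.
      by near: k; move/cvgrPdist_le : uF; apply.
  by have [u1 u2] := u12 k; exists (u k).
have harm : (fun j => j.+1%:R^-1) @ \oo --> (0 : R) by exact: cvg_harmonic.
exists v; split.
- by move=> j; have [] := hv j.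
- have lim : (fun j => j.+1%:R^-1 + hn (fun x => f j x - g x)) @ \oo --> (0 : R).
    by rewrite -[X in _ --> X](addr0 0); exact: cvgD.
  apply: (squeeze_cvgr _ (cvg_cst 0) lim); near=> j; rewrite hn_ge0/=.
  have [v1 v2 h1 _] := hv j.
  by apply: le_trans (hn_dist_le v2 g2 (f2 j)) _; rewrite lerD2r.
- have lim : (fun j => j.+1%:R^-1 + hn (fun y => F j y - G y)) @ \oo --> (0 : R).
    by rewrite -[X in _ --> X](addr0 0); exact: cvgD.
  apply: (squeeze_cvgr _ (cvg_cst 0) lim); near=> j; rewrite hn_ge0/=.
  have [v1 v2 _ h1] := hv j.
  apply: le_trans (hn_dist_le (L2_fourier1 v1 v2) G2 (F2 j)) _.
  by rewrite lerD2r.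
Unshelve. all: by end_near. Qed.

Lemma hn_cvg_cauchy (x : nat -> R -> R[i]) g : (forall k, L2 (x k)) -> L2 g ->
  (fun k => hn (fun t => x k t - g t)) @ \oo --> (0 : R) ->
  forall e, 0 < e -> exists N, forall j k, (N <= j)%N -> (N <= k)%N ->
    hn (fun t => x j t - x k t) <= e.
Proof.
move=> x2 g2 xg e e0.
have e2 : 0 < e / 2 by rewrite divr_gt0.
have /cvgrPdist_le/(_ _ e2)[N _ hN] := xg; exists N => j k Nj Nk.
apply: le_trans (hn_dist_le (x2 j) (x2 k) g2) _.
have h i : (N <= i)%N -> hn (fun t => x i t - g t) <= e / 2.
  by move=> Ni; have := hN i Ni; rewrite /= sub0r normrN ger0_norm ?hn_ge0.
by rewrite [leRHS](splitr e); apply: lerD; [exact: h|rewrite hn_subC; exact: h].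
Qed.

(** Truncations of [f] are integrable and converge to it; by isometry their transforms form a Cauchy
    sequence. *)
Lemma fourier2_exists f : L2 f -> exists F, is_fourier2 f F.
Proof.
move=> f2; have t2 k := L2_trunc k f2; have ti k := L2_trunc_cintegrable k f2.
have tf := hn_trunc_cvg f2.
have tF k := is_fourier2_L1 (ti k) (t2 k).
have [e e0|F F2 cF] := @L2_complete R (fun k => fourier1 (trunc k f))
    (fun k => L2_fourier1 (ti k) (t2 k)).
  have [N hN] := hn_cvg_cauchy t2 f2 tf e0; exists N => j k Nj Nk.
  by rewrite (fourier2_hn (fourier2_B (tF j) (tF k))); exact: hN.
by exists F; exact: fourier2_closed tF f2 F2 tf cF.
Qed.

Lemma fourierP f : L2 f -> is_fourier2 f (fourier f).
Proof. by move=> /fourier2_exists h; exact: (xgetPex (fun=> 0) h). Qed.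

(** The given preimage [f] makes the set of candidates nonempty; for the dual symbol it is supplied
    by [span_of_symbol]. *)
Lemma inv_fourierP f F : is_fourier2 f F -> is_fourier2 (inv_fourier F) F.
Proof.
by move=> fF; apply: (@xgetPex _ (fun=> 0) [set f | is_fourier2 f F]); exists f.
Qed.

Lemma fourier2_inj f g F : is_fourier2 f F -> is_fourier2 g F ->
  hn (fun x => f x - g x) = 0.
Proof.
move=> fF gF; rewrite -(fourier2_hn (fourier2_B fF gF)).
rewrite /hnorm /ip2; under eq_fun do rewrite subrr mul0r.
by rewrite (@cintegral_real R (cst 0)) /Rintegral integral0 /= sqrtr0.
Qed.

Lemma fourier2_ae f F G : is_fourier2 f F -> L2 G ->
  {ae mu, forall y, F y = G y} -> is_fourier2 f G.
Proof.
move=> /is_fourier2P[f2 F2 [u [u12 uf uF]]] G2 FG.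
apply/is_fourier2P; split => //; exists u; split => //.
rewrite (_ : (fun k => _) = (fun k => hn (fun y => fourier1 (u k) y - F y)))//.
apply/funext => k; have [u1 u2] := u12 k.
have mf := cmeas_fourier1 u1.
apply: ae_eq_hn; [apply: cmeasB => //; exact: L2_meas|apply: cmeasB => //; exact: L2_meas|].
by apply: aeS FG => y ->.
Qed.

End fourier_L2.

(** * Systems of translates *)

Section almost_everywhere.
Context {R : realType}.
Notation mu := (@lebesgue_measure R).
Notation U := (@unit_itv R).

Lemma Rintegral_ae_le (f g : R -> R) : mu.-integrable setT (EFin \o f) ->
  mu.-integrable setT (EFin \o g) -> {ae mu, forall x, f x <= g x} ->
  Rintegral mu setT f <= Rintegral mu setT g.
Proof.
move=> fi gi fg; rewrite -subr_ge0 -RintegralB//.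
have mf : measurable_fun [set: R] f by apply/measurable_EFinP; exact: measurable_int fi.
have mg : measurable_fun [set: R] g by apply/measurable_EFinP; exact: measurable_int gi.
have md := measurable_funB mg mf.
have -> : Rintegral mu setT (fun x => g x - f x) =
    Rintegral mu setT (fun x => `|g x - f x|).
  rewrite /Rintegral; congr fine; apply: ae_eq_integral => //.
  - by apply/measurable_EFinP; exact: md.
  - by apply/measurable_EFinP; apply: measurableT_comp => //; exact: md.
  - by apply: aeS fg => x fgx _; rewrite ger0_norm// subr_ge0.
exact: Rintegral_ge0.
Qed.

(** Transport of null sets from the period to the line: the measure of the preimage of [N] is the
    integral of the periodization of its indicator, which vanishes at every [t] of the unit interval
    outside [N]. *)
Lemma ae_frac (a : R) (P : R -> Prop) : 0 < a ->
  {ae mu, forall t, U t -> P t} -> {ae mu, forall y, P (frac (a * y))}.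
Proof.
move=> a0 [N [mN N0 sN]].
have mq : measurable_fun [set: R] (fun y => frac (a * y)).
  by apply: (measurableT_comp (@measurable_frac R)); exact: measurable_funM.
have mN' : measurable ((fun y => frac (a * y)) @^-1` N).
  by rewrite -[X in measurable X]setTI; exact: mq.
exists ((fun y => frac (a * y)) @^-1` N); split => //; last first.
  move=> y /= nP; apply: sN => /= h; apply: nP; apply: h.
  by rewrite /unit_itv/= in_itv/= frac_itv.
have -> : mu ((fun y => frac (a * y)) @^-1` N) =
    (\int[mu]_y (\1_N (frac (a * y)))%:E)%E.
  rewrite -[X in mu X]setIT -(integral_indic mu measurableT mN').
  apply: eq_integral => y _; rewrite !indicE.
  have -> // : (y \in (fun y => frac (a * y)) @^-1` N) = (frac (a * y) \in N).
  by apply/idP/idP => /set_mem h; exact: mem_set.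
rewrite (@integral_pz _ a a0 (fun y => \1_N (frac (a * y)))); last 2 first.
- by apply: (measurableT_comp _ mq); exact: measurable_indic.
- by move=> y; rewrite indicE.
rewrite (@ge0_ae_eq_integral _ _ _ mu U _ (cst 0%E))//.
- by rewrite integral0.
- exact: measurable_unit_itv.
- apply: measurable_funTS; apply: measurable_pz => [|y]; last by rewrite indicE.
  by apply: (measurableT_comp _ mq); exact: measurable_indic.
- by move=> t _; apply: pz_ge0 => // y; rewrite indicE.
exists N; split => // t /= /not_implyP[Ut nz]; apply: contrapT => nN; apply: nz.
apply: pz0 => n; have -> : a * ((t + n%:~R) / a) = t + n%:~R by field; rewrite gt_eqF.
rewrite frac_addz frac_id; last by move: Ut; rewrite /unit_itv/= in_itv.
by rewrite indicE memNset.
Qed.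

End almost_everywhere.

(** * The closed span and the bracket on the Fourier side *)

Section system_of_translates.
Context {R : realType}.
Notation mu := (@lebesgue_measure R).
Notation U := (@unit_itv R).
Notation L2 := (@Lspc R 2%:E).
Notation hn := (hnorm (@ip2 R)).
Variables (phi : R -> R[i]) (a : R).
Hypotheses (hphi : L2 phi) (a0 : 0 < a).

Notation xi := (translates phi a).
Notation K := (closed_span xi).
Let Phi := fourier phi.
Let p := pz a (fun y => csq (Phi y)).

Let phiF : is_fourier2 phi Phi. Proof. exact: fourierP. Qed.
Let Phi2 : L2 Phi. Proof. by case: phiF. Qed.
Let mPhi : cmeasurable Phi. Proof. exact: L2_meas. Qed.
Let iPhi : mu.-integrable setT (EFin \o (fun y => csq (Phi y))).
Proof. exact: L2_csq. Qed.
Let csqPhi0 y : 0 <= csq (Phi y). Proof. exact: csq_ge0. Qed.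

Let ma : measurable_fun [set: R] (fun y => a * y).
Proof. exact: measurable_funM. Qed.
Let maf : measurable_fun [set: R] (fun y => frac (a * y)).
Proof. exact: (measurableT_comp (@measurable_frac R) ma). Qed.

Lemma p_funE t : p_fun phi a t = p t.
Proof.
rewrite /p_fun /p /pz; congr (_ * _)%E; apply: eq_esum => n _.
by rewrite normc_sqr.
Qed.

Lemma translate_fourier f F n : is_fourier2 f F ->
  is_fourier2 (translates f a n) (fun y => en (- n) (a * y) * F y).
Proof.
move=> fF; have := fourier2_shift (n%:~R * a) fF.
congr is_fourier2; apply/funext => y; congr (_ * _).
by rewrite /en; congr expi; rewrite intrN; ring.
Qed.

Lemma xi_fourier n : is_fourier2 (xi n) (fun y => en (- n) (a * y) * Phi y).
Proof. exact: translate_fourier. Qed.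

Lemma xi_L2 n : L2 (xi n). Proof. by case: (xi_fourier n). Qed.

Lemma hn_subrr f : hn (f - f) = 0.
Proof.
rewrite /hnorm /ip2; have -> : f - f = (fun=> 0).
  by apply/funext => x; exact: subrr.
under eq_fun do rewrite mul0r.
by rewrite (@cintegral_real R (cst 0)) /Rintegral integral0 /= sqrtr0.
Qed.

Lemma lin_span_pairs (s : seq (int * R[i])) :
  lin_span xi (fun x => \sum_(q <- s) q.2 * xi q.1 x).
Proof.
have [r [c [_ h]]] := sum_pairs_uniq s; exists r, c.
by apply/funext => x; exact: (h (fun n => xi n x)).
Qed.

Lemma lin_spanP f : lin_span xi f ->
  exists s : seq (int * R[i]), f = fun x => \sum_(q <- s) q.2 * xi q.1 x.
Proof.
move=> [s [c ->]]; exists [seq (n, c n) | n <- s].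
by apply/funext => x; rewrite big_map.
Qed.

Lemma span_fourier (s : seq (int * R[i])) :
  is_fourier2 (fun x => \sum_(q <- s) q.2 * xi q.1 x)
    (fun y => trig [seq (- q.1, q.2) | q <- s] (a * y) * Phi y).
Proof.
have := fourier2_sum s (fun q => q.2) (fun q => xi_fourier q.1).
congr is_fourier2; apply/funext => y; rewrite /trig big_map big_distrl/=.
by apply: eq_bigr => q _; rewrite mulrA.
Qed.

Lemma closed_span_L2 f : K f -> L2 f. Proof. by case. Qed.

Lemma xi_closed_span n : K (xi n).
Proof.
split; first exact: xi_L2.
move=> e e0; exists (xi n); split; last by rewrite hn_subrr.
by exists [:: n], (fun=> 1); apply/funext => x; rewrite big_seq1 mul1r.
Qed.

Lemma closed_spanB f g : K f -> K g -> K (fun x => f x - g x).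
Proof.
move=> [f2 fK] [g2 gK]; split; first exact: L2B.
move=> e e0; have e2 : 0 < e / 2 by rewrite divr_gt0.
have [_ [/lin_spanP[s ->] hs]] := fK _ e2.
have [_ [/lin_spanP[r ->] hr]] := gK _ e2.
exists (fun x => \sum_(q <- s ++ [seq (q.1, - q.2) | q <- r]) q.2 * xi q.1 x).
split; first exact: lin_span_pairs.
have L (l : seq (int * R[i])) : L2 (fun x => \sum_(q <- l) q.2 * xi q.1 x).
  by apply: L2_sum => q; apply: L2Z; exact: xi_L2.
rewrite [ltRHS](splitr e); apply: le_lt_trans (ltrD hs hr).
apply: le_trans (hnB_le (L2B f2 (L s)) (L2B g2 (L r))).
rewrite le_eqVlt; apply/orP; left; apply/eqP; congr hnorm; apply/funext => x.
transitivity (f x - g x - \sum_(q <- s ++ [seq (q.1, - q.2) | q <- r]) q.2 * xi q.1 x) => //.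
rewrite big_cat big_map/=; under [X in _ - (_ + X)]eq_bigr do rewrite mulNr.
by rewrite sumrN; ring.
Qed.

(** Elements are functions rather than classes, so membership must be carried over to other
    representatives, such as the one chosen by [inv_fourier]. *)
Lemma closed_span_hn0 f g : K f -> L2 g -> hn (fun x => f x - g x) = 0 -> K g.
Proof.
move=> [f2 fK] g2 fg; split => // e e0; have [h [hs fh]] := fK e e0.
exists h; split => //; apply: le_lt_trans fh.
have h2 : L2 h.
  by have [s ->] := lin_spanP hs; apply: L2_sum => q; apply: L2Z; exact: xi_L2.
apply: le_trans (hn_dist_le g2 h2 f2) _.
by rewrite hn_subC fg add0r.
Qed.

Lemma modulation_L2 (m : R -> R[i]) (M : R) F : cmeasurable m ->
  (forall t, csq (m t) <= M) -> L2 F -> L2 (fun y => m (frac (a * y)) * F y).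
Proof.
move=> mm mM F2; apply: (L2Mb F2 _ (fun y => mM (frac (a * y)))).
exact: cmeas_comp.
Qed.

(* Approximate [m] by trigonometric polynomials in the weight [|Phi|^2] and pull
   the approximants back along the isometry. *)
Theorem span_of_symbol (m : R -> R[i]) (M : R) : cmeasurable m ->
  (forall t, csq (m t) <= M) ->
  exists2 f, K f & is_fourier2 f (fun y => m (frac (a * y)) * Phi y).
Proof.
move=> mm mM; pose G y := m (frac (a * y)) * Phi y.
have G2 : L2 G by exact: modulation_L2 mM Phi2.
have j0 (j : nat) : (0 : R) < j.+1%:R^-1 by rewrite invr_gt0.
have /choice[s hs] : forall j : nat, exists s : seq (int * R[i]),
    hn (fun y => trig [seq (- q.1, q.2) | q <- s] (a * y) * Phi y - G y) <= j.+1%:R^-1.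
  move=> j.
  have [s hs] := trig_dense csqPhi0 iPhi ma mm mM (exprn_gt0 2 (j0 j)).
  (* Translation by [n a] modulates with frequency [- n]; negating here cancels the negation in
     [span_fourier]. *)
  exists [seq (- q.1, q.2) | q <- s].
  have -> : [seq (- q.1, q.2) | q <- [seq (- q.1, q.2) | q <- s]] = s.
    by rewrite -map_comp -[RHS]map_id; apply: eq_map => -[n c] /=; rewrite opprK.
  have T2 : L2 (fun y => trig s (a * y) * Phi y).
    have [B hB] := trig_bounded s.
    by apply: (L2Mb Phi2 _ (fun y => hB (a * y))); exact: cmeas_trig.
  apply: hn_le; [exact: L2B|exact/ltW|].
  apply: le_trans hs; rewrite le_eqVlt; apply/orP; left; apply/eqP.
  by apply: eq_integral => y _; rewrite /G -csqM -csqN; congr (csq _)%:E; ring.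
pose f j : R -> R[i] := fun x => \sum_(q <- s j) q.2 * xi q.1 x.
pose F j : R -> R[i] := fun y => trig [seq (- q.1, q.2) | q <- s j] (a * y) * Phi y.
have fF j : is_fourier2 (f j) (F j) by exact: span_fourier.
have f2 j : L2 (f j) by have [] := fF j.
have F2 j : L2 (F j) by have [] := fF j.
have FG : (fun j => hn (fun y => F j y - G y)) @ \oo --> (0 : R).
  apply: (squeeze_cvgr _ (cvg_cst 0) (@cvg_harmonic R)); near=> j.
  by rewrite hn_ge0/=; exact: hs.
have [e e0|g g2 fg] := L2_complete f2.
  have [N hN] := hn_cvg_cauchy F2 G2 FG e0; exists N => j k Nj Nk.
  by rewrite -(fourier2_hn (fourier2_B (fF j) (fF k))); exact: hN.
exists g; last exact: fourier2_closed fF g2 G2 fg FG.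
split => // e e0.
have /cvgrPdist_lt/(_ _ e0)[N _ hN] := fg.
exists (f N); split; first exact: lin_span_pairs.
have := hN N (leqnn N); rewrite /= sub0r normrN ger0_norm ?hn_ge0//.
by apply: le_lt_trans; rewrite hn_subC.
Unshelve. all: by end_near. Qed.

(** [span_of_symbol] yields an element of the span with the same transform; by injectivity it is at
    distance 0 from [f]. *)
Lemma closed_span_symbol (m : R -> R[i]) (M : R) f F : cmeasurable m ->
  (forall t, csq (m t) <= M) -> is_fourier2 f F ->
  {ae mu, forall y, F y = m (frac (a * y)) * Phi y} ->
  K f /\ is_fourier2 f (fun y => m (frac (a * y)) * Phi y).
Proof.
move=> mm mM fF FE.
have fG := fourier2_ae fF (modulation_L2 mm mM Phi2) FE.
split => //; have [g gK gG] := span_of_symbol mm mM.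
by apply: (closed_span_hn0 gK); [case: fF|exact: fourier2_inj gG fG].
Qed.

(* The fibre inner product of [Phi] and [F]; its Fourier coefficients are the
   frame coefficients. *)
Definition bracket (F : R -> R[i]) : R -> R[i] :=
  cres (periodize a (fun y => Phi y * conjc (F y))).

Lemma bracket_supp F t : ~ U t -> bracket F t = 0.
Proof. by move=> nU; rewrite /bracket /cres indicE memNset// mul0r. Qed.

Lemma cintegrable_bracket F : L2 F -> cintegrable (bracket F).
Proof. by move=> F2; apply: cintegrable_periodize => //; exact: L2_mul_cintegrable. Qed.

(** A vanishing sum of nonnegative terms forces [Phi] to be zero on the whole fibre over [t]. *)
Lemma bracket0 F t : p t = 0%E -> bracket F t = 0.
Proof.
rewrite /p /pz => /eqP; rewrite mule_eq0 eqe invr_eq0 gt_eqF//= => /eqP E.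
rewrite /bracket /cres periodize0 ?mulr0// => n.
suff -> : Phi ((t + n%:~R) / a) = 0 by rewrite mul0r.
apply: csq_eq0; apply/eqP; rewrite eq_le csq_ge0 andbT.
suff : ((csq (Phi ((t + n%:~R) / a)))%:E <=
    \esum_(n in [set: int]) (csq (Phi ((t + n%:~R) / a)))%:E)%E.
  by rewrite E lee_fin.
apply: esum_ge; exists [set n]; first by split => //; exact: finite_set1.
by rewrite fsbig_set1.
Qed.

Lemma cintegral_bracket F (T : R -> R[i]) (M : R) : L2 F -> cmeasurable T ->
  (forall s, csq (T s) <= M) -> (forall s (n : int), T (s + n%:~R) = T s) ->
  cintegral (fun t => T t * bracket F t) = ip2 (fun y => T (a * y) * Phi y) F.
Proof.
move=> F2 mT TM TP.
have := cintegral_periodize a0 mT TM TP (L2_mul_cintegrable Phi2 F2).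
have -> : cres (fun t => T t * periodize a (fun x => Phi x * conjc (F x)) t) =
    (fun t => T t * bracket F t).
  by apply/funext => t; rewrite /bracket /cres mulrCA.
move=> ->; congr cintegral; apply/funext => y; by rewrite mulrA.
Qed.

Lemma en_periodic n s (k : int) : en n (s + k%:~R) = en n s :> R[i].
Proof. by rewrite en_add en_int mulr1. Qed.

Lemma trig_periodic l s (k : int) : trig l (s + k%:~R) = trig l s :> R[i].
Proof. by apply: eq_bigr => q _; rewrite en_periodic. Qed.

(** The modulation [en (- n)] of [xi n] is the conjugate exponential of the coefficient. As the
    bracket conjugates [F], this is the conjugate of the frame coefficient of [f]. *)
Lemma fcoef_bracket f F n : is_fourier2 f F -> fcoef (bracket F) n = ip2 (xi n) f.
Proof.
move=> fF; have [_ F2 _] := fF.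
rewrite -(fourier2_ip2 (xi_fourier n) fF).
rewrite -(@cintegral_bracket F (en (- n)) 1)//.
- by congr cintegral; apply/funext => t; rewrite enN mulrC.
- exact: (@cmeas_en R (- n) id (@measurable_id _ _ _)).
- by move=> s; rewrite csq_en.
- by move=> s k; exact: en_periodic.
Qed.

(** Both sides may be [+oo]: the bracket is in general only integrable. *)
Lemma analysis_sumE f F : is_fourier2 f F ->
  analysis_sum (@ip2 R) xi f = Sq (bracket F).
Proof.
move=> fF; have [f2 F2 _] := fF.
rewrite -parseval; [|exact: cintegrable_bracket|exact: bracket_supp].
apply: eq_esum => n _; rewrite normc_sqr (fcoef_bracket n fF).
by rewrite (ip2J (xi_L2 n) f2) csqJ.
Qed.

Lemma bracket_symbol (m : R -> R[i]) t :
  bracket (fun y => m (frac (a * y)) * Phi y) t =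
  cres (fun t => conjc (m (frac t)) * (fine (p t))%:C) t.
Proof.
rewrite /bracket /cres.
have -> : (fun y => Phi y * conjc (m (frac (a * y)) * Phi y)) =
    (fun y => (fun s => conjc (m (frac s))) (a * y) * (csq (Phi y))%:C).
  by apply/funext => y; rewrite conjM mulrCA mulJ.
rewrite (@periodize_mul R a a0 (fun s => conjc (m (frac s)))) => [//|s n|//].
by rewrite frac_addz.
Qed.

Lemma p_fin : {ae mu, forall t, U t -> p t \is a fin_num}.
Proof. exact: pz_fin. Qed.

Lemma p_ge0 t : (0 <= p t)%E. Proof. exact: pz_ge0. Qed.

Lemma measurable_p : measurable_fun [set: R] p.
Proof. by apply: measurable_pz => //; exact: meas_csq. Qed.

Lemma measurable_fine_p : measurable_fun [set: R] (fun t => fine (p t)).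
Proof. by apply: measurableT_comp; [exact: fine_measurable|exact: measurable_p]. Qed.

End system_of_translates.

Lemma hnB_sqr (R : realType) (f g : R -> R[i]) : Lspc 2%:E f -> Lspc 2%:E g ->
  hnorm (@ip2 R) (fun x => f x - g x) ^+ 2 =
  hnorm (@ip2 R) f ^+ 2 + hnorm (@ip2 R) g ^+ 2 - 2 * complex.Re (ip2 f g).
Proof.
move=> f2 g2; rewrite (hnD_sqr f2 (L2N g2)) hnN.
have -> : ip2 f (fun x => - g x) = - ip2 f g.
  rewrite /ip2 -cintegralN; last exact: L2_mul_cintegrable.
  by congr cintegral; apply/funext => x; rewrite rmorphN mulrN.
by rewrite ReN mulrN.
Qed.

(** * The lower frame bound against the lower bound of the periodization *)

Section lower_semi_frame.
Context {R : realType}.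
Notation mu := (@lebesgue_measure R).
Notation U := (@unit_itv R).
Notation L2 := (@Lspc R 2%:E).
Notation hn := (hnorm (@ip2 R)).
Variables (phi : R -> R[i]) (a : R).
Hypotheses (hphi : L2 phi) (a0 : 0 < a).

Notation xi := (translates phi a).
Notation K := (closed_span xi).
Notation Phi := (fourier phi).
Notation p := (pz a (fun y => csq (fourier phi y))).
Notation bracket := (bracket phi a).

Let Phi2 : L2 Phi. Proof. by case: (fourierP hphi). Qed.
Let iPhi : mu.-integrable setT (EFin \o (fun y => csq (Phi y))).
Proof. exact: L2_csq. Qed.
Let csqPhi0 y : 0 <= csq (Phi y). Proof. exact: csq_ge0. Qed.
Let p0 t : (0 <= p t)%E. Proof. exact: p_ge0. Qed.
Let fp0 t : 0 <= fine (p t). Proof. exact: fine_ge0. Qed.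
Let ma : measurable_fun [set: R] (fun y => a * y).
Proof. exact: measurable_funM. Qed.

Let mfp : measurable_fun [set: R] (fun t => fine (p t)).
Proof. exact: measurable_fine_p. Qed.

Definition bounded_below (A : R) :=
  {ae mu, forall t, U t -> (0 < p t)%E -> (A%:E <= p t)%E}.

Lemma L2_bracket F : L2 F -> (Sq (bracket F) < +oo)%E -> L2 (bracket F).
Proof.
move=> F2 Foo; apply/Lspc2P; split => //.
by have [/measurable_int/measurable_EFinP ? /measurable_int/measurable_EFinP ?] :=
  cintegrable_bracket hphi a0 F2.
Qed.

Lemma Sq_symbol (T : R -> R[i]) : cmeasurable T ->
  (forall s (n : int), T (s + n%:~R) = T s) ->
  Sq (fun y => T (a * y) * Phi y) =
  (\int[mu]_t (csq (T t) * (\1_U t * fine (p t)))%:E)%E.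
Proof.
move=> mT TP; have := @ge0_integral_pz_mul R a a0 (fun t => csq (T t)) _
  (meas_csq mT) (fun t => csq_ge0 (T t)) (fun s n => congr1 (@csq R) (TP s n)) iPhi csqPhi0.
rewrite /Sq; under [X in _ -> X = _]eq_integral do rewrite csqM.
by move=> ->; apply: eq_integral => t _; rewrite mulrCA.
Qed.

(** On a period the pairing is the integral of [T B] with [B] the bracket, and
    [2 Re (T B) <= A |T|^2 + |B|^2 / A] pointwise. Where [p > 0], [A] is at most [p]; where [p = 0],
    [B] vanishes. So the first term is bounded by [|T|^2 p], which integrates to a squared norm. *)
Lemma Re_ip2_symbol_le (A M : R) (T : R -> R[i]) F : 0 < A -> bounded_below A ->
  cmeasurable T -> (forall s, csq (T s) <= M) ->
  (forall s (n : int), T (s + n%:~R) = T s) -> L2 F -> L2 (bracket F) ->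
  2 * complex.Re (ip2 (fun y => T (a * y) * Phi y) F) <=
  A^-1 * hn (bracket F) ^+ 2 + hn (fun y => T (a * y) * Phi y) ^+ 2.
Proof.
move=> A0 pA mT TM TP F2 B2.
have H2 : L2 (fun y => T (a * y) * Phi y).
  by apply: (L2Mb Phi2 _ (fun y => TM (a * y))); exact: cmeas_comp.
have iB := L2_csq B2.
have iTB : cintegrable (fun t => T t * bracket F t).
  apply: (@cintegrableMb _ _ _ (Num.sqrt M)) => //; first exact: cintegrable_bracket.
  by move=> t; rewrite normc_csq ler_wsqrtr.
have iTp : mu.-integrable setT (EFin \o (fun t => csq (T t) * (\1_U t * fine (p t)))).
  apply: (@integrableMb _ _ _ M); [exact: meas_csq| |exact: integrable_res_pz].
  by move=> s; rewrite ger0_norm ?csq_ge0.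
rewrite -(cintegral_bracket hphi a0 F2 mT TM TP) hn_sqr// hn_sqr// (Sq_symbol mT TP).
rewrite /Sq [X in 2 * X]/= -!/(Rintegral _ _ _) -!RintegralZl//; last by case: iTB.
rewrite -RintegralD//; last exact: integrable_Zl.
apply: Rintegral_ae_le.
- by apply: integrable_Zl; case: iTB.
- have i1 := integrable_Zl A^-1 iB.
  exact: (integrableD measurableT i1 iTp).
apply: aeS2 (p_fin hphi a0) pA => t pfin pA.
have [Ut|nUt] := pselect (U t); last first.
  rewrite bracket_supp// mulr0/= mulr0 /csq/= expr0n/= addr0 mulr0 add0r.
  by rewrite mulr_ge0 ?mulr_ge0 ?csq_ge0.
have [pt0|ptn0] := eqVneq (p t) 0%E.
  rewrite (bracket0 a0)// mulr0/= mulr0 /csq/= expr0n/= addr0 mulr0 add0r.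
  by rewrite mulr_ge0 ?mulr_ge0 ?csq_ge0.
have : A <= fine (p t).
  by rewrite -lee_fin fineK ?pfin//; apply: pA => //; rewrite lt_neqAle eq_sym ptn0 p0.
rewrite indicE mem_set// mul1r => Ap.
have := @Re_mulJ_le _ (T t) (conjc (bracket F t)) _ A0; rewrite conjcK csqJ => h.
by apply: (le_trans h); rewrite addrC lerD2l mulrC ler_wpM2l ?csq_ge0.
Qed.

Lemma bounded_below_lower (A : R) : 0 < A -> bounded_below A ->
  forall f, K f -> ((A * hn f ^+ 2)%:E <= analysis_sum (@ip2 R) xi f)%E.
Proof.
move=> A0 pA f fK; have f2 := closed_span_L2 fK; have fF := fourierP f2.
have [_ F2 _] := fF; rewrite (analysis_sumE hphi a0 fF).
have [Boo|] := ltP (Sq (bracket (fourier f))) +oo%E; last first.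
  by move=> h; apply: le_trans h; rewrite leey.
have B2 := L2_bracket F2 Boo.
rewrite Sq_hn// lee_fin -ler_pdivlMl//; apply/ler_addgt0Pr => e e0.
(* With [||f - h||^2 <= e], expanding this norm and bounding [2 Re <f, h>] by the previous lemma
   leaves [||f||^2] at most [e] plus [||B||^2 / A]: the terms [||h||^2] cancel. *)
have [_ fh] := fK; have := fh (Num.sqrt e); rewrite sqrtr_gt0 => /(_ e0)[h [hs hfh]].
have [s hE] := lin_spanP hs.
have hH := span_fourier a hphi s; rewrite -hE in hH.
have [h2 H2 _] := hH.
have := hnB_sqr f2 h2.
have : hn (fun x => f x - h x) ^+ 2 <= e.
  by rewrite -[leRHS]sqr_sqrtr ?(ltW e0)// lerXn2r ?nnegrE ?hn_ge0 ?sqrtr_ge0// ltW.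
have [M hM] := @trig_bounded R [seq (- q.1, q.2) | q <- s].
have := @Re_ip2_symbol_le A M (trig [seq (- q.1, q.2) | q <- s]) (fourier f) A0 pA.
rewrite (fourier2_ip2 hH fF) (fourier2_hn hH) (ip2J f2 h2) ReJ => /(_ _ hM _ F2 B2).
have mt : cmeasurable (trig [seq (- q.1, q.2) | q <- s]).
  exact: (@cmeas_trig R _ id (@measurable_id _ _ _)).
move=> /(_ mt (fun s n => trig_periodic _ s n)).
move: (hn _ ^+ 2) (hn f ^+ 2) (hn h ^+ 2) (complex.Re _) (A^-1 * _) => x y z u v.
by move=> ? ? ?; lra.
Qed.


(** The test symbol is the indicator of [0 < p < A], for which the bracket is bounded by [A]. The
    frame inequality then reads [A int p <= int p^2] over that part of the period, which must
    therefore be null. *)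
Lemma lower_bounded_below (A : R) : 0 < A ->
  (forall f, K f -> ((A * hn f ^+ 2)%:E <= analysis_sum (@ip2 R) xi f)%E) ->
  bounded_below A.
Proof.
move=> A0 hA; pose E : set R := [set t | 0 < fine (p t) < A].
have mE : measurable E.
  have -> : E = (fun t => fine (p t)) @^-1` `]0, A[%classic.
    by apply/seteqP; split => t; rewrite /E/= in_itv.
  by rewrite -[X in measurable X]setTI; exact: (mfp measurableT (measurable_itv _)).
have m1E : measurable_fun [set: R] (\1_E : R -> R) by exact: measurable_indic.
pose m t : R[i] := (\1_E t)%:C.
have mm : cmeasurable m by exact: cmeas_real.
have m1 t : csq (m t) = \1_E t.
  by rewrite csq_real indicE; case: (_ \in _); rewrite ?expr1n ?expr0n.
have [|f fK fF] := @span_of_symbol R phi a hphi m 1 mm.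
  by move=> t; rewrite m1 indicE lern1 leq_b1.
pose v t : R := \1_E t * (\1_U t * fine (p t)).
have v0 t : 0 <= v t by rewrite !mulr_ge0.
have vA t : v t <= A.
  rewrite /v !indicE; case: (boolP (t \in E)) => [/set_mem/andP[_ /ltW h]|_].
    by case: (_ \in _); rewrite mul1r ?mul1r ?mul0r// ltW.
  by rewrite mul0r ltW.
have iv : mu.-integrable setT (EFin \o v).
  apply: (@integrableMb _ _ _ 1) => //; last exact: integrable_res_pz.
  by move=> s; rewrite indicE; case: (_ \in _); rewrite ?normr1 ?normr0.
have mv : measurable_fun [set: R] v by apply/measurable_EFinP; exact: measurable_int iv.
have ivv : mu.-integrable setT (EFin \o (fun t => v t * v t)).
  by apply: (@integrableMb _ _ _ A) => // s; rewrite ger0_norm.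
have fracU t : U t -> frac t = t by rewrite /unit_itv/= in_itv/= => ?; exact: frac_id.
have FE : Sq (fun y => m (frac (a * y)) * Phi y) = (\int[mu]_t (v t)%:E)%E.
  rewrite (@Sq_symbol (fun t => m (frac t))).
  - apply: eq_integral => t _; rewrite m1 /v; have [Ut|nUt] := pselect (U t).
      by rewrite fracU.
    by rewrite [\1_U t]indicE memNset// !mul0r !mulr0.
  - by apply: (cmeas_comp mm); exact: measurable_frac.
  - by move=> s n; rewrite frac_addz.
have := hA f fK; rewrite (analysis_sumE hphi a0 fF) -(fourier2_hn fF).
have -> : Sq (bracket (fun y => m (frac (a * y)) * Phi y)) =
    (\int[mu]_t (v t * v t)%:E)%E.
  apply: eq_integral => t _; rewrite (bracket_symbol phi a0) csq_cres csqM csqJ m1 csq_real /v.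
  have [Ut|nUt] := pselect (U t).
    rewrite fracU// [\1_U t]indicE mem_set// !mul1r indicE.
    by case: (_ \in _); rewrite ?mul1r ?mul0r// expr2.
  by rewrite [\1_U t]indicE memNset// !mul0r !mulr0.
have [_ F2 _] := fF.
rewrite EFinM -Sq_hn// FE => hv.
(* Nonnegative because [0 <= v <= A], with integral at most 0 by the frame inequality; hence zero
   a.e. *)
pose w t := A * v t - v t * v t.
have iw : mu.-integrable setT (EFin \o w).
  by have := integrableB measurableT (integrable_Zl A iv) ivv; exact.
have w0 t : 0 <= w t by rewrite /w -mulrBl mulr_ge0// subr_ge0.
have /ae_eq_integral_abs : (\int[mu]_t `|(w t)%:E| = 0)%E.
  under eq_integral do rewrite gee0_abs ?lee_fin//.
  apply/eqP; rewrite eq_le integral_ge0 ?andbT; last by move=> t _; rewrite lee_fin.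
  rewrite (_ : (fun t => (w t)%:E) =
    ((EFin \o (fun t => A * v t)%R) \- (EFin \o (fun t => v t * v t)%R))%E)//.
  rewrite integralB//; last exact: integrable_Zl.
  rewrite sube_le0.
  rewrite [X in (X <= _)%E](_ : _ = (A%:E * \int[mu]_t (v t)%:E)%E)//.
  by rewrite -integralZl.
move=> /(_ measurableT (measurable_int _ iw)); apply: aeS => t /(_ I)/= [wt] Ut pt.
rewrite leNgt; apply/negP => pA.
have pfin : p t \is a fin_num by rewrite ge0_fin_numE// (lt_trans pA)// ltry.
have fp : 0 < fine (p t) by rewrite -lte_fin fineK.
have fA : fine (p t) < A by rewrite -lte_fin fineK.
move: wt; rewrite /w -mulrBl /v !indicE !mem_set//; last by rewrite /E/= fp.
rewrite !mul1r => /eqP; rewrite mulf_eq0 subr_eq0 (gt_eqF fp) orbF.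
by rewrite gt_eqF.
Qed.

Lemma bracket_symbolE (m : R -> R[i]) :
  bracket (fun y => m (frac (a * y)) * Phi y) =
  cres (fun t => conjc (m t) * (fine (p t))%:C).
Proof.
apply/funext => t; rewrite (bracket_symbol phi a0) /cres.
have [|nUt] := pselect (U t); last by rewrite indicE memNset// !mul0r.
by rewrite /unit_itv/= in_itv/= => /frac_id ->.
Qed.

(* [xi n] is the limit of its cut-offs to [p <= k], which have a bounded
   bracket. *)
Lemma xi_K_xi n : K_xi (@ip2 R) K xi (xi n).
Proof.
split; first exact: xi_closed_span.
move=> e e0; pose E (k : nat) : set R := [set t | fine (p t) <= k%:R].
have mE k : measurable (E k).
  have -> : E k = (fun t => fine (p t)) @^-1` `]-oo, k%:R]%classic.
    by apply/seteqP; split => t; rewrite /E/= in_itv.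
  by rewrite -[X in measurable X]setTI; exact: (mfp measurableT (measurable_itv _)).
pose m k t : R[i] := (\1_(E k) t)%:C * en (- n) t.
have men : cmeasurable (@en R (- n)) by exact: (@cmeas_en R (- n) id (@measurable_id _ _ _)).
have mm k : cmeasurable (m k).
  by apply: cmeasM => //; apply: cmeas_real; exact: measurable_indic.
have cm k t : csq (m k t) = \1_(E k) t.
  rewrite csqM csq_en mulr1 csq_real indicE.
  by case: (_ \in _); rewrite ?expr1n ?expr0n.
have m1 k t : csq (m k t) <= 1 by rewrite cm indicE lern1 leq_b1.
pose F k y := m k (frac (a * y)) * Phi y.
pose X y := en (- n) (a * y) * Phi y.
have XF k y : csq (F k y - X y) = (1 - \1_(E k) (frac (a * y))) * csq (Phi y).
  rewrite /F /X /m en_frac -mulrBl -[X in _ - X]mul1r -mulrBl !csqM csq_en mulr1.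
  rewrite indicE; case: (_ \in _); rewrite ?subrr ?subr0 ?sub0r ?csqN//.
    by rewrite /csq/= expr0n/= addr0.
  by rewrite /csq/= expr0n/= expr1n addr0.
have F2 k : L2 (F k) by apply: (modulation_L2 a (mm k) (m1 k)).
have [_ X2 _] := xi_fourier a hphi n.
have dom : (fun k => Sq (fun y => F k y - X y)) @ \oo --> 0%E.
  apply: (@Sq_dominated R F X (fun y => csq (Phi y))) => //.
  - by move=> k; exact: L2_meas.
  - exact: L2_meas.
  - apply: aeW => y.
    suff : \forall k \near \oo, F k y = X y.
      move=> [N _ hN]; split; apply/cvgrPdist_lt => d d0; exists N => // k Nk /=;
        by rewrite hN// subrr normr0.
    have := fp0 (frac (a * y)); set r := fine _ => r0.
    (* From this index on the level [k] exceeds [r], and the cut-off leaves the value at [y]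
       unchanged. *)
    exists (Num.truncn r).+1 => // k /= rk; rewrite /F /X /m indicE mem_set ?mul1r ?en_frac//.
    rewrite /E/= -/r (le_trans (ltW (truncnS_gt r)))// ler_nat//.
  - by move=> k y; rewrite XF ler_piMl// gerBl.
have e2 : (0 < (e ^+ 2)%:E)%E by rewrite lte_fin exprn_gt0.
have [k hk] : exists k, (Sq (fun y => F k y - X y)%R < (e ^+ 2)%:E)%E.
  have [N _ hN] := cvge0_lt dom e2.
  by exists N; apply: hN => /=.
have [f fK fF] := span_of_symbol a hphi (mm k) (m1 k).
exists f; split.
  split => //; rewrite (analysis_sumE hphi a0 fF) bracket_symbolE.
  have : L2 (cres (fun t => conjc (m k t) * (fine (p t))%:C)).
    apply: (@L2_cresb _ _ (k%:R ^+ 2)).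
      by apply: cmeasM; [exact: cmeasJ|exact: cmeas_real].
    move=> t; rewrite csqM csqJ cm csq_real indicE; case: (boolP (t \in E k)) => [/set_mem tE|_].
      by rewrite mul1r lerXn2r ?nnegrE.
    by rewrite mul0r exprn_ge0.
  by move=> /Lspc2P[].
have := fourier2_hn (fourier2_B (xi_fourier a hphi n) fF).
rewrite -/(X) -/(F k) => FE; rewrite (_ : hn _ = hn (fun y => X y - F k y)); last by rewrite FE.
rewrite hn_subC -(@ltr_pXn2r _ 2) ?nnegrE ?hn_ge0 ?(ltW e0)// -lte_fin -Sq_hn//.
exact: L2B.
Qed.

End lower_semi_frame.

(** * The frame operator and the canonical dual *)

Section canonical_dual.
Context {R : realType}.

#[local] Existing Instance totally_filter.

Notation mu := (@lebesgue_measure R).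
Notation U := (@unit_itv R).
Notation L2 := (@Lspc R 2%:E).
Notation hn := (hnorm (@ip2 R)).
Variables (phi : R -> R[i]) (a : R).
Hypotheses (hphi : L2 phi) (a0 : 0 < a).

Notation xi := (translates phi a).
Notation K := (closed_span xi).
Notation Phi := (fourier phi).
Notation p := (pz a (fun y => csq (fourier phi y))).
Notation bracket := (bracket phi a).

Let Phi2 : L2 Phi. Proof. by case: (fourierP hphi). Qed.
Let fp0 t : 0 <= fine (p t). Proof. by rewrite fine_ge0// p_ge0. Qed.
Let mfp : measurable_fun [set: R] (fun t => fine (p t)).
Proof. exact: measurable_fine_p. Qed.
Let maf : measurable_fun [set: R] (fun y => frac (a * y)).
Proof.
by apply: (measurableT_comp (@measurable_frac R)); exact: measurable_funM.
Qed.

Lemma dom_C_bracket f F : is_fourier2 f F -> dom_C (@ip2 R) K xi f -> L2 (bracket F).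
Proof.
move=> fF [_]; rewrite (analysis_sumE hphi a0 fF).
by apply: L2_bracket => //; case: fF.
Qed.

(** The combination of two square-integrable brackets is square integrable, and Parseval converts
    this back into square summability of the coefficients of [f - g]. *)
Lemma dom_CB f g : dom_C (@ip2 R) K xi f -> dom_C (@ip2 R) K xi g ->
  dom_C (@ip2 R) K xi (fun x => f x - g x).
Proof.
move=> fD gD; have [fK _] := fD; have [gK _] := gD.
have f2 := closed_span_L2 fK; have g2 := closed_span_L2 gK.
split; first exact: closed_spanB.
have Bf := dom_C_bracket (fourierP f2) fD; have Bg := dom_C_bracket (fourierP g2) gD.
have B0 F t : ~ U t -> bracket F t = 0 by exact: bracket_supp.
have B2 := L2D Bf (L2Z (-1) Bg); have /Lspc2P[_] := B2.
have BB0 t : ~ U t -> bracket (fourier f) t + -1 * bracket (fourier g) t = 0.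
  by move=> nU; rewrite !B0// mulr0 addr0.
rewrite -parseval//; last exact: L2_unit_cintegrable.
congr (_ < _)%E; apply: eq_esum => n _; rewrite normc_sqr; congr (_%:E).
have Ef := fcoef_bracket hphi a0 n (fourierP f2).
have Eg := fcoef_bracket hphi a0 n (fourierP g2).
have E := @fcoefD _ _ _ (-1) n (B0 _) (B0 _) Bf Bg.
rewrite (etrans E (congr2 (fun z w : R[i] => z + -1 * w) Ef Eg)).
have x2 := xi_L2 a hphi n.
rewrite mulN1r (ip2J f2 x2) (ip2J g2 x2) -conjB csqJ.
by rewrite -(ip2B f2 g2 x2).
Qed.

(** Both defining limits are tested on [d = f' - f]. Their difference is the sum of [|<d, xi n>|^2],
    which must therefore equal [<h, d> - <h, d> = 0]. *)
Lemma frame_op_inj f f' h : frame_op (@ip2 R) K xi f h -> frame_op (@ip2 R) K xi f' h ->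
  analysis_sum (@ip2 R) xi (fun x => f' x - f x) = 0%E.
Proof.
move=> [fD _ fh] [f'D _ f'h]; have dD := dom_CB f'D fD.
set d := fun x => f' x - f x in dD *.
have d2 := closed_span_L2 (proj1 dD); have dF := fourierP d2.
have f2 := closed_span_L2 (proj1 fD); have f'2 := closed_span_L2 (proj1 f'D).
have B2 := dom_C_bracket dF dD.
have B0 t : ~ U t -> bracket (fourier d) t = 0 by exact: bracket_supp.
have h1 := parseval_polar B0 B0 B2 B2.
have h2 := cvgB (f'h d dD) (fh d dD).
rewrite (analysis_sumE hphi a0 dF) -[LHS]fineK ?L2_fin//.
suff E : ip2 (bracket (fourier d)) (bracket (fourier d)) = 0.
  by move: E; rewrite ip2_self// => /complexI ->.
rewrite -(subrr (ip2 h d)).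
apply: (@cvg_unique (R[i]^o) (@norm_hausdorff _ _) _ _ _ _ h1).
rewrite (_ : partial_sum _ = fun s =>
  partial_sum (fun n => ip2 f' (xi n) * ip2 (xi n) d : R[i]^o) s
  - partial_sum (fun n => ip2 f (xi n) * ip2 (xi n) d : R[i]^o) s); first exact: h2.
apply/funext => s; rewrite !partial_sumE -sumrB; apply: eq_bigr => n _.
rewrite (fcoef_bracket hphi a0 n dF); have x2 := xi_L2 a hphi n.
by rewrite -(ip2J x2 d2) -mulrBl -(ip2B f'2 f2 x2) mulrC.
Qed.

(** The two cases merge because [0^-1 = 0]. The inverse is written as a power so that measurability
    of real powers applies. *)
Lemma dual_symbolE y : dual_symbol phi a y =
  ((fine (p (frac (a * y)))) `^ (-1))%:C * Phi y.
Proof.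
rewrite /dual_symbol -/(frac (a * y)) (p_funE phi a) powR_inv1//.
case: asboolP => [_|nZ]; first by rewrite mulrC fmorphV.
suff -> : fine (p (frac (a * y))) = 0 by rewrite invr0 mul0r.
apply/eqP; rewrite eq_le fp0 andbT leNgt; apply/negP => h; apply: nZ; split.
  exact: frac_itv.
rewrite (p_funE phi a) lt_neqAle p_ge0// andbT; apply/negP => /eqP E.
by move: h; rewrite -E ltxx.
Qed.

Variable A : R.
Hypotheses (A0 : 0 < A) (pA : bounded_below phi a A).

(** The symbol [1/p] restricted to [p >= A]. It is at most [1/A] everywhere, as the lemmas on
    bounded symbols require. *)
Let m0 (t : R) : R := \1_[set t | A <= fine (p t)] t * (fine (p t)) `^ (-1).

Let m0E t : m0 t = if A <= fine (p t) then (fine (p t))^-1 else 0.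
Proof.
rewrite /m0 powR_inv1// indicE; case: ifPn => h; last first.
  by rewrite memNset ?mul0r//=; apply/negP.
by rewrite mem_set ?mul1r.
Qed.

Let mE : measurable_fun [set: R] (\1_[set t | A <= fine (p t)] : R -> R).
Proof.
apply: measurable_indic.
have -> : [set t | A <= fine (p t)] = (fun t => fine (p t)) @^-1` `[A, +oo[%classic.
  by apply/seteqP; split => t; rewrite /= in_itv/= andbT.
by rewrite -[X in measurable X]setTI; exact: (mfp measurableT (measurable_itv _)).
Qed.

Let mm0 : measurable_fun [set: R] m0.
Proof.
have m2 := measurableT_comp (@measurable_powR R (-1)) mfp.
exact: (measurable_funM mE m2).
Qed.

Let m0_ge0 t : 0 <= m0 t.
Proof. by rewrite m0E; case: ifP => // _; rewrite invr_ge0. Qed.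

Let m0_le t : m0 t <= A^-1.
Proof.
rewrite m0E; case: ifP => h; last by rewrite invr_ge0 ltW.
by rewrite lef_pV2// ?posrE// (lt_le_trans A0).
Qed.

(** The lower bound of [p] holds a.e. on the period and is carried to the frequency line by
    [ae_frac]. Where [p = 0] both sides are 0, again by [0^-1 = 0]. *)
Lemma dual_symbol_ae : {ae mu, forall y, dual_symbol phi a y = (m0 (frac (a * y)))%:C * Phi y}.
Proof.
apply: (aeS _ (ae_frac a0 (P := fun t => p t \is a fin_num /\
    ((0 < p t)%E -> (A%:E <= p t)%E)) _)).
  move=> y [pf pAy]; rewrite dual_symbolE powR_inv1// m0E.
  case: ifPn => // /negP nA; have [p0|] := eqVneq (p (frac (a * y))) 0%E.
    by rewrite p0/= invr0.
  move=> pn0; case: nA; rewrite -lee_fin fineK//; apply: pAy.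
  by rewrite lt_neqAle eq_sym pn0 p_ge0.
by apply: aeS2 (p_fin hphi a0) pA => t h1 h2 Ut; split; [exact: h1|exact: h2].
Qed.

Let mn n t : R[i] := en (- n) t * (m0 t)%:C.

Let mmn n : cmeasurable (mn n).
Proof.
apply: cmeasM; last exact: cmeas_real.
exact: (@cmeas_en R (- n) id (@measurable_id _ _ _)).
Qed.

Let csq_mn n t : csq (mn n t) <= A^-1 ^+ 2.
Proof.
by rewrite csqM csq_en mul1r csq_real lerXn2r ?nnegrE// ?invr_ge0 ?(ltW A0).
Qed.

Let csq_m0 t : csq (m0 t)%:C <= A^-1 ^+ 2.
Proof. by rewrite csq_real lerXn2r ?nnegrE// invr_ge0 ltW. Qed.

Lemma L2_dual_symbol : L2 (dual_symbol phi a).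
Proof.
have mD : cmeasurable (dual_symbol phi a).
  rewrite (_ : dual_symbol _ _ = fun y => ((fine (p (frac (a * y)))) `^ (-1))%:C * Phi y).
    apply: cmeasM; last exact: L2_meas.
    have m1 : measurable_fun [set: R] (fun y : R => fine (p (frac (a * y))) `^ (-1)).
      exact: (measurableT_comp (measurableT_comp (@measurable_powR R (-1)) mfp) maf).
    exact: (cmeas_real m1).
  by apply/funext => y; exact: dual_symbolE.
have G2 : L2 (fun y => (m0 (frac (a * y)))%:C * Phi y).
  exact: (modulation_L2 a (cmeas_real mm0) csq_m0 Phi2).
apply/Lspc2P; split => //; have /Lspc2P[_] := G2.
congr (_ < _)%E; apply: ae_eq_integral => //.
- by apply: meas_ecsq; exact: L2_meas.
- exact: meas_ecsq.
- by apply: aeS dual_symbol_ae => y -> _.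
Qed.

Notation psi := (translates (inv_fourier (dual_symbol phi a)) a).

Lemma dual_fourier n : K (psi n) /\
  is_fourier2 (psi n) (fun y => mn n (frac (a * y)) * Phi y).
Proof.
(* Only a witness that the dual symbol is a Fourier transform; the generator itself is the
   representative picked by [inv_fourier]. *)
have [f fK fF] := span_of_symbol a hphi (cmeas_real mm0) csq_m0.
have fD : is_fourier2 f (dual_symbol phi a).
  apply: fourier2_ae fF L2_dual_symbol _.
  by apply: aeS dual_symbol_ae => y ->.
have := translate_fourier a n (inv_fourierP fD) => nD.
apply: (closed_span_symbol hphi (mmn n) (csq_mn n) nD).
apply: aeS dual_symbol_ae => y ->.
by rewrite /mn en_frac mulrA.
Qed.

Let dual_bracket n : bracket (fun y => mn n (frac (a * y)) * Phi y) =
  cres (fun t => en n t * (\1_[set t | A <= fine (p t)] t)%:C).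
Proof.
rewrite (bracket_symbolE phi a0); apply/funext => t; rewrite /cres; congr (_ * _).
rewrite /mn conjM conjc_real enN conjcK -mulrA -rmorphM m0E; congr (_ * _%:C).
rewrite indicE; case: ifPn => h; last by rewrite memNset ?mul0r//=; apply/negP.
by rewrite mem_set// mulVf// gt_eqF// (lt_le_trans A0).
Qed.

Let L2_dual_bracket n : L2 (bracket (fun y => mn n (frac (a * y)) * Phi y)).
Proof.
rewrite dual_bracket; apply: (@L2_cresb _ _ 1).
  apply: cmeasM; last exact: cmeas_real.
  exact: (@cmeas_en R n id (@measurable_id _ _ _)).
move=> t; rewrite csqM csq_en mul1r csq_real indicE.
by case: (_ \in _); rewrite ?expr1n ?expr0n.
Qed.

Lemma dual_dom_C n : dom_C (@ip2 R) K xi (psi n).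
Proof.
have [nK nF] := dual_fourier n; split => //.
by rewrite (analysis_sumE hphi a0 nF); have /Lspc2P[] := L2_dual_bracket n.
Qed.

(** Coefficients of brackets are [<xi k, .>], conjugates of frame coefficients, so the polarised
    identity is taken with the bracket of [g] first and that of [psi n] second. Its limit is then
    the [n]-th Fourier coefficient of the bracket of [g], which is [<xi n, g>]. *)
Lemma dual_frame_op n : frame_op (@ip2 R) K xi (psi n) (xi n).
Proof.
split; [exact: dual_dom_C|exact: xi_K_xi|move=> g gD].
have [nK nF] := dual_fourier n; have [n2 _ _] := nF.
have g2 := closed_span_L2 (proj1 gD); have gF := fourierP g2.
have Bg2 := dom_C_bracket gF gD.
have B0 F t : ~ U t -> bracket F t = 0 by exact: bracket_supp.
have := parseval_polar (B0 _) (B0 _) Bg2 (L2_dual_bracket n).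
have -> : ip2 (bracket (fourier g)) (bracket (fun y => mn n (frac (a * y)) * Phi y)) =
    ip2 (xi n) g.
  rewrite -(fcoef_bracket hphi a0 n gF); apply: ae_eq_cintegral.
  - by apply: cmeasM; [|apply: cmeasJ]; exact: L2_meas.
  - apply: cmeasM; first exact: L2_meas.
    by apply: cmeasJ; exact: (@cmeas_en R n id (@measurable_id _ _ _)).
  - apply: aeS2 (p_fin hphi a0) pA => t pf pAt.
    have [Ut|nUt] := pselect (U t); last by rewrite B0// !mul0r.
    have [pt0|ptn0] := eqVneq (p t) 0%E; first by rewrite (bracket0 a0 _ pt0) !mul0r.
    rewrite dual_bracket /cres !indicE !mem_set ?mul1r ?mulr1//=.
    rewrite -lee_fin fineK ?pf//; apply: pAt => //.
    by rewrite lt_neqAle eq_sym ptn0 p_ge0.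
apply: cvg_trans; apply: near_eq_cvg; near=> s.
rewrite !partial_sumE; apply: eq_bigr => k _.
rewrite (fcoef_bracket hphi a0 k gF) (fcoef_bracket hphi a0 k nF).
by rewrite -(ip2J (xi_L2 a hphi k) n2) mulrC.
Unshelve. all: by end_near. Qed.

End canonical_dual.

(** * The equivalence and the identification of the dual *)

Lemma bounded_belowP (R : realType) (phi : R -> R[i]) (a A : R) :
  bounded_below phi a A <->
  {ae @lebesgue_measure R,
    forall gamma, Z_set phi a gamma -> (A%:E <= p_fun phi a gamma)%E}.
Proof.
split; apply: aeS => t.
- by move=> h [tU]; rewrite (p_funE phi a); apply: h; rewrite /unit_itv/= in_itv.
- move=> h Ut p0; rewrite -(p_funE phi a); apply: h; split.
    by move: Ut; rewrite /unit_itv/= in_itv.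
  by rewrite (p_funE phi a).
Qed.

Theorem theorem6p3 (R : realType) (phi : R -> R[i]) (a : R)
    (hphi : Lspc 2%:E phi) (ha : 0 < a) :
  (lower_semi_frame (@ip2 R) (closed_span (translates phi a))
      (translates phi a)
   <->
   exists A : R, 0 < A /\
     {ae @lebesgue_measure R,
       forall gamma, Z_set phi a gamma -> (A%:E <= p_fun phi a gamma)%E})
  /\
  (lower_semi_frame (@ip2 R) (closed_span (translates phi a))
      (translates phi a) ->
   Lspc 2%:E (dual_symbol phi a) /\
   canonical_dual (@ip2 R) (closed_span (translates phi a))
     (translates phi a) (translates (inv_fourier (dual_symbol phi a)) a)).
Proof.
split; [split|].
- move=> [_ [A [A0 hA]]]; exists A; split => //; apply/bounded_belowP.
  exact: (lower_bounded_below hphi ha A0 hA).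
- move=> [A [A0 /bounded_belowP hA]].
  split=> [n|]; first exact: xi_closed_span.
  by exists A; split => //; exact: bounded_below_lower.
move=> [_ [A [A0 hA]]]; have pA := lower_bounded_below hphi ha A0 hA.
split; first exact: (L2_dual_symbol hphi ha A0 pA).
(* [xi n] already belongs to [K_xi], so it is its own orthogonal projection. *)
move=> n; exists (translates phi a n); split.
  split=> [|g _]; first exact: xi_K_xi.
  rewrite /ip2 (_ : (fun x => _) = cst 0).
    by rewrite (@cintegral_real R (cst 0)) /Rintegral integral0.
  by apply/funext => x; apply: (etrans (congr1 (fun z => z * _) (subrr _))); rewrite mul0r.
have op := dual_frame_op hphi ha A0 pA n.
split=> // f op'; have S0 := frame_op_inj hphi ha op op'.
have := hA _ (closed_spanB hphi (proj1 (let: And3 h _ _ := op' in h))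
  (proj1 (let: And3 h _ _ := op in h))).
rewrite S0 lee_fin pmulr_rle0// => h.
by apply/eqP; rewrite -sqrf_eq0 eq_le h sqr_ge0.
Qed.
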